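(* Let $f$ be a transcendental entire function and let $K(f)=\{z\in\mathbb{C} : (f^n(z))_{n\in\mathbb{N}} \text{ is bounded}\}$. Then $K(f)$ is either connected or has infinitely many components.
   Context: $f^n$ denotes the $n$th iterate of $f$. *)

(* Defs.v *)
From HB Require Import structures.
From mathcomp Require Import all_boot all_order all_algebra.
From mathcomp Require Import all_classical all_reals all_analysis.
From mathcomp Require Import complex.
Set Implicit Arguments. Unset Strict Implicit. Unset Printing Implicit Defensive.
Import Order.TTheory GRing.Theory Num.Theory.
Import numFieldNormedType.Exports.
Local Open Scope classical_set_scope.
Local Open Scope ring_scope.

(* the complex plane, viewed as a numFieldType (hence a normed module over
   itself, with the usual modulus topology) *)
Definition Cplx (R : realType) : numFieldType := R[i].

(* entire: complex-differentiable at every point (derivative along 1 in the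
   normed module R[i] over the field R[i]) *)
Definition entire (R : realType) (f : Cplx R -> Cplx R) : Prop :=
  forall z : Cplx R, derivable f z 1.

Definition transcendental_entire (R : realType) (f : Cplx R -> Cplx R) : Prop :=
  entire f /\ ~ (exists p : {poly Cplx R}, forall z, f z = p.[z]).

Definition bounded_orbit_set (R : realType) (f : Cplx R -> Cplx R) : set (Cplx R) :=
  [set z | exists M : Cplx R, forall n : nat, `|iter n f z| <= M].

Definition components {T : topologicalType} (A : set T) : set (set T) :=
  connected_component A @` A.

(* Main.v *)
(* Write K for the set of bounded orbits; it is completely invariant. Suppose that
   K is disconnected with finitely many components, so that every z in K has a
   disc D with D /\ K inside one component, whence f^m(D) /\ K lies in one
   component for every m. If z is also a limit of points outside K then, by
   Schottky's theorem, the iterates f^m on D cannot all omit two points taken from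
   a fixed finite set: otherwise they would be uniformly bounded near z. This
   leads to a contradiction once K has a point which is not interior (otherwise
   blow-up produces a compact disc E, not contained in K, with f^p(E) containing
   E, and hence a bounded orbit outside K) and no component is a single point
   (otherwise K has at most two points, so that f takes two values only finitely
   often and is a polynomial).

   Schottky's theorem follows from the Ahlfors-Schwarz lemma for an explicit
   complete metric of negative curvature on the plane minus two points. Applied on
   large circles it also yields the version of Picard's theorem used above. *)
Require Import Defs.
From HB Require Import structures.
From mathcomp Require Import all_boot all_order all_algebra.
From mathcomp Require Import all_classical all_reals all_analysis.
From mathcomp Require Import complex.
From mathcomp Require Import ring lra.
Set Implicit Arguments. Unset Strict Implicit. Unset Printing Implicit Defensive.
Import Order.TTheory GRing.Theory Num.Theory.
Import numFieldNormedType.Exports.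
Local Open Scope classical_set_scope.
Local Open Scope ring_scope.

(** * Complex modulus *)

(** Schottky only forces an iterate on the disc D to take one of two values, so the contradiction
    uses pairs: [p], [p'] in one component and [q], [q'] in another. The one component that contains
    f^m(D /\ K) would meet both pairs, hence equal both components; this is why components must not
    be single points. The same [m] has to serve both pairs, so the Schottky constant is made uniform
    over all bounded pairs with separation bounded below. The covering argument for open K relies on
    this uniformity too.

    Complex analysis is built from pointwise complex differentiability alone, and its shape is
    dictated by regularity: until the derivative of an entire function is known to be holomorphic,
    the functions known to be twice differentiable are those built from primitives. Maximum
    principle and Cauchy estimate are therefore proved through primitives and difference quotients,
    and curvature enters as a sum of second derivatives in the directions 1 and i. *)

Section Modulus.
Context (R : realType).
Implicit Types (z w : Cplx R) (x y : R).

Definition re z : R := complex.Re z.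
Definition im z : R := complex.Im z.
Definition mkc x y : Cplx R := Complex x y.
Definition cmod z : R := ComplexField.Normc.normc z.

Arguments mkc : simpl never.
Arguments cmod : simpl never.

Lemma normCE z : `|z| = mkc (cmod z) 0.
Proof. by case: z. Qed.

Lemma mkc_eta z : mkc (re z) (im z) = z.
Proof. by case: z. Qed.

Lemma re_mkc x y : re (mkc x y) = x. Proof. by []. Qed.
Lemma im_mkc x y : im (mkc x y) = y. Proof. by []. Qed.
Lemma reD z w : re (z + w) = re z + re w. Proof. by case: z; case: w. Qed.
Lemma imD z w : im (z + w) = im z + im w. Proof. by case: z; case: w. Qed.
Lemma reN z : re (- z) = - re z. Proof. by case: z. Qed.
Lemma imN z : im (- z) = - im z. Proof. by case: z. Qed.
Lemma reM z w : re (z * w) = re z * re w - im z * im w.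
Proof. by case: z; case: w. Qed.
Lemma imM z w : im (z * w) = re z * im w + im z * re w.
Proof. by case: z; case: w. Qed.
Lemma re0 : re 0 = 0. Proof. by []. Qed.
Lemma im0 : im 0 = 0. Proof. by []. Qed.
Lemma re1 : re 1 = 1. Proof. by []. Qed.
Lemma im1 : im 1 = 0. Proof. by []. Qed.

Definition reimE := (re_mkc, im_mkc, reD, imD, reN, imN, reM, imM, re0, im0, re1, im1).

Lemma cplx_eq z w : re z = re w -> im z = im w -> z = w.
Proof. by case: z => a b; case: w => c d; rewrite /re /im /= => -> ->. Qed.

Lemma ltCE x y : (mkc x 0 < mkc y 0) = (x < y).
Proof. exact: ltcR. Qed.

Lemma leCE x y : (mkc x 0 <= mkc y 0) = (x <= y).
Proof. exact: lecR. Qed.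

Lemma cmod_ge0 z : 0 <= cmod z.
Proof. by case: z => a b; rewrite sqrtr_ge0. Qed.

Lemma cmod_sq z : cmod z ^+ 2 = re z ^+ 2 + im z ^+ 2.
Proof. by case: z => a b; rewrite /cmod/= sqr_sqrtr ?addr_ge0 ?sqr_ge0. Qed.

Lemma cmodM z w : cmod (z * w) = cmod z * cmod w.
Proof. exact: ComplexField.Normc.normcM. Qed.

Lemma cmodD z w : cmod (z + w) <= cmod z + cmod w.
Proof. exact: le_normcD. Qed.

Lemma cmodN z : cmod (- z) = cmod z.
Proof. exact: normcN. Qed.

Lemma cmodV z : cmod z^-1 = (cmod z)^-1.
Proof. exact: ComplexField.Normc.normcV. Qed.

Lemma cmod0 : cmod 0 = 0.
Proof. exact: ComplexField.Normc.normc0. Qed.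

Lemma cmod1 : cmod 1 = 1.
Proof. exact: ComplexField.Normc.normc1. Qed.

Lemma cmodX z n : cmod (z ^+ n) = cmod z ^+ n.
Proof. by elim: n => [|n ih]; rewrite ?expr0 ?cmod1// !exprS cmodM ih. Qed.

Lemma cmod_eq0 z : (cmod z == 0) = (z == 0).
Proof.
apply/eqP/eqP => [|->]; last exact: cmod0.
exact: ComplexField.Normc.eq0_normc.
Qed.

Lemma cmod_gt0 z : (0 < cmod z) = (z != 0).
Proof. by rewrite lt_neqAle cmod_ge0 andbT eq_sym cmod_eq0. Qed.

Lemma cmodB z w : cmod (z - w) <= cmod z + cmod w.
Proof. by rewrite -(cmodN w); exact: cmodD. Qed.

Lemma cmodBC z w : cmod (z - w) = cmod (w - z).
Proof. by rewrite -cmodN opprB. Qed.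

Lemma cmod_tri z w v : cmod (z - w) <= cmod (z - v) + cmod (v - w).
Proof. by rewrite -[z - w](subrKA v) ; exact: cmodD. Qed.

Lemma cmod_sub z w : cmod z - cmod w <= cmod (z - w).
Proof. by rewrite lerBlDr -{1}(subrK w z) cmodD. Qed.

Lemma cmod_norm z w : `|cmod z - cmod w| <= cmod (z - w).
Proof. by rewrite ler_norml cmod_sub andbT lerNl opprB (cmodBC z) cmod_sub. Qed.

Lemma re_le z : `|re z| <= cmod z.
Proof.
rewrite -(@ler_pXn2r _ 2) ?nnegrE ?cmod_ge0//.
by rewrite cmod_sq real_normK ?num_real// lerDl sqr_ge0.
Qed.

Lemma im_le z : `|im z| <= cmod z.
Proof.
rewrite -(@ler_pXn2r _ 2) ?nnegrE ?cmod_ge0//.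
by rewrite cmod_sq real_normK ?num_real// lerDr sqr_ge0.
Qed.

Lemma cmod_le z : cmod z <= `|re z| + `|im z|.
Proof.
rewrite -(@ler_pXn2r _ 2) ?nnegrE ?cmod_ge0 ?addr_ge0//.
rewrite cmod_sq sqrrD !real_normK ?num_real//.
have := mulr_ge0 (normr_ge0 (re z)) (normr_ge0 (im z)); lra.
Qed.

Lemma cmod_real x : cmod (mkc x 0) = `|x|.
Proof. by rewrite /cmod/= expr0n/= addr0 sqrtr_sqr. Qed.

Lemma cmod_imag x : cmod (mkc 0 x) = `|x|.
Proof. by rewrite /cmod/= expr0n/= add0r sqrtr_sqr. Qed.

(** Balls of [Cplx R] have radii in [Cplx R] itself; a positive element is real, so its real part
    serves as radius. *)
Lemma nbhs_cmod z (A : set (Cplx R)) :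
  nbhs z A <-> exists2 e : R, 0 < e & forall w, cmod (w - z) < e -> A w.
Proof.
split.
- move=> /nbhs_ballP[e /= e0 zA]; exists (re e).
    by move: e e0 {zA} => [a b]; rewrite ltcE => /andP[].
  move=> w we; apply: zA; rewrite /ball/= normCE cmodBC.
  move: e e0 we => [a b]; rewrite ltcE/= => /andP[/eqP -> _] wa.
  by rewrite -[Complex _ _]/(mkc _ _) ltCE.
- move=> [e e0 zA]; apply/nbhs_ballP.
  exists (mkc e 0); first by rewrite /= -[0]/(mkc 0 0) ltCE.
  by move=> w; rewrite /ball/= normCE ltCE cmodBC; exact: zA.
Qed.

Lemma continuous_cmodP (T : topologicalType) (f : T -> Cplx R) (t : T) :
  {for t, continuous f} <->
  forall e, 0 < e -> \forall s \near t, cmod (f s - f t) < e.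
Proof.
split=> [fc e e0|h].
  by apply: (fc [set w | cmod (w - f t) < e]); apply/nbhs_cmod; exists e.
move=> A /nbhs_cmod[e e0 eA]; apply: filterS (h e e0) => s /eA//.
Qed.

Lemma cplx_continuousP (f : Cplx R -> Cplx R) z :
  {for z, continuous f} <->
  forall e, 0 < e -> exists2 d, 0 < d &
    forall w, cmod (w - z) < d -> cmod (f w - f z) < e.
Proof.
split=> [/continuous_cmodP h e /h/nbhs_cmod//|h].
by apply/continuous_cmodP => e /h ?; apply/nbhs_cmod.
Qed.

Lemma continuous_normP (T : topologicalType) (f : T -> R) (t : T) :
  (forall e, 0 < e -> \forall s \near t, `|f s - f t| < e) ->
  {for t, continuous f}.
Proof.
move=> h A /nbhs_ballP[e e0 eA]; apply: filterS (h e e0) => s se; apply: eA.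
by rewrite /ball/= distrC.
Qed.

Lemma cmod_continuous : continuous cmod.
Proof.
move=> z; apply: continuous_normP => e e0; apply/nbhs_cmod; exists e => //.
by move=> w wz; apply: le_lt_trans wz; exact: cmod_norm.
Qed.

Lemma re_continuous : continuous re.
Proof.
move=> z; apply: continuous_normP => e e0; apply/nbhs_cmod; exists e => //.
move=> w wz; apply: le_lt_trans wz.
by rewrite -reN -reD; exact: re_le.
Qed.

Definition disc z r : set (Cplx R) := [set w | cmod (w - z) < r].
Definition cdisc z r : set (Cplx R) := [set w | cmod (w - z) <= r].

Lemma nbhs_disc z r : 0 < r -> nbhs z (disc z r).
Proof. by move=> r0; apply/nbhs_cmod; exists r. Qed.

Lemma continuous_cmodB z : continuous (fun w => cmod (w - z)).
Proof.
move=> w; apply: continuous_normP => e e0; apply/nbhs_cmod; exists e => //.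
move=> v vw; apply: le_lt_trans vw.
by rewrite (_ : v - w = (v - z) - (w - z)); [exact: cmod_norm | ring].
Qed.

Lemma closed_cdisc z r : closed (cdisc z r).
Proof.
rewrite (_ : cdisc z r = (fun w => cmod (w - z)) @^-1` [set x | x <= r]) //.
move: (@continuous_cmodB z) => /continuous_closedP; apply; exact: closed_le.
Qed.

Lemma mkc_continuous : continuous (fun p : R * R => mkc p.1 p.2).
Proof.
move=> p; apply/continuous_cmodP => e e0.
have e20 : 0 < e / 2 by rewrite divr_gt0.
apply/nbhs_ballP; exists (e / 2) => //= q [/= h1 h2].
apply: le_lt_trans (cmod_le _) _.
move: h1 h2; rewrite /ball/= distrC => h1; rewrite distrC => h2.
by rewrite (splitr e) ltrD.
Qed.

(** A closed subset of the continuous image of a compact square of [R * R]. *)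
Lemma compact_cdisc z r : compact (cdisc z r).
Proof.
pose A : set (R * R) :=
  `[re z - r, re z + r]%classic `*` `[im z - r, im z + r]%classic.
have cA : compact ((fun p : R * R => mkc p.1 p.2) @` A).
  apply: continuous_compact; last by apply: compact_setX; exact: segment_compact.
  by apply: continuous_subspaceT; exact: mkc_continuous.
apply: subclosed_compact (@closed_cdisc z r) cA _ => w wr.
exists (re w, im w); last exact: mkc_eta.
split => /=; rewrite in_itv/=.
- have := le_trans (re_le (w - z)) wr.
  by rewrite reD reN ler_distl.
- have := le_trans (im_le (w - z)) wr.
  by rewrite imD imN ler_distl.
Qed.

Lemma disc_max (h : Cplx R -> R) z r : 0 <= r ->
  {in cdisc z r, continuous h} ->
  exists2 w, cdisc z r w & forall v, cdisc z r v -> h v <= h w.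
Proof.
move=> r0 ch.
have [||w wz hw] := @compact_EVT_max _ _ h _ _ (@compact_cdisc z r).
- by exists z; rewrite /cdisc/= subrr cmod0.
- apply: continuous_in_subspaceT; exact: ch.
- by exists w; [exact/set_mem | move=> v vz; apply: hw; exact/mem_set].
Qed.

End Modulus.
(** * Complex derivatives *)

Section Derivatives.

Lemma is_derive_epsP (K : numFieldType) (f : K -> K) (x d : K) :
  is_derive x 1 f d <->
  forall e, 0 < e -> exists2 t, 0 < t &
    forall h, `|h| < t -> `|f (x + h) - f x - d * h| <= e * `|h|.
Proof.
have key (h : K) : h != 0 ->
    `|d - h^-1 *: ((f \o shift x) (h *: 1) - f x)| * `|h| =
    `|f (x + h) - f x - d * h|.
  move=> h0; rewrite -normrM mulrBl /= /GRing.scale/= mulr1 mulrAC mulVf// mul1r.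
  by rewrite distrC (addrC h).
split.
- move=> [fx fd].
  have /cvgrPdist_le fc : (fun h => h^-1 *: ((f \o shift x) (h *: 1) - f x)) @ 0^' --> d.
    by rewrite -fd; exact: fx.
  move=> e /fc /= /nbhs_ballP[t /= t0 ht]; exists t => // h hlt.
  have [->|h0] := eqVneq h 0.
    by rewrite addr0 subrr mulr0 subrr normr0 mulr0.
  rewrite -key// ler_wpM2r// ht//.
  by rewrite /ball/= sub0r normrN.
- move=> H.
  have fc : (fun h => h^-1 *: ((f \o shift x) (h *: 1) - f x)) @ 0^' --> d.
    apply/cvgrPdist_le => e /H[t t0 ht].
    apply/nbhs_ballP; exists t => // h; rewrite /ball/= sub0r normrN => hlt h0.
    by rewrite -(@ler_pM2r _ `|h|) ?normr_gt0// key// ht.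
  split; first by apply/cvg_ex; exists d.
  by apply/cvg_lim.
Qed.

Context (R : realType).
Implicit Types (z w d : Cplx R) (f g : Cplx R -> Cplx R).

(** Real [e] and [t] keep the estimates in the totally ordered field [R], where [lra] applies,
    instead of the partially ordered [Cplx R]. *)
Definition cdiff f z d := forall e : R, 0 < e -> exists2 t : R, 0 < t &
  forall h, cmod h < t -> cmod (f (z + h) - f z - d * h) <= e * cmod h.

Lemma cdiffP f z d : is_derive z 1 f d <-> cdiff f z d.
Proof.
split=> [/is_derive_epsP H e e0|H].
- have [|t t0 ht] := H (mkc e 0); first by rewrite -[0]/(mkc 0 0) ltCE.
  exists (re t); first by move: t t0 {ht} => [a b]; rewrite ltcE => /andP[].
  move: t t0 ht => [a b]; rewrite ltcE => /andP[/eqP /= ->] _ ht h hlt.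
  have := ht h; rewrite !normCE ltCE => /(_ hlt).
  by rewrite -leCE /mkc; congr (_ <= _); apply: cplx_eq; rewrite !reimE; ring.
- apply/is_derive_epsP => e e0.
  have ee : e = mkc (re e) 0.
    by move: e e0 => [a b]; rewrite ltcE => /andP[/eqP /= ->].
  have [|t t0 ht] := H (re e).
    by move: e0; rewrite ee -[0]/(mkc 0 0) ltCE.
  exists (mkc t 0); first by rewrite -[0]/(mkc 0 0) ltCE.
  move=> h; rewrite !normCE ltCE => /ht.
  by rewrite -leCE {2}ee; congr (_ <= _); apply: cplx_eq; rewrite !reimE; ring.
Qed.

Lemma rdiffP (phi : R -> R) (x d : R) :
  is_derive x 1 phi d <->
  forall e : R, 0 < e -> exists2 t : R, 0 < t &
    forall h, `|h| < t -> `|phi (x + h) - phi x - d * h| <= e * `|h|.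
Proof. exact: is_derive_epsP. Qed.

Lemma cdiff_comp f g z d d' : cdiff g z d -> cdiff f (g z) d' ->
  cdiff (f \o g) z (d' * d).
Proof.
move=> hg hf e e0.
pose M := cmod d + 1.
have M0 : 0 < M by rewrite ltr_wpDl ?cmod_ge0.
pose e1 := e / (2 * M).
have e10 : 0 < e1 by rewrite divr_gt0// mulr_gt0.
have [t1 t10 h1] := hf e1 e10.
(* The bound 1 gives [cmod k <= M * cmod h]; the other one makes the error of [g], multiplied by
   [d'], at most half of the allowance. *)
pose e2 := Num.min 1 (e / (2 * (cmod d' + 1))).
have d'0 : 0 < cmod d' + 1 by rewrite ltr_wpDl ?cmod_ge0.
have e20 : 0 < e2 by rewrite lt_min ltr01 divr_gt0// mulr_gt0.
have [t2 t20 h2] := hg e2 e20.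
exists (Num.min t2 (t1 / M)); first by rewrite lt_min t20 divr_gt0.
move=> h; rewrite lt_min => /andP[ht2 ht1].
have := h2 h ht2; set k := g (z + h) - g z => hk.
have kM : cmod k <= M * cmod h.
  have -> : k = (k - d * h) + d * h by ring.
  apply: (le_trans (cmodD _ _)); rewrite cmodM.
  have : e2 <= 1 by rewrite ge_min lexx.
  move=> /(ler_wpM2r (cmod_ge0 h)); rewrite /M; lra.
have kt1 : cmod k < t1.
  by apply: (le_lt_trans kM); rewrite mulrC -ltr_pdivlMr.
have gk : g (z + h) = g z + k by rewrite /k; ring.
rewrite /= gk.
have -> : f (g z + k) - f (g z) - d' * d * h =
  (f (g z + k) - f (g z) - d' * k) + d' * (k - d * h) by ring.
apply: (le_trans (cmodD _ _)); rewrite cmodM.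
have A1 : e1 * cmod k <= e / 2 * cmod h.
  rewrite (_ : e / 2 * cmod h = e1 * (M * cmod h)) ?ler_pM2l//.
  by rewrite /e1; field; rewrite gt_eqF.
have A2 : cmod d' * cmod (k - d * h) <= e / 2 * cmod h.
  apply: (@le_trans _ _ ((cmod d' + 1) * (e / (2 * (cmod d' + 1)) * cmod h))).
    apply: ler_pM; rewrite ?cmod_ge0// ?lerDl//.
    apply: (le_trans hk); rewrite ler_wpM2r ?cmod_ge0//.
    by rewrite ge_min lexx orbT.
  by rewrite le_eqVlt; apply/orP; left; apply/eqP; field; rewrite gt_eqF.
have := h1 k kt1; lra.
Qed.

Lemma cdiff_continuous f z d : cdiff f z d -> {for z, continuous f}.
Proof.
move=> /cdiffP[fd _]; apply: differentiable_continuous.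
exact/derivable1_diffP.
Qed.

Lemma cdiff_ext f g z d : f =1 g -> cdiff f z d -> cdiff g z d.
Proof. by move=> /funext ->. Qed.

Lemma cdiff_near f g z d r : 0 < r -> {in disc z r, f =1 g} ->
  cdiff f z d -> cdiff g z d.
Proof.
move=> r0 fg h e /h[t t0 ht]; exists (Num.min t r); first by rewrite lt_min t0.
move=> k; rewrite lt_min => /andP[kt kr].
rewrite -!fg; first exact: ht.
  by rewrite inE /disc/= subrr cmod0.
by rewrite inE /disc/= addrAC subrr add0r.
Qed.

Lemma cdiff_id z : cdiff id z 1.
Proof. exact/cdiffP. Qed.

Lemma cdiff_cst w z : cdiff (fun=> w) z 0.
Proof. apply/cdiffP; exact: is_derive_cst. Qed.

Lemma cdiffD f g z d d' : cdiff f z d -> cdiff g z d' ->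
  cdiff (fun w => f w + g w) z (d + d').
Proof. by move=> /cdiffP hf /cdiffP hg; apply/cdiffP; exact: is_deriveD. Qed.

Lemma cdiffB f g z d d' : cdiff f z d -> cdiff g z d' ->
  cdiff (fun w => f w - g w) z (d - d').
Proof. by move=> /cdiffP hf /cdiffP hg; apply/cdiffP; exact: is_deriveB. Qed.

Lemma cdiffM f g z d d' : cdiff f z d -> cdiff g z d' ->
  cdiff (fun w => f w * g w) z (d * g z + f z * d').
Proof.
move=> /cdiffP hf /cdiffP hg; apply/cdiffP.
have := is_deriveM hf hg.
by rewrite /GRing.scale/= (addrC (f z * d')) (mulrC (g z)).
Qed.

Lemma cdiffZ f w z d : cdiff f z d -> cdiff (fun v => w * f v) z (w * d).
Proof.
move=> hf; have := cdiffM (cdiff_cst w z) hf.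
by rewrite mul0r add0r.
Qed.

Lemma cdiffX f n z d : cdiff f z d ->
  cdiff (fun v => f v ^+ n.+1) z (n.+1%:R * f z ^+ n * d).
Proof.
move=> hf; elim: n => [|n ih].
  by rewrite expr0 mulr1 mul1r.
have := cdiffM hf ih.
rewrite (_ : _ + _ = n.+2%:R * f z ^+ n.+1 * d); last first.
  by rewrite -[n.+2]addn1 natrD !exprS; ring.
by apply: cdiff_ext => v; rewrite -exprS.
Qed.

Lemma cdiffV f z d : f z != 0 -> cdiff f z d ->
  cdiff (fun v => (f v)^-1) z (- d / f z ^+ 2).
Proof.
move=> fz0 /cdiffP[fd fv]; apply/cdiffP; split; first exact: derivableV.
by rewrite (deriveV fz0 fd) fv /GRing.scale/= mulNr mulrC mulNr.
Qed.

Lemma cdiff_shift f z w d : cdiff f (z + w) d -> cdiff (fun v => f (v + w)) z d.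
Proof.
move=> hf e /hf[t t0 ht]; exists t => // h /ht.
by rewrite (addrAC z h).
Qed.

Lemma cdiff_real f z v d (t0 : R) : cdiff f (z + mkc t0 0 * v) d ->
  is_derive t0 1 (fun t : R => re (f (z + mkc t 0 * v))) (re (d * v)) /\
  is_derive t0 1 (fun t : R => im (f (z + mkc t 0 * v))) (im (d * v)).
Proof.
move=> hf.
have key e : 0 < e -> exists2 t : R, 0 < t & forall h, `|h| < t ->
  cmod (f (z + mkc (t0 + h) 0 * v) - f (z + mkc t0 0 * v) - d * v * mkc h 0) <= e * `|h|.
  move=> e0.
  have v0 : 0 < cmod v + 1 by rewrite ltr_wpDl ?cmod_ge0.
  have [|t t0' ht] := hf (e / (cmod v + 1)); first by rewrite divr_gt0.
  exists (t / (cmod v + 1)); first by rewrite divr_gt0.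
  move=> h hlt.
  have -> : z + mkc (t0 + h) 0 * v = z + mkc t0 0 * v + mkc h 0 * v.
    by apply: cplx_eq; rewrite !reimE; ring.
  have -> : d * v * mkc h 0 = d * (mkc h 0 * v) by ring.
  have hv : cmod (mkc h 0 * v) <= `|h| * (cmod v + 1).
    by rewrite cmodM cmod_real ler_wpM2l// lerDl.
  apply: (le_trans (ht _ _)).
    by apply: (le_lt_trans hv); rewrite -ltr_pdivlMr.
  apply: (@le_trans _ _ (e / (cmod v + 1) * (`|h| * (cmod v + 1)))).
    by rewrite ler_pM2l// divr_gt0.
  by rewrite le_eqVlt; apply/orP; left; apply/eqP; field; rewrite gt_eqF.
split; apply/rdiffP => e /key[t t0' ht]; exists t => // h /ht hh;
  apply: le_trans hh.
- apply: le_trans (re_le _).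
  by rewrite le_eqVlt; apply/orP; left; apply/eqP; congr (`|_|); rewrite !reimE; ring.
- apply: le_trans (im_le _).
  by rewrite le_eqVlt; apply/orP; left; apply/eqP; congr (`|_|); rewrite !reimE; ring.
Qed.

End Derivatives.
(** * Goursat's lemma and primitives *)

Section Goursat.
Context (R : realType).
Implicit Types (z w d : Cplx R) (f g : Cplx R -> Cplx R).

Lemma derivable_cont (phi : R -> R) (x d : R) :
  is_derive x 1 phi d -> {for x, continuous phi}.
Proof.
by move=> [fd _]; apply: differentiable_continuous; exact/derivable1_diffP.
Qed.

Lemma mvt_ex (phi dphi : R -> R) (a b : R) : a < b ->
  (forall t, a <= t <= b -> is_derive t 1 phi (dphi t)) ->
  exists2 c, a < c < b & phi b - phi a = dphi c * (b - a).
Proof.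
move=> ab h.
have [||c] := @MVT R phi dphi a b ab.
- by move=> t; rewrite in_itv/= => /andP[t1 t2]; apply: h; rewrite !ltW.
- apply: derivable_within_continuous => t; rewrite in_itv/= => /h[]//.
- by rewrite in_itv/= => cab e; exists c.
Qed.

Lemma mvt_le (phi dphi : R -> R) (a b M : R) : a <= b ->
  (forall t, a <= t <= b -> is_derive t 1 phi (dphi t)) ->
  (forall t, a <= t <= b -> `|dphi t| <= M) ->
  `|phi b - phi a| <= M * (b - a).
Proof.
rewrite le_eqVlt => /orP[/eqP-> _ _|ab h hM].
  by rewrite !subrr normr0 mulr0.
have [c /andP[ac cb] ->] := mvt_ex ab h; have := ltW ab.
rewrite -subr_ge0 => ba.
by rewrite normrM (ger0_norm ba) ler_wpM2r// hM// !ltW.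
Qed.

(** The integral starts at [N], so it is controlled only to the right of [N]; complex primitives are
    accordingly built on discs and then glued. *)
Lemma antiderivative (phi : R -> R) (N : R) : continuous phi ->
  exists Phi : R -> R, forall x, N < x -> is_derive x 1 Phi (phi x).
Proof.
move=> cphi.
exists (fun x => \int[lebesgue_measure]_(t in [set` Interval (BLeft N) (BRight x)]) phi t)%R.
move=> x Nx.
have [||||D E] := @continuous_FTC1_closed R phi N x (x + 1).
- by rewrite ltrDl.
- apply: continuous_compact_integrable; first exact: segment_compact.
  exact: continuous_subspaceT.
- exact: Nx.
- exact: cphi.
by split; [exact: D | rewrite -derive1E].
Qed.

Definition rderiv (u : R -> Cplx R) (t : R) (c : Cplx R) :=
  is_derive t 1 (fun s => re (u s)) (re c) /\
  is_derive t 1 (fun s => im (u s)) (im c).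

Lemma rderivB u v t c d : rderiv u t c -> rderiv v t d ->
  rderiv (fun s => u s - v s) t (c - d).
Proof.
move=> [u1 u2] [v1 v2]; split.
- rewrite (_ : (fun _ => _) = (fun s => re (u s)) - (fun s => re (v s))).
    by rewrite !reimE; exact: is_deriveB.
  by apply/funext => s; rewrite !reimE.
- rewrite (_ : (fun _ => _) = (fun s => im (u s)) - (fun s => im (v s))).
    by rewrite !reimE; exact: is_deriveB.
  by apply/funext => s; rewrite !reimE.
Qed.

Lemma rderiv_cdiff f z v d (t : R) : cdiff f (z + mkc t 0 * v) d ->
  rderiv (fun s : R => f (z + mkc s 0 * v)) t (d * v).
Proof. exact: cdiff_real. Qed.

Lemma rderiv_ext u v t c : u =1 v -> rderiv u t c -> rderiv v t c.
Proof. by move=> /funext ->. Qed.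

(** The mean value theorem is applied to both coordinates, which costs the factor 2. *)
Lemma rderiv_mvt (u du : R -> Cplx R) (a b M : R) : a <= b ->
  (forall t, a <= t <= b -> rderiv u t (du t)) ->
  (forall t, a <= t <= b -> cmod (du t) <= M) ->
  cmod (u b - u a) <= 2 * M * (b - a).
Proof.
move=> ab h hM; apply: le_trans (cmod_le _) _; rewrite !reimE.
have H1 : `|re (u b) - re (u a)| <= M * (b - a).
  apply: (@mvt_le (fun s => re (u s)) (fun s => re (du s))) => // t /[dup] tab.
  - by move=> /h[].
  - by move=> /hM; exact: le_trans (re_le _).
have H2 : `|im (u b) - im (u a)| <= M * (b - a).
  apply: (@mvt_le (fun s => im (u s)) (fun s => im (du s))) => // t /[dup] tab.
  - by move=> /h[].
  - by move=> /hM; exact: le_trans (im_le _).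
lra.
Qed.

Lemma rderiv_mvtC (u du : R -> Cplx R) (a b M : R) :
  (forall t, Num.min a b <= t <= Num.max a b -> rderiv u t (du t)) ->
  (forall t, Num.min a b <= t <= Num.max a b -> cmod (du t) <= M) ->
  cmod (u b - u a) <= 2 * M * `|b - a|.
Proof.
have [ab|ba] := leP a b => h hM.
  by rewrite ger0_norm ?subr_ge0//; exact: rderiv_mvt h hM.
rewrite cmodBC ltr0_norm ?subr_lt0// opprB.
exact: rderiv_mvt (ltW ba) h hM.
Qed.

Definition rect_diff (H : R -> R -> Cplx R) x a y b :=
  H (x + a) (y + b) - H x (y + b) - H (x + a) y + H x y.

(* Goursat's bisection needs no path integral: it only uses additivity over a
   subdivision into four rectangles, which every second difference has. Below
   H = - A + i B, where A and B are antiderivatives of f along horizontal and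
   vertical lines. *)
Lemma rect_diff_eq0 (H : R -> R -> Cplx R) x y a b : 0 <= a -> 0 <= b ->
  (forall px py, x <= px <= x + a -> y <= py <= y + b ->
     forall e, 0 < e -> exists2 t, 0 < t & forall x' a' y' b',
       x <= x' -> x' + a' <= x + a -> y <= y' -> y' + b' <= y + b ->
       0 <= a' -> 0 <= b' -> x' <= px <= x' + a' -> y' <= py <= y' + b' ->
       a' + b' < t -> cmod (rect_diff H x' a' y' b') <= e * (a' + b') ^+ 2) ->
  rect_diff H x a y b = 0.
Proof.
move=> a0 b0 loc.
pose T k (p : R * R) := rect_diff H p.1 (a / 2 ^+ k) p.2 (b / 2 ^+ k).
(* One of the four half-size rectangles carries at least a quarter of the second difference. The
   level is part of the input so that [choice] yields a single selection function. *)
have step (kp : nat * (R * R)) : exists q : R * R,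
    [/\ q.1 = kp.2.1 \/ q.1 = kp.2.1 + a / 2 ^+ kp.1.+1,
        q.2 = kp.2.2 \/ q.2 = kp.2.2 + b / 2 ^+ kp.1.+1 &
        cmod (T kp.1 kp.2) <= 4 * cmod (T kp.1.+1 q)].
  case: kp => k [u v] /=; set a' := a / 2 ^+ k.+1; set b' := b / 2 ^+ k.+1.
  have ea : a / 2 ^+ k = a' + a'.
    by rewrite /a' exprS; field; rewrite expf_neq0.
  have eb : b / 2 ^+ k = b' + b'.
    by rewrite /b' exprS; field; rewrite expf_neq0.
  have TE : T k (u, v) = T k.+1 (u, v) + T k.+1 (u + a', v) +
      T k.+1 (u, v + b') + T k.+1 (u + a', v + b').
    by rewrite /T /rect_diff /= ea eb !addrA; ring.
  have := cmodD (T k.+1 (u, v) + T k.+1 (u + a', v) + T k.+1 (u, v + b')) (T k.+1 (u + a', v + b')).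
  rewrite -TE.
  have := cmodD (T k.+1 (u, v) + T k.+1 (u + a', v)) (T k.+1 (u, v + b')).
  have := cmodD (T k.+1 (u, v)) (T k.+1 (u + a', v)).
  set t1 := cmod (T k.+1 (u, v)); set t2 := cmod (T k.+1 (u + a', v)).
  set t3 := cmod (T k.+1 (u, v + b')); set t4 := cmod (T k.+1 (u + a', v + b')).
  move=> H1 H2 H3.
  have [h1|h1] := lerP (cmod (T k (u, v))) (4 * t1).
    by exists (u, v); split => //; left.
  have [h2|h2] := lerP (cmod (T k (u, v))) (4 * t2).
    by exists (u + a', v); split => //=; [right|left].
  have [h3|h3] := lerP (cmod (T k (u, v))) (4 * t3).
    by exists (u, v + b'); split => //=; [left|right].
  exists (u + a', v + b'); split => //=; [by right|by right|].
  rewrite -/t4; lra.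
have [nxt nxtP] := choice step.
pose s := fix s k := if k is k'.+1 then nxt (k', s k') else (x, y).
have sP k : [/\ (s k.+1).1 = (s k).1 \/ (s k.+1).1 = (s k).1 + a / 2 ^+ k.+1,
        (s k.+1).2 = (s k).2 \/ (s k.+1).2 = (s k).2 + b / 2 ^+ k.+1 &
        cmod (T k (s k)) <= 4 * cmod (T k.+1 (s k.+1))] by exact: (nxtP (k, s k)).
have half c k : c / 2 ^+ k = c / 2 ^+ k.+1 + c / 2 ^+ k.+1 :> R.
  by rewrite exprS; field; rewrite expf_neq0.
have pow_ge0 c k : 0 <= c -> 0 <= c / 2 ^+ k :> R.
  by move=> c0; rewrite divr_ge0// exprn_ge0.
(* Nested intervals, used in each coordinate; the common point is the supremum of the left ends. *)
have nest (c : R) (u : nat -> R) : 0 <= c ->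
    (forall k, u k.+1 = u k \/ u k.+1 = u k + c / 2 ^+ k.+1) ->
    exists2 p, u 0%N <= p <= u 0%N + c &
      forall k, [/\ u 0%N <= u k, u k + c / 2 ^+ k <= u 0%N + c &
        u k <= p <= u k + c / 2 ^+ k].
  move=> c0 uS.
  have mono k : u k <= u k.+1 /\ u k.+1 + c / 2 ^+ k.+1 <= u k + c / 2 ^+ k.
    have := pow_ge0 c k.+1 c0; have := half c k.
    by case: (uS k) => ->; split; lra.
  have monoD k j : u k <= u (k + j)%N /\
      u (k + j)%N + c / 2 ^+ (k + j) <= u k + c / 2 ^+ k.
    elim: j => [|j [ih1 ih2]]; first by rewrite addn0.
    by rewrite addnS; have [] := mono (k + j)%N; split; lra.
  have ub k j : u j <= u k + c / 2 ^+ k.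
    have [kj|jk] := leqP k j.
      by have := monoD k (j - k)%N; rewrite subnKC// => -[_]; have := pow_ge0 c j c0; lra.
    by have := monoD j (k - j)%N; rewrite subnKC 1?ltnW// => -[+ _]; have := pow_ge0 c k c0; lra.
  have hs : has_sup (range u).
    split; first by exists (u 0%N); exists 0%N.
    by exists (u 0%N + c / 2 ^+ 0) => _ [j _ <-]; exact: ub.
  have supP k : u k <= sup (range u) <= u k + c / 2 ^+ k.
    apply/andP; split; first by apply: sup_upper_bound => //; exists k.
    by apply: ge_sup; [exact: hs.1 | move=> _ [j _ <-]; exact: ub].
  exists (sup (range u)); first by have := supP 0%N; rewrite expr0 divr1.
  move=> k; have := monoD 0%N k; rewrite add0n expr0 divr1 => -[].
  by split.
have [px pxP nx] := nest a (fun k => (s k).1) a0 (fun k => let: And3 h _ _ := sP k in h).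
have [py pyP ny] := nest b (fun k => (s k).2) b0 (fun k => let: And3 _ h _ := sP k in h).
have T4 k : cmod (rect_diff H x a y b) <= 4 ^+ k * cmod (T k (s k)).
  elim: k => [|k ih]; first by rewrite expr0 mul1r /T /= expr0 !divr1.
  apply: (le_trans ih); rewrite exprSr -mulrA ler_wpM2l ?exprn_ge0//.
  by have [] := sP k.
apply/eqP; rewrite -cmod_eq0 eq_le cmod_ge0 andbT.
apply/ler_addgt0Pr => e e0; rewrite add0r.
(* The factor [4 ^+ k] of [T4] cancels the squared side length at level [k], so only [(a + b) ^+ 2]
   has to be absorbed; the summand 1 covers a degenerate rectangle. *)
pose e' := e / ((a + b) ^+ 2 + 1).
have ab0 : 0 < (a + b) ^+ 2 + 1 by rewrite ltr_wpDl ?sqr_ge0.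
have e'0 : 0 < e' by rewrite divr_gt0.
have [t t0 ht] := loc px py pxP pyP e' e'0.
have [k hk] : exists k, (a + b) / 2 ^+ k < t.
  have [k hk] : exists k : nat, (a + b) / t < k%:R.
    by exists (Num.bound ((a + b) / t)); apply: le_lt_trans (archi_boundP _); rewrite ?ler_norm// divr_ge0// ?addr_ge0// ltW.
  exists k; rewrite ltr_pdivrMr ?exprn_gt0// mulrC -ltr_pdivrMr//.
  apply: (lt_trans hk); rewrite -natrX ltr_nat; exact: ltn_expl.
have [nx1 nx2 nx3] := nx k; have [ny1 ny2 ny3] := ny k.
have := ht _ _ _ _ nx1 nx2 ny1 ny2 (pow_ge0 _ _ a0) (pow_ge0 _ _ b0) nx3 ny3.
rewrite -mulrDl => /(_ hk) hT.
apply: (le_trans (T4 k)); apply: (@le_trans _ _ (4 ^+ k * (e' * ((a + b) / 2 ^+ k) ^+ 2))).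
  by rewrite ler_wpM2l ?exprn_ge0.
rewrite (_ : _ * _ = e' * (a + b) ^+ 2).
  by rewrite /e' mulrAC ler_pdivrMr// ler_pM2l// lerDl.
have -> : (4 : R) ^+ k = (2 ^+ k) ^+ 2.
  by rewrite -exprM mulnC exprM; congr (_ ^+ _); ring.
by field; rewrite expf_neq0.
Qed.

End Goursat.

Section Primitive.
Context (R : realType).
Implicit Types (z w d : Cplx R) (f g : Cplx R -> Cplx R).

Lemma cplx_antiderivative (u : R -> Cplx R) (N : R) :
  (forall t, exists c, rderiv u t c) ->
  exists U : R -> Cplx R, forall t, N < t -> rderiv U t (u t).
Proof.
move=> hu.
have [|P hP] := @antiderivative R (fun s => re (u s)) N.
  by move=> t; have [c [h _]] := hu t; exact: derivable_cont h.
have [|Q hQ] := @antiderivative R (fun s => im (u s)) N.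
  by move=> t; have [c [_ h]] := hu t; exact: derivable_cont h.
exists (fun t => mkc (P t) (Q t)) => t Nt; split; [exact: hP | exact: hQ].
Qed.

Lemma rderiv_horiz f (x y : R) d : cdiff f (mkc x y) d ->
  rderiv (fun t => f (mkc t y)) x d.
Proof.
move=> h.
have := @rderiv_cdiff R f (mkc 0 y) 1 d x.
have e t : mkc 0 y + mkc t 0 * 1 = mkc t y.
  by apply: cplx_eq; rewrite !reimE; ring.
by rewrite e mulr1 => /(_ h); apply: rderiv_ext => t; rewrite e.
Qed.

Lemma rderiv_vert f (x y : R) d : cdiff f (mkc x y) d ->
  rderiv (fun t => f (mkc x t)) y (d * mkc 0 1).
Proof.
move=> h.
have := @rderiv_cdiff R f (mkc x 0) (mkc 0 1) d y.
have e t : mkc x 0 + mkc t 0 * mkc 0 1 = mkc x t.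
  by apply: cplx_eq; rewrite !reimE; ring.
rewrite e => /(_ h); apply: rderiv_ext => t.
by rewrite e.
Qed.

Lemma rderiv_lin (c : Cplx R) t : rderiv (fun s => c * mkc s 0) t c.
Proof.
have h : cdiff (fun w => c * w) (mkc t 0) c.
  by have := cdiffZ c (cdiff_id (mkc t 0)); rewrite mulr1.
by have := rderiv_horiz h.
Qed.

(** Up to a constant, [F] integrates [f] from the origin, horizontally and then vertically. By
    Goursat its increment from [z] to [z + h] can be taken along two sides of their common box,
    where [f] is close to [f z]. *)
Lemma primitive_local f (N : R) : (forall z, exists d, cdiff f z d) ->
  exists F, forall z, cmod z < N -> cdiff F z (f z).
Proof.
move=> hf.
have hA (y : R) : exists U : R -> Cplx R, forall t, - N < t -> rderiv U t (f (mkc t y)).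
  apply: (cplx_antiderivative (u := fun t => f (mkc t y))) => t.
  by have [d /rderiv_horiz h] := hf (mkc t y); exists d.
have hB (x : R) : exists U : R -> Cplx R, forall t, - N < t -> rderiv U t (f (mkc x t)).
  apply: (cplx_antiderivative (u := fun t => f (mkc x t))) => t.
  by have [d /rderiv_vert h] := hf (mkc x t); exists (d * mkc 0 1).
have [A AP] := choice hA; have [B BP] := choice hB.
have bnd (c : R) : 2 * c = c + c by ring.
(* The second difference of [H] over a rectangle is the contour integral of [f] around it. *)
pose H (x y : R) := - A y x + mkc 0 1 * B x y.
have fc z : forall e : R, 0 < e -> exists2 d, 0 < d &
    forall w, cmod (w - z) < d -> cmod (f w - f z) < e.
  by have [d /cdiff_continuous/cplx_continuousP] := hf z.
have gour x y a b : - N < x -> - N < y -> 0 <= a -> 0 <= b ->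
    rect_diff H x a y b = 0.
  move=> Nx Ny a0 b0; apply: rect_diff_eq0 => // px py pxP pyP e e0.
  have [d dP] := hf (mkc px py).
  have [|t t0 ht] := dP (e / 4); first by rewrite divr_gt0.
  exists t => // x' a' y' b' xx' xa yy' yb a'0 b'0 px' py' abt.
  set z0 := mkc px py in dP ht.
  (* First-order expansion at the accumulation point. Having the primitive [Q], it contributes
     nothing around the rectangle; the remainder contributes at most [2 * (e / 4 * (a' + b'))] times
     the length of each side. *)
  pose L w := f z0 + d * (w - z0).
  have fL (u v : R) : x' <= u <= x' + a' -> y' <= v <= y' + b' ->
      cmod (f (mkc u v) - L (mkc u v)) <= e / 4 * (a' + b').
    move=> hu hv.
    have hz : cmod (mkc u v - z0) <= a' + b'.
      apply: le_trans (cmod_le _) _; rewrite !reimE.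
      by apply: lerD; rewrite ler_norml; apply/andP; split; lra.
    have := ht (mkc u v - z0) (le_lt_trans hz abt).
    rewrite (addrC z0) subrK => h.
    apply: (@le_trans _ _ (e / 4 * cmod (mkc u v - z0))).
      by apply: le_trans h; rewrite /L opprD addrA.
    by rewrite ler_pM2l// divr_gt0.
  pose Q w := f z0 * w + d * (w ^+ 2 * 2^-1 - z0 * w).
  have QP w : cdiff Q w (L w).
    have h2 : cdiff (fun v : Cplx R => v ^+ 2 * 2^-1) w w.
      have h0 := cdiffX 1 (cdiff_id w).
      have := cdiffZ 2^-1 h0.
      rewrite expr1 mulr1 mulrA mulVf ?mul1r ?pnatr_eq0//.
      by apply: cdiff_ext => v; rewrite mulrC.
    have := cdiffD (cdiffZ (f z0) (cdiff_id w)) (cdiffZ d (cdiffB h2 (cdiffZ z0 (cdiff_id w)))).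
    by rewrite !mulr1.
  have EA v : y' <= v <= y' + b' ->
    cmod ((A v (x' + a') - Q (mkc (x' + a') v)) - (A v x' - Q (mkc x' v))) <= 2 * (e / 4 * (a' + b')) * (x' + a' - x').
    move=> hv.
    apply: (@rderiv_mvt _ (fun u => A v u - Q (mkc u v)) (fun u => f (mkc u v) - L (mkc u v))).
    + by rewrite lerDl.
    + move=> u hu; apply: rderivB; last exact: rderiv_horiz.
      by apply: AP; lra.
    + by move=> u hu; exact: fL.
  (* In the real parameter of a vertical line [Q] has derivative [i * L], whereas [B] is an
     antiderivative of [f] itself; hence the factor [(mkc 0 1)^-1]. *)
  have EB u : x' <= u <= x' + a' ->
    cmod ((B u (y' + b') - (mkc 0 1)^-1 * Q (mkc u (y' + b'))) - (B u y' - (mkc 0 1)^-1 * Q (mkc u y'))) <= 2 * (e / 4 * (a' + b')) * (y' + b' - y').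
    move=> hu.
    apply: (@rderiv_mvt _ (fun v => B u v - (mkc 0 1)^-1 * Q (mkc u v)) (fun v => f (mkc u v) - L (mkc u v))).
    + by rewrite lerDl.
    + move=> v hv; apply: rderivB; first by apply: BP; lra.
      have := rderiv_vert (cdiffZ (mkc 0 1)^-1 (QP (mkc u v))).
      have i0 : mkc 0 1 != 0 :> Cplx R by rewrite -cmod_eq0 cmod_imag normr1 oner_eq0.
      by rewrite mulrAC mulVf// mul1r.
    + by move=> v hv; exact: fL.
  have i0 : mkc 0 1 != 0 :> Cplx R by rewrite -cmod_eq0 cmod_imag normr1 oner_eq0.
  have := EA y'; rewrite lexx lerDl => /(_ b'0).
  have := EA (y' + b'); rewrite lexx lerDl andbT => /(_ b'0).
  have := EB x'; rewrite lexx lerDl => /(_ a'0).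
  have := EB (x' + a'); rewrite lexx lerDl andbT => /(_ a'0).
  set q00 := Q (mkc x' y'); set q01 := Q (mkc x' (y' + b')).
  set q10 := Q (mkc (x' + a') y'); set q11 := Q (mkc (x' + a') (y' + b')).
  set B1 := (_ - _ - _ : Cplx R); set B2 := (_ - _ - _ : Cplx R).
  set A1 := (_ - _ - _ : Cplx R); set A2 := (_ - _ - _ : Cplx R).
  move=> h1 h2 h3 h4.
  have -> : rect_diff H x' a' y' b' = - A1 + A2 + mkc 0 1 * (B1 - B2).
    by rewrite /rect_diff /H /A1 /A2 /B1 /B2; field.
  have := cmodD (- A1 + A2) (mkc 0 1 * (B1 - B2)).
  have := cmodD (- A1) A2; have := cmodB B1 B2.
  rewrite cmodM cmodN cmod_imag normr1 mul1r => k1 k2 k3.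
  have ab0 : 0 <= a' * b' by rewrite mulr_ge0.
  have sq : (a' + b') ^+ 2 = (a' + b') * a' + (a' + b') * b' by ring.
  rewrite sq; lra.
pose F z := A 0 (re z) + mkc 0 1 * (B (re z) (im z) - B (re z) 0).
have N0 z : cmod z < N -> - N < 0.
  by move=> zN; rewrite oppr_lt0; exact: le_lt_trans (cmod_ge0 _) zN.
have gour2 x x' y : - N < 0 -> - N < x -> - N < x' -> - N < y ->
    H x' y - H x' 0 - H x y + H x 0 = 0.
  move=> Nn Nx Nx' Ny.
  wlog xx' : x x' Nx Nx' / x <= x'.
    move=> W; have [|/ltW h] := leP x x'; first exact: W.
    have e0 := W x' x Nx' Nx h.
    rewrite (_ : _ + _ = - (H x y - H x 0 - H x' y + H x' 0)); last by ring.
    by rewrite e0 oppr0.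
  have [y0|/ltW y0] := leP 0 y.
    have := @gour x 0 (x' - x) y Nx Nn; rewrite subr_ge0 => /(_ xx' y0).
    rewrite /rect_diff add0r (addrC x) subrK => <-; ring.
  have := @gour x y (x' - x) (- y) Nx Ny; rewrite subr_ge0 oppr_ge0 => /(_ xx' y0).
  rewrite /rect_diff subrr (addrC x) subrK => e0.
  rewrite (_ : _ + _ = - (H x' 0 - H x 0 - H x' y + H x y)); last by ring.
  by rewrite e0 oppr0.
exists F => z zN.
have zn := N0 _ zN.
move=> e e0; have [|t t0 ht] := fc z (e / 4); first by rewrite divr_gt0.
exists (Num.min t (N - cmod z)); first by rewrite lt_min t0 subr_gt0.
move=> h; rewrite lt_min => /andP[hlt hN].
set x := re z; set y := im z; set x' := re (z + h); set y' := im (z + h).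
have xE : x' = x + re h by rewrite /x' reD.
have yE : y' = y + im h by rewrite /y' imD.
have zhN : cmod (z + h) < N.
  by apply: le_lt_trans (cmodD _ _) _; lra.
have lowN w : cmod w < N -> - N < re w /\ - N < im w.
  move=> wN; split; rewrite ltrNl; apply: le_lt_trans wN.
    by apply: le_trans (re_le w); rewrite -normrN ler_norm.
  by apply: le_trans (im_le w); rewrite -normrN ler_norm.
have [Nx Ny] := lowN z zN; have [Nx' Ny'] := lowN _ zhN.
have := @gour2 x x' y' zn Nx Nx' Ny'.
rewrite /H => G.
have -> : F (z + h) - F z - f z * h =
   ((A y' x' - f z * mkc x' 0) - (A y' x - f z * mkc x 0)) +
   mkc 0 1 * ((B x y' - f z * mkc y' 0) - (B x y - f z * mkc y 0)).
  have eh : h = mkc x' 0 - mkc x 0 + mkc 0 1 * (mkc y' 0 - mkc y 0).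
    by apply: cplx_eq; rewrite /x' /y' /x /y !reimE; ring.
  rewrite {2}eh /F -/x -/y -/x' -/y'.
  apply/eqP; rewrite -subr_eq0 -[X in _ == X]G; apply/eqP; ring.
have small (u v : R) : Num.min x x' <= u <= Num.max x x' -> Num.min y y' <= v <= Num.max y y' ->
    cmod (f (mkc u v) - f z) <= e / 4.
  move=> hu hv; apply/ltW/ht; apply: le_lt_trans hlt.
  rewrite -(@ler_pXn2r _ 2) ?nnegrE ?cmod_ge0// !cmod_sq !reimE -/x -/y.
  have sqle (p q r : R) : Num.min p (p + r) <= q <= Num.max p (p + r) -> (q - p) ^+ 2 <= r ^+ 2.
    move=> hq; rewrite -[leRHS]real_normK ?num_real// -[leLHS]real_normK ?num_real//.
    rewrite ler_pXn2r ?nnegrE//.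
    have [r0|r0] := leP 0 r; move: hq.
      rewrite min_l ?lerDl// max_r ?lerDl// => hq.
      by rewrite (ger0_norm r0) ler_norml; apply/andP; split; lra.
    rewrite min_r ?gerDl ?(ltW r0)// max_l ?gerDl ?(ltW r0)// => hq.
    by rewrite (ltr0_norm r0) ler_norml; apply/andP; split; lra.
  by rewrite xE in hu; rewrite yE in hv; apply: lerD; exact: sqle.
have minE (p q : R) : Num.min p q <= p <= Num.max p q.
  by rewrite ge_min lexx le_max lexx.
have minE' (p q : R) : Num.min p q <= q <= Num.max p q.
  by rewrite ge_min lexx orbT le_max lexx orbT.
have minN (p q u : R) : - N < p -> - N < q -> Num.min p q <= u <= Num.max p q -> - N < u.
  by move=> Np Nq /andP[+ _]; apply: lt_le_trans; rewrite lt_min Np Nq.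
apply: le_trans (cmodD _ _) _.
rewrite cmodM cmod_imag normr1 mul1r.
have H1 : cmod (A y' x' - f z * mkc x' 0 - (A y' x - f z * mkc x 0)) <= 2 * (e / 4) * `|x' - x|.
  apply: (@rderiv_mvtC _ (fun u => A y' u - f z * mkc u 0) (fun u => f (mkc u y') - f z)).
    move=> u hu; apply: rderivB; last exact: rderiv_lin.
    by apply: AP; exact: minN hu.
  by move=> u hu; exact: small.
have H2 : cmod (B x y' - f z * mkc y' 0 - (B x y - f z * mkc y 0)) <= 2 * (e / 4) * `|y' - y|.
  apply: (@rderiv_mvtC _ (fun v => B x v - f z * mkc v 0) (fun v => f (mkc x v) - f z)).
    move=> v hv; apply: rderivB; last exact: rderiv_lin.
    by apply: BP; exact: minN hv.
  by move=> v hv; exact: small.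
have H3 : `|x' - x| <= cmod h by rewrite xE addrAC subrr add0r re_le.
have H4 : `|y' - y| <= cmod h by rewrite yE addrAC subrr add0r im_le.
have H5 := ler_wpM2l (ltW e0) H3; have H6 := ler_wpM2l (ltW e0) H4.
lra.
Qed.

End Primitive.
(** * Second derivatives along lines *)

Section SecondDerivative.
Context (R : realType).
Implicit Types (phi psi : R -> R) (a b c : R).

(** A relation instead of an operator, so that second derivatives are computed by chaining the rules
    below. The base point is 0 because functions on the plane are restricted to lines [w + t v]. *)
Definition D2 phi a b := exists dphi : R -> R,
  [/\ exists2 t0 : R, 0 < t0 & forall t : R, `|t| < t0 -> is_derive t 1 phi (dphi t),
      dphi 0 = a & is_derive (0 : R) 1 dphi b].

(** The first derivative vanishes at a local maximum; were [b] positive, it would be positive just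
    to the right of 0 and [phi] would increase there. *)
Lemma D2_max phi a b : D2 phi a b ->
  (exists2 t0 : R, 0 < t0 & forall t : R, `|t| < t0 -> phi t <= phi 0) -> b <= 0.
Proof.
move=> [dphi [[t0 t00 hphi] a0 hb]] [t1 t10 hmax].
have d0 : dphi 0 = 0.
  apply/eqP; rewrite -normr_eq0; apply/negPn/negP => n0.
  have n0' : 0 < `|dphi 0| by rewrite lt0r n0 /=.
  have := hphi 0; rewrite normr0 => /(_ t00)/rdiffP/(_ (`|dphi 0| / 2)).
  rewrite divr_gt0// => /(_ isT)[t2 t20 h2].
  pose t := Num.min t1 t2 / 2.
  have m0 : 0 < Num.min t1 t2 by rewrite lt_min t10.
  have tlt : t < Num.min t1 t2 by rewrite /t; lra.
  have t_gt0 : 0 < t by rewrite /t; lra.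
  move: tlt; rewrite lt_min => /andP[tt1 tt2].
  have := h2 (t * Num.sg (dphi 0)); rewrite normrM normr_sg -normr_eq0 n0 mulr1.
  rewrite (gtr0_norm t_gt0) => /(_ tt2); rewrite add0r (mulrCA (dphi 0)) (mulrC (dphi 0)) -normrEsg.
  have := hmax (t * Num.sg (dphi 0)); rewrite normrM normr_sg -normr_eq0 n0 mulr1.
  rewrite (gtr0_norm t_gt0) => /(_ tt1) h3.
  have := mulr_gt0 t_gt0 n0'.
  by rewrite ler_norml => h4 /andP[h5 h6]; lra.
rewrite leNgt; apply/negP => b0.
have /rdiffP/(_ (b / 2)) := hb; rewrite divr_gt0// => /(_ isT)[t2 t20 h2].
pose m := Num.min t0 (Num.min t1 t2).
have m0 : 0 < m by rewrite !lt_min t00 t10.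
pose t := m / 2.
have tm : t < m by rewrite /t; lra.
have t_gt0 : 0 < t by rewrite /t; lra.
move: (tm); rewrite !lt_min => /and3P[tt0 tt1 tt2].
have [|c /andP[c0 ct]] := @mvt_ex R phi dphi 0 t t_gt0.
  by move=> s /andP[s0 st]; apply: hphi; rewrite ger0_norm//; lra.
have := hmax t; rewrite (gtr0_norm t_gt0) => /(_ tt1) h3.
rewrite subr0 => e3.
have := h2 c; rewrite (gtr0_norm c0) add0r d0 subr0 => h4.
have {}h4 := h4 (lt_trans ct tt2).
have bc : 0 < b * c by rewrite mulr_gt0.
have dc : 0 < dphi c by move: h4; rewrite ler_norml => /andP[h5 h6]; lra.
have := mulr_gt0 dc t_gt0; lra.
Qed.

Lemma D2_ext phi psi a b : phi =1 psi -> D2 phi a b -> D2 psi a b.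
Proof. by move=> /funext ->. Qed.

Lemma D2D phi psi a b c d : D2 phi a b -> D2 psi c d ->
  D2 (fun t => phi t + psi t) (a + c) (b + d).
Proof.
move=> [dp [[t0 t00 h0] <- hb]] [dq [[t1 t10 h1] <- hd]].
exists (fun t => dp t + dq t); split => //.
- exists (Num.min t0 t1); first by rewrite lt_min t00.
  move=> t; rewrite lt_min => /andP[/h0 ? /h1 ?]; exact: is_deriveD.
- exact: is_deriveD.
Qed.

Lemma D2Z phi (k : R) a b : D2 phi a b -> D2 (fun t => k * phi t) (k * a) (k * b).
Proof.
move=> [dp [[t0 t00 h0] <- hb]].
exists (fun t => k * dp t); split => //.
- exists t0 => // t /h0 h; exact: (@is_deriveZ _ _ _ phi k t 1 (dp t) h).
- exact: (@is_deriveZ _ _ _ dp k 0 1 b hb).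
Qed.

Lemma D2_cst (k : R) : D2 (fun=> k) 0 0.
Proof.
exists (fun=> 0); split => //; last exact: is_derive_cst.
by exists 1 => // t _; exact: is_derive_cst.
Qed.

Lemma D2B phi psi a b c d : D2 phi a b -> D2 psi c d ->
  D2 (fun t => phi t - psi t) (a - c) (b - d).
Proof.
move=> h1 h2; have := D2D h1 (D2Z (-1) h2); rewrite !mulN1r.
by apply: D2_ext => t; rewrite mulN1r.
Qed.

Lemma D2M phi psi a b c d : D2 phi a b -> D2 psi c d ->
  D2 (fun t => phi t * psi t) (a * psi 0 + phi 0 * c)
     (b * psi 0 + 2 * a * c + phi 0 * d).
Proof.
move=> [dp [[t0 t00 h0] <- hb]] [dq [[t1 t10 h1] <- hd]].
have h00 : is_derive (0 : R) 1 phi (dp 0) by apply: h0; rewrite normr0.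
have h10 : is_derive (0 : R) 1 psi (dq 0) by apply: h1; rewrite normr0.
exists (fun t => dp t * psi t + phi t * dq t); split => //.
- exists (Num.min t0 t1); first by rewrite lt_min t00.
  move=> t; rewrite lt_min => /andP[/h0 hp /h1 hq].
  by apply: is_derive_eq (is_deriveM hp hq) _; rewrite /GRing.scale/=; ring.
- apply: is_derive_eq (is_deriveD (is_deriveM hb h10) (is_deriveM h00 hd)) _.
  by rewrite /GRing.scale/=; ring.
Qed.

Lemma D2_ln phi a b : 0 < phi 0 -> D2 phi a b ->
  D2 (fun t => ln (phi t)) (a / phi 0) (b / phi 0 - (a / phi 0) ^+ 2).
Proof.
move=> p0 [dp [[t0 t00 h0] <- hb]].
have h00 : is_derive (0 : R) 1 phi (dp 0) by apply: h0; rewrite normr0.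
have pc : {for 0, continuous phi} by exact: derivable_cont h00.
have [t1 t10 h1] : exists2 t1 : R, 0 < t1 & forall t : R, `|t| < t1 -> 0 < phi t.
  have /nbhs_ballP[t1 /= t10 ht] : nbhs 0 [set t | 0 < phi t].
    by apply: (pc [set y | 0 < y]); apply: open_nbhs_nbhs; split; [exact: open_gt|].
  by exists t1 => // t tt; apply: ht; rewrite /ball/= sub0r normrN.
exists (fun t => dp t * (phi t)^-1); split => //.
- exists (Num.min t0 t1); first by rewrite lt_min t00.
  move=> t; rewrite lt_min => /andP[/h0 hp /h1 hq].
  by apply: is_derive_eq (is_derive1_comp (is_derive1_ln hq) hp) _; rewrite mulrC.
- have hV : is_derive (0 : R) 1 (fun t => (phi t)^-1) (- (phi 0) ^- 2 *: dp 0).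
    split; first by apply: derivableV; [rewrite gt_eqF | case: h00].
    by rewrite deriveV ?gt_eqF//; case: h00 => ? ->.
  apply: is_derive_eq (is_deriveM hb hV) _.
  by rewrite /GRing.scale/=; field; rewrite gt_eqF.
Qed.

Lemma D2_quad (a b c : R) : D2 (fun t => a + b * t + c * t ^+ 2) b (2 * c).
Proof.
exists (fun t => b + 2 * c * t); split.
- exists 1 => // t _; apply/rdiffP => e e0.
  exists (e / (`|c| + 1)); first by rewrite divr_gt0// ltr_wpDl.
  move=> h hh.
  rewrite (_ : _ - _ = c * h * h); last by ring.
  rewrite !normrM ler_wpM2r//.
  have c1 : 0 < `|c| + 1 by rewrite ltr_wpDl.
  move: hh; rewrite ltr_pdivlMr// => hh.
  apply: le_trans (ltW hh); rewrite mulrC ler_wpM2l// lerDl//.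
- by rewrite mulr0 addr0.
- apply/rdiffP => e e0; exists 1 => // h _.
  rewrite (_ : _ - _ = 0); last by ring.
  by rewrite normr0 mulr_ge0// ltW.
Qed.

Lemma D2_holo (F dF : Cplx R -> Cplx R) (w v d : Cplx R) (r : R) : 0 < r ->
  (forall z, disc w r z -> cdiff F z (dF z)) -> cdiff dF w d ->
  D2 (fun t => re (F (w + mkc t 0 * v))) (re (dF w * v)) (re (d * v * v)) /\
  D2 (fun t => im (F (w + mkc t 0 * v))) (im (dF w * v)) (im (d * v * v)).
Proof.
move=> r0 hF hd.
have v0 : 0 < cmod v + 1 by rewrite ltr_wpDl ?cmod_ge0.
have near0 t : `|t| < r / (cmod v + 1) -> disc w r (w + mkc t 0 * v).
  move=> tr; rewrite /disc/= addrAC subrr add0r cmodM cmod_real.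
  move: tr; rewrite ltr_pdivlMr//; apply: le_lt_trans.
  by rewrite ler_wpM2l// lerDl.
have e0 : w + mkc 0 0 * v = w by rewrite -[mkc 0 0]/(0 : Cplx R) mul0r addr0.
have hd0 : rderiv (fun s : R => dF (w + mkc s 0 * v)) 0 (d * v).
  by apply: rderiv_cdiff; rewrite e0.
have hdv : rderiv (fun s : R => dF (w + mkc s 0 * v) * v) 0 (d * v * v).
  have h2 : cdiff (fun z => dF z * v) w (d * v).
    by have := cdiffM hd (cdiff_cst v w); rewrite mulr0 addr0.
  by apply: (@rderiv_cdiff R (fun z => dF z * v)); rewrite e0.
split.
- exists (fun t => re (dF (w + mkc t 0 * v) * v)); split => //.
  + by exists (r / (cmod v + 1)); [rewrite divr_gt0 | move=> t /near0/hF/rderiv_cdiff[]].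
  + by rewrite e0.
  + by case: hdv.
- exists (fun t => im (dF (w + mkc t 0 * v) * v)); split => //.
  + by exists (r / (cmod v + 1)); [rewrite divr_gt0 | move=> t /near0/hF/rderiv_cdiff[]].
  + by rewrite e0.
  + by case: hdv.
Qed.

End SecondDerivative.
(** * Maximum principle and Cauchy estimate *)

Section MaxModulus.
Context (R : realType).
Implicit Types (z w d : Cplx R) (f g F : Cplx R -> Cplx R) (r e M : R).

Lemma cmod_sq_line z w v (t : R) :
  cmod (w + mkc t 0 * v - z) ^+ 2 =
  cmod (w - z) ^+ 2 + 2 * (re (w - z) * re v + im (w - z) * im v) * t + cmod v ^+ 2 * t ^+ 2.
Proof. by rewrite !cmod_sq !reimE; ring. Qed.

Lemma continuous_add (T : topologicalType) (p q : T -> R) t :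
  {for t, continuous p} -> {for t, continuous q} ->
  {for t, continuous (fun x => p x + q x)}.
Proof. by move=> hp hq; exact: cvgD hp hq. Qed.

Lemma continuous_sub (T : topologicalType) (p q : T -> R) t :
  {for t, continuous p} -> {for t, continuous q} ->
  {for t, continuous (fun x => p x - q x)}.
Proof. by move=> hp hq; exact: cvgB hp hq. Qed.

Lemma continuous_mul (T : topologicalType) (p q : T -> R) t :
  {for t, continuous p} -> {for t, continuous q} ->
  {for t, continuous (fun x => p x * q x)}.
Proof. by move=> hp hq; exact: cvgM hp hq. Qed.

Lemma continuous_cst (T : topologicalType) (k : R) (t : T) :
  {for t, continuous (fun=> k)}.
Proof. exact: cvg_cst. Qed.

Lemma continuous_re_comp (T : topologicalType) (p : T -> Cplx R) t :
  {for t, continuous p} -> {for t, continuous (fun x => re (p x))}.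
Proof.
move=> hp; apply: (@continuous_comp _ _ _ p (@re R)) => //.
exact: re_continuous.
Qed.

Lemma continuous_cmod_comp (T : topologicalType) (p : T -> Cplx R) t :
  {for t, continuous p} -> {for t, continuous (fun x => cmod (p x))}.
Proof.
move=> hp; apply: (@continuous_comp _ _ _ p (@cmod R)) => //.
exact: cmod_continuous.
Qed.

(** Second-derivative test on [re F] plus a small multiple of the squared distance to [z0]. Second
    derivatives of [re F] in the directions 1 and i are opposite, so at an interior maximum the two
    sum to [4 * k > 0]. Twice differentiability is assumed of [F] because it is not yet known for
    entire functions. *)
Lemma max_re F (dF : Cplx R -> Cplx R) z0 r M : 0 < r ->
  (forall z, cdisc z0 r z -> cdiff F z (dF z)) ->
  (forall z, disc z0 r z -> exists d, cdiff dF z d) ->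
  (forall z, cmod (z - z0) = r -> re (F z) <= M) ->
  forall z, disc z0 r z -> re (F z) <= M.
Proof.
move=> r0 hF hdF hM z zr.
apply/ler_addgt0Pr => e e0.
pose k := e / r ^+ 2.
have k0 : 0 < k by rewrite divr_gt0 ?exprn_gt0.
pose h w := re (F w) + k * cmod (w - z0) ^+ 2.
have [||w wr hmax] := @disc_max R h z0 r.
- exact: ltW.
- move=> w; rewrite inE => /hF /cdiff_continuous Fc.
  apply: (continuous_add (p := fun w => re (F w)) (q := fun w => k * cmod (w - z0) ^+ 2)).
    exact: continuous_re_comp.
  apply: (continuous_mul (p := fun=> k)); first exact: continuous_cst.
  apply: (continuous_mul (p := fun w => cmod (w - z0)) (q := fun w => cmod (w - z0))).
    exact: continuous_cmodB.
  exact: continuous_cmodB.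
have hz : re (F z) <= h z by rewrite lerDl mulr_ge0 ?sqr_ge0// ltW.
apply: (le_trans hz); apply: (le_trans (hmax z (ltW zr))).
have er : k * r ^+ 2 = e by rewrite /k divfK// expf_neq0// gt_eqF.
move: wr; rewrite /cdisc/= le_eqVlt => /orP[/eqP wr|wr].
  by rewrite /h wr er lerD2r hM.
exfalso.
have [d hd] := hdF w wr.
have rw : 0 < r - cmod (w - z0) by rewrite subr_gt0.
have hFw u : disc w (r - cmod (w - z0)) u -> cdiff F u (dF u).
  move=> ur; apply: hF; rewrite /cdisc/=.
  apply: le_trans (cmod_tri u z0 w) _; move: ur; rewrite /disc/=; lra.
have key v : cmod v = 1 -> re (d * v * v) + k * 2 <= 0.
  move=> v1.
  have [H _] := D2_holo v rw hFw hd.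
  have H2 := D2_quad (cmod (w - z0) ^+ 2) (2 * (re (w - z0) * re v + im (w - z0) * im v)) (cmod v ^+ 2).
  have := D2D H (D2Z k H2); rewrite {2}v1 expr1n mulr1 => H3.
  apply: (D2_max H3); exists (r - cmod (w - z0)) => // t tr.
  rewrite -!cmod_sq_line -[X in _ <= X]/(h (w + mkc 0 0 * v)).
  rewrite [mkc 0 0](_ : _ = 0)// mul0r addr0; apply: hmax.
  rewrite /cdisc/=; apply: le_trans (cmod_tri _ z0 w) _.
  rewrite (addrC w) addrK cmodM cmod_real v1 mulr1; lra.
have := key 1 (cmod1 R); have := key (mkc 0 1); rewrite cmod_imag normr1 => /(_ erefl).
rewrite !mulr1 (_ : d * _ * _ = - d); last by apply: cplx_eq; rewrite !reimE; ring.
rewrite reN; lra.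
Qed.

Definition holo f := forall z, exists d, cdiff f z d.
Definition cderiv f z : Cplx R := 'D_1 f z.

Lemma holoP f z : holo f -> cdiff f z (cderiv f z).
Proof.
move=> /(_ z)[d h]; rewrite (_ : cderiv f z = d)//.
by move/cdiffP: h => [].
Qed.

Lemma deriv_unique f z d : cdiff f z d -> cderiv f z = d.
Proof. by move=> /cdiffP[]. Qed.

#[global] Opaque cderiv.

Lemma holo_continuous f : holo f -> continuous f.
Proof. by move=> hf z; apply: cdiff_continuous (holoP z hf). Qed.

Lemma entire_holo f : entire f <-> holo f.
Proof.
split=> hf z; first by exists ('D_1 f z); apply/cdiffP; apply: derivableP.
by have [d /cdiffP[]] := hf z.
Qed.

Lemma holo_mvt f z h M : holo f ->
  (forall t : R, 0 <= t <= 1 -> cmod (cderiv f (z + mkc t 0 * h)) <= M) ->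
  cmod (f (z + h) - f z) <= 2 * (M * cmod h).
Proof.
move=> hf hM.
have := @rderiv_mvt R (fun t => f (z + mkc t 0 * h)) (fun t => cderiv f (z + mkc t 0 * h) * h) 0 1 (M * cmod h) ler01.
rewrite subr0 mulr1 [mkc 0 0](_ : _ = 0)// mul0r addr0 [mkc 1 0](_ : _ = 1)// mul1r; apply.
- by move=> t _; apply: rderiv_cdiff; exact: holoP.
- by move=> t /hM ht; rewrite cmodM ler_wpM2r ?cmod_ge0.
Qed.

(** Only [w] is confined to the disc: difference quotients based in the disc also look outside
    it. *)
Lemma unif_cont f z0 r e : holo f -> 0 < e -> exists2 d, 0 < d &
  forall w v, cdisc z0 r w -> cmod (v - w) < d -> cmod (f v - f w) < e.
Proof.
move=> hf e0.
have := @compact_cdisc R z0 r; rewrite compact_near_coveringP.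
move=> /(_ R (0^'+) (fun (d : R) (w : Cplx R) => forall v, cmod (v - w) < d -> cmod (f v - f w) < e)).
case.
- move=> w _.
  have e20 : 0 < e / 2 by rewrite divr_gt0.
  have /cplx_continuousP /(_ _ e20)[d d0 hd] := @holo_continuous f hf w.
  have d20 : 0 < d / 2 by rewrite divr_gt0.
  exists (disc w (d / 2), [set x | x < d / 2]); first split => /=.
  + exact: nbhs_disc.
  + exact: nbhs_right_lt.
  move=> [u x] /= [uw xd] v vu.
  apply: le_lt_trans (cmod_tri _ _ (f w)) _; rewrite (cmodBC (f w)) [ltRHS](splitr e).
  apply: ltrD; apply: hd.
    apply: le_lt_trans (cmod_tri _ _ u) _; rewrite [ltRHS](splitr d); apply: ltrD => //.
    exact: lt_trans vu xd.
  by apply: lt_trans uw _; lra.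
- move=> x /= x0 hx; exists (x / 2); first by rewrite divr_gt0.
  move=> w v wr; apply: (hx (x / 2)) => //.
  + by rewrite /= sub0r normrN gtr0_norm ?divr_gt0//; lra.
  + by rewrite divr_gt0.
Qed.

Lemma deriv0_cst_disc g (N : R) : (forall z, cmod z < N -> cdiff g z 0) ->
  forall z, cmod z < N -> g z = g 0.
Proof.
move=> hg z zN.
have := @rderiv_mvt R (fun t => g (0 + mkc t 0 * z)) (fun t => 0 * z) 0 1 0 ler01.
rewrite mulr0 mul0r [mkc 0 0](_ : _ = 0)// mul0r addr0 [mkc 1 0](_ : _ = 1)// mul1r add0r.
move=> H; apply/eqP; rewrite -subr_eq0 -cmod_eq0 eq_le cmod_ge0 andbT; apply: H.
- move=> t /andP[t0 t1]; rewrite -[X in rderiv _ _ X](mul0r z); apply: rderiv_cdiff; apply: hg.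
  rewrite add0r cmodM cmod_real ger0_norm//; apply: le_lt_trans zN.
  by rewrite ler_piMl ?cmod_ge0.
- by move=> t _; rewrite cmod0.
Qed.

(** Primitives on the discs of radius [n], normalised to vanish at 0, agree on common discs because
    their difference has derivative 0. *)
Lemma primitive f : holo f -> exists F, forall z, cdiff F z (f z).
Proof.
move=> hf.
have [F0 F0P] := choice (fun n : nat => primitive_local n%:R hf).
pose F n z := F0 n z - F0 n 0.
have FP n z : cmod z < n%:R -> cdiff (F n) z (f z).
  move=> /F0P h; have := cdiffB h (cdiff_cst (F0 n 0) z).
  by rewrite subr0.
have F00 n : F n 0 = 0 by rewrite /F subrr.
have FE n m z : cmod z < n%:R -> (n <= m)%N -> F m z = F n z.
  move=> zn nm.
  have H w : cmod w < n%:R -> cdiff (fun w => F m w - F n w) w 0.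
    move=> wn; rewrite -(subrr (f w)); apply: cdiffB; apply: FP => //.
    by apply: lt_le_trans wn _; rewrite ler_nat.
  by have := deriv0_cst_disc H zn; rewrite !F00 subr0 => /subr0_eq.
pose k z := (Num.bound (cmod z)).+1.
have kP z : cmod z < (Num.bound (cmod z))%:R.
  by apply: le_lt_trans (archi_boundP (cmod_ge0 z)).
exists (fun z => F (k z) z) => z.
pose n := k z.
have FE' w : cmod w < n%:R -> F (k w) w = F n w.
  move=> wn.
  have wk : cmod w < (k w)%:R by apply: lt_trans (kP w) _; rewrite ltr_nat.
  have [nk|/ltnW kn] := leqP n (k w); first exact: FE.
  by rewrite (FE (k w) n).
have zn : cmod z < n%:R by apply: lt_trans (kP z) _; rewrite ltr_nat.
apply: (@cdiff_near R (F n) _ z (f z) (n%:R - cmod z)).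
- by rewrite subr_gt0.
- move=> w; rewrite inE /disc/= => wz; rewrite FE'//.
  by have := cmodD (w - z) z; rewrite subrK; lra.
- exact: FP.
Qed.

(** Uniformity on discs is required since the Cauchy estimate takes bounds on a whole circle as
    input. *)
Definition uderiv F f := forall z0 r e, 0 < e -> exists2 d, 0 < d &
  forall h, h != 0 -> cmod h < d -> forall w, cdisc z0 r w ->
    cmod ((F (w + h) - F w) / h - f w) <= e.

(** Subtracting the linear map of slope [f w] leaves a function with derivative [f v - f w],
    uniformly small near [w]. *)
Lemma uderiv_cont F f : holo f -> (forall z, cdiff F z (f z)) -> uderiv F f.
Proof.
move=> hf hF z0 r e e0.
have [|d d0 hd] := @unif_cont f z0 r (e / 2) hf; first by rewrite divr_gt0.
exists d => // h h0 hlt w wr.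
have ch : 0 < cmod h by rewrite cmod_gt0.
rewrite -(@ler_pM2r _ (cmod h))// -cmodM mulrBl divfK//.
pose G v := F v - f w * v.
have hG v : cdiff G v (f v - f w).
  have := cdiffB (hF v) (cdiffZ (f w) (cdiff_id v)).
  by rewrite mulr1.
have -> : F (w + h) - F w - f w * h = G (w + h) - G w by rewrite /G; ring.
apply: (@le_trans _ _ (2 * (e / 2 * cmod h))).
  apply: holo_mvt => [v|t /andP[t0 t1]]; first by exists (f v - f w).
  rewrite (deriv_unique (hG _)); apply/ltW/hd => //.
  rewrite (addrC w) addrK cmodM cmod_real ger0_norm//; apply: le_lt_trans hlt.
  by rewrite ler_piMl ?cmod_ge0.
by rewrite le_eqVlt; apply/orP; left; apply/eqP; field.
Qed.

Lemma cdiff_quot F z h d d' : cdiff F z d -> cdiff F (z + h) d' ->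
  cdiff (fun w => (F (w + h) - F w) / h) z ((d' - d) / h).
Proof.
move=> h1 /cdiff_shift h2.
have := cdiffZ h^-1 (cdiffB h2 h1); rewrite mulrC.
by apply: cdiff_ext => w; rewrite mulrC.
Qed.

(* The second-derivative test applies to the difference quotients of a primitive
   of g, which are twice differentiable, and these converge to g. *)
Theorem max_modulus g z0 r M : holo g -> 0 < r ->
  (forall z, cmod (z - z0) = r -> cmod (g z) <= M) ->
  forall z, cdisc z0 r z -> cmod (g z) <= M.
Proof.
move=> hg r0 hM z; rewrite /cdisc/= le_eqVlt => /orP[/eqP/hM//|zr].
have [G hG] := primitive hg.
have [g0|g0] := eqVneq (g z) 0.
  rewrite g0 cmod0; apply: (le_trans (cmod_ge0 (g (z0 + mkc r 0)))); apply: hM.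
  by rewrite addrAC subrr add0r cmod_real ger0_norm// ltW.
apply/ler_addgt0Pr => e e0.
have [|d d0 hd] := @uderiv_cont G g hg hG z0 r (e / 2); first by rewrite divr_gt0.
pose h := mkc (d / 2) 0.
have ch : cmod h = d / 2 by rewrite cmod_real gtr0_norm ?divr_gt0.
have h0 : h != 0 by rewrite -cmod_gt0 ch divr_gt0.
have {}hd : forall w, cdisc z0 r w -> cmod ((G (w + h) - G w) / h - g w) <= e / 2.
  by move=> w; apply: hd; rewrite // ch; lra.
(* A rotation making [g z] real and nonnegative, so that a bound on real parts bounds the
   modulus. *)
pose c := mkc (cmod (g z)) 0 / g z.
have c1 : cmod c = 1.
  by rewrite cmodM cmodV cmod_real ger0_norm ?cmod_ge0// divff// cmod_eq0.
have cg : c * g z = mkc (cmod (g z)) 0 by rewrite divfK.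
pose F w := c * ((G (w + h) - G w) / h).
have FE w : cdisc z0 r w -> cmod (F w - c * g w) <= e / 2.
  by move=> /hd; rewrite /F -mulrBr cmodM c1 mul1r.
have : re (F z) <= M + e / 2.
  apply: (@max_re F (fun w => c * ((g (w + h) - g w) / h)) z0 r) => //.
  - by move=> w _; apply: cdiffZ; exact: cdiff_quot.
  - move=> w _; exists (c * ((cderiv g (w + h) - cderiv g w) / h)).
    by apply: cdiffZ; apply: cdiff_quot; exact: holoP.
  - move=> w wr; apply: (le_trans (ler_norm _)); apply: (le_trans (re_le _)).
    have := FE w; rewrite /cdisc/= wr lexx => /(_ isT).
    have := cmod_sub (F w) (c * g w); rewrite cmodM c1 mul1r.
    by have := hM w wr; lra.
have := FE z (ltW zr); rewrite cg => h1.
have := re_le (F z - mkc (cmod (g z)) 0); rewrite reD reN re_mkc distrC => h2.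
have := ler_norm (cmod (g z) - re (F z)); lra.
Qed.

(** Stands in for taking n-th roots: by Bernoulli's inequality the powers of [x / y] would outgrow
    [b / a] if [0 < y < x]. *)
Lemma pow_cmp (a b x y : R) : 0 < a -> 0 <= y ->
  (forall n, a * x ^+ n.+1 <= b * y ^+ n.+1) -> x <= y.
Proof.
move=> a0 y0 h; rewrite leNgt; apply/negP => yx.
have x0 : 0 < x by exact: le_lt_trans yx.
move: y0; rewrite le_eqVlt => /orP[/eqP y0|y0].
  by have := h 0%N; rewrite -y0 !expr1 mulr0 leNgt mulr_gt0.
pose q := x / y.
have q1 : 0 < q - 1 by rewrite subr_gt0 ltr_pdivlMr// mul1r.
have bern n : 1 + n%:R * (q - 1) <= q ^+ n.
  elim: n => [|n ih]; first by rewrite mul0r addr0 expr0.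
  have qn : 0 < q by lra.
  have := ler_wpM2r (ltW qn) ih; rewrite -exprSr => h2; apply: le_trans h2.
  have := mulr_ge0 (mulr_ge0 (ler0n _ n) (ltW q1)) (ltW q1).
  by rewrite -natr1; set m := n%:R; lra.
pose n := Num.bound (`|b| / a / (q - 1)).
have nP : `|b| / a / (q - 1) < n%:R by apply: archi_boundP; rewrite !divr_ge0// ltW.
move: nP; rewrite ltr_pdivrMr// => nP.
have := h n; rewrite -ler_pdivrMr ?exprn_gt0// -mulrA -expr_div_n -/q => hn.
have := bern n.+1; rewrite -natr1 mulrDl mul1r => h2.
have : a * (1 + (n%:R * (q - 1) + (q - 1))) <= `|b|.
  by apply: le_trans (ler_norm b); apply: le_trans hn; rewrite ler_pM2l.
move: nP; rewrite ltr_pdivrMr// => nP.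
have := mulr_gt0 a0 q1; lra.
Qed.

(* The quotient q is only continuous at w, but (z - w) q(z)^n is holomorphic
   there; the maximum principle for all n bounds q. *)
Theorem cauchy_estimate g w r M : holo g -> 0 < r ->
  (forall z, cmod (z - w) = r -> cmod (g z) <= M) ->
  cmod (cderiv g w) <= 2 * M / r.
Proof.
move=> hg r0 hM.
pose q z := if z == w then cderiv g w else (g z - g w) / (z - w).
have M0 : 0 <= M.
  apply: (le_trans (cmod_ge0 (g (w + mkc r 0)))); apply: hM.
  by rewrite addrAC subrr add0r cmod_real ger0_norm// ltW.
have qw : q w = cderiv g w by rewrite /q eqxx.
have qc : {for w, continuous q}.
  apply/cplx_continuousP => e e0.
  have e20 : 0 < e / 2 by rewrite divr_gt0.
  have [t t0 ht] := holoP w hg e20; exists t => // v vw.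
  rewrite qw /q; case: (eqVneq v w) => [_|nvw]; first by rewrite subrr cmod0.
  have c0 : 0 < cmod (v - w) by rewrite cmod_gt0 subr_eq0.
  have := ht _ vw; rewrite (addrC w) subrK => h.
  rewrite -(@ltr_pM2r _ (cmod (v - w)))// -cmodM mulrBl divfK ?subr_eq0//.
  by apply: (le_lt_trans h); rewrite ltr_pM2r//; lra.
have hp n : holo (fun z => (z - w) * q z ^+ n.+1).
  move=> z; have [->|zw] := eqVneq z w.
    exists (q w ^+ n.+1) => e e0.
    have : {for w, continuous (fun z => q z ^+ n.+1)}.
      by apply: (@continuous_comp _ _ _ q (fun x : Cplx R => x ^+ n.+1)); [exact: qc | exact: cdiff_continuous (cdiffX n (cdiff_id _))].
    move=> /cplx_continuousP/(_ _ e0)[t t0 ht]; exists t => // h hh.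
    rewrite (addrC w) addrK subrr mul0r subr0 (mulrC h) -mulrBl cmodM ler_wpM2r ?cmod_ge0//.
    by apply/ltW; rewrite (addrC h); apply: ht; rewrite (addrC w) addrK.
  have zw0 : z - w != 0 by rewrite subr_eq0.
  have hq : cdiff (fun v => (v - w) * ((g v - g w) * (v - w)^-1) ^+ n.+1) z
     (1 * ((g z - g w) * (z - w)^-1) ^+ n.+1 + (z - w) *
       (n.+1%:R * ((g z - g w) * (z - w)^-1) ^+ n * (cderiv g z * (z - w)^-1 + (g z - g w) * (- 1 / (z - w) ^+ 2)))).
    have hb : cdiff (fun v => v - w) z 1.
      by have := cdiffB (cdiff_id z) (cdiff_cst w z); rewrite subr0.
    have hgb : cdiff (fun v => g v - g w) z (cderiv g z).
      by have := cdiffB (holoP z hg) (cdiff_cst (g w) z); rewrite subr0.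
    apply: cdiffM => //; apply: (@cdiffX R (fun v => (g v - g w) * (v - w)^-1) n); apply: cdiffM => //.
    exact: cdiffV.
  eexists; apply: (@cdiff_near R _ _ z _ (cmod (z - w))) hq; first by rewrite cmod_gt0.
  move=> v; rewrite inE /disc/= => vz.
  rewrite /q; case: (eqVneq v w) => [vw|//].
  by move: vz; rewrite vw cmodBC ltxx.
have bnd n z : cdisc w r z -> cmod (z - w) * cmod (q z) ^+ n.+1 <= r * (2 * M / r) ^+ n.+1.
  move=> zr; rewrite -cmodX -cmodM; apply: (max_modulus (hp n) r0 _ zr) => v vr.
  rewrite cmodM cmodX vr ler_pM2l// lerXn2r ?nnegrE ?cmod_ge0//.
    by rewrite divr_ge0 ?mulr_ge0// ltW.
  have vw : v != w by rewrite -subr_eq0 -cmod_gt0 vr.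
  rewrite /q (negPf vw) cmodM cmodV vr ler_pM2r ?invr_gt0//.
  have gw : cmod (g w) <= M.
    by apply: (max_modulus hg r0 hM); rewrite /cdisc/= subrr cmod0 ltW.
  by apply: (le_trans (cmodB _ _)); have := hM v vr; lra.
have qz z : z != w -> cdisc w r z -> cmod (q z) <= 2 * M / r.
  move=> zw zr; apply: (@pow_cmp (cmod (z - w)) r) => [||n]; last exact: bnd.
    by rewrite cmod_gt0 subr_eq0.
  by rewrite divr_ge0 ?mulr_ge0// ltW.
(* At [w] the left side of [bnd] is 0 and says nothing; the bound reaches [w] from a nearby point by
   continuity of [q]. *)
apply/ler_addgt0Pr => e e0.
have /cplx_continuousP/(_ _ e0)[t t0 ht] := qc.
pose s := Num.min t r / 2.
have m0 : 0 < Num.min t r by rewrite lt_min t0.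
have s0 : 0 < s by rewrite /s; lra.
have : s < Num.min t r by rewrite /s; lra.
rewrite lt_min => /andP[st sr].
have sw : cmod (w + mkc s 0 - w) = s by rewrite (addrC w) addrK cmod_real gtr0_norm.
have zw : w + mkc s 0 != w by rewrite -subr_eq0 -cmod_gt0 sw.
have := qz _ zw; rewrite /cdisc/= sw => /(_ (ltW sr)).
have := ht (w + mkc s 0); rewrite sw => /(_ st); rewrite qw cmodBC.
have := cmod_sub (cderiv g w) (q (w + mkc s 0)); lra.
Qed.

(* The difference quotients of f are the derivatives of those of its primitive
   F, so the Cauchy estimate makes them uniformly Cauchy. *)
Lemma uderivS F f : holo F -> holo f -> (forall z, cdiff F z (f z)) ->
  uderiv F f -> uderiv f (cderiv f).
Proof.
move=> holF hf hF uF z0 r e e0.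
(* The margin 1 leaves room for Cauchy circles of radius 1. Two errors [e / 8] give [e / 4] on them,
   hence [e / 2] for the derivatives; the other [e / 2] is spent on one small [k] whose quotient
   approximates the derivative. *)
have [|d d0 hd] := uF z0 (r + 1) (e / 8); first by rewrite divr_gt0.
exists d => // h h0 hh w wr.
have cau k : k != 0 -> cmod k < d ->
    cmod ((f (w + h) - f w) / h - (f (w + k) - f w) / k) <= e / 2.
  move=> k0 kd.
  pose G v := (F (v + h) - F v) / h - (F (v + k) - F v) / k.
  have GP v : cdiff G v ((f (v + h) - f v) / h - (f (v + k) - f v) / k).
    by apply: cdiffB; exact: cdiff_quot.
  rewrite -(deriv_unique (GP w)).
  have -> : e / 2 = 2 * (e / 4) / 1 by field.
  apply: cauchy_estimate => // [v|v vw]; first by eexists; exact: GP.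
  have vr : cdisc z0 (r + 1) v.
    rewrite /cdisc/=; apply: le_trans (cmod_tri v z0 w) _.
    by rewrite vw addrC lerD2r.
  rewrite (_ : G v = ((F (v + h) - F v) / h - f v) - ((F (v + k) - F v) / k - f v)); last by rewrite /G; ring.
  apply: (le_trans (cmodB _ _)).
  by have := hd h h0 hh v vr; have := hd k k0 kd v vr; lra.
have e20 : 0 < e / 2 by rewrite divr_gt0.
have [t t0 ht] := holoP w hf e20.
pose s := Num.min t d / 2.
have m0 : 0 < Num.min t d by rewrite lt_min t0.
have s0 : 0 < s by rewrite /s; lra.
have : s < Num.min t d by rewrite /s; lra.
rewrite lt_min => /andP[st sd].
pose k := mkc s 0.
have ck : cmod k = s by rewrite cmod_real gtr0_norm.
have k0 : k != 0 by rewrite -cmod_gt0 ck.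
have := ht k; rewrite ck => /(_ st) h1.
have h2 : cmod ((f (w + k) - f w) / k - cderiv f w) <= e / 2.
  by rewrite -(@ler_pM2r _ (cmod k)) ?cmod_gt0// -cmodM mulrBl divfK// ck.
have := cau k k0; rewrite ck => /(_ sd).
by have := cmod_tri ((f (w + h) - f w) / h) (cderiv f w) ((f (w + k) - f w) / k); lra.
Qed.

Lemma cplx_complete (u : nat -> Cplx R) :
  (forall e, 0 < e -> exists N, forall n m, (N <= n)%N -> (N <= m)%N -> cmod (u n - u m) <= e) ->
  exists l, forall e, 0 < e -> exists N, forall n, (N <= n)%N -> cmod (u n - l) <= e.
Proof.
move=> hu.
have key (p : Cplx R -> R) : (forall z w, `|p z - p w| <= cmod (z - w)) ->
    exists l : R, forall e, 0 < e -> exists N, forall n, (N <= n)%N -> `|p (u n) - l| <= e.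
  move=> hp.
  have : cvgn (fun n => p (u n)).
    apply/cauchy_cvgP/cauchy_ballP => e e0.
    have [|N hN] := hu (e / 2); first by rewrite divr_gt0.
    near_simpl; near=> n m; rewrite /ball/=.
    apply: le_lt_trans (hp _ _) _; apply: (@le_lt_trans _ _ (e / 2)); last by lra.
    by apply: hN; [near: n | near: m]; exists N.
  move=> /cvg_ex[l /cvgrPdist_le hl]; exists l => e /hl[N _ hN].
  by exists N => n /hN; rewrite distrC.
have [|a ha] := key (@re R).
  by move=> z w; rewrite -reN -reD re_le.
have [|b hb] := key (@im R).
  by move=> z w; rewrite -imN -imD im_le.
exists (mkc a b) => e e0.
have e20 : 0 < e / 2 by rewrite divr_gt0.
have [N1 h1] := ha _ e20; have [N2 h2] := hb _ e20.
exists (maxn N1 N2) => n; rewrite geq_max => /andP[/h1 k1 /h2 k2].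
by apply: (le_trans (cmod_le _)); rewrite !reimE; lra.
Unshelve. all: by end_near.
Qed.

(** Difference quotients of the derivative are derivatives of difference quotients of [f], which
    converge uniformly by [uderivS]. The Cauchy estimate makes the former a Cauchy family; its limit
    is found along [1 / (n + 1)]. *)
Theorem holo_deriv f : holo f -> holo (cderiv f).
Proof.
move=> hf z.
have [F hF] := primitive hf.
have holF : holo F by move=> w; exists (f w).
have uf : uderiv f (cderiv f) by apply: (uderivS holF hf hF); exact: uderiv_cont.
have cau e : 0 < e -> exists2 d, 0 < d & forall h k, h != 0 -> k != 0 ->
    cmod h < d -> cmod k < d ->
    cmod ((cderiv f (z + h) - cderiv f z) / h - (cderiv f (z + k) - cderiv f z) / k) <= e.
  move=> e0; have [|d d0 hd] := uf z 1 (e / 4); first by rewrite divr_gt0.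
  exists d => // h k h0 k0 hh hk.
  pose G v := (f (v + h) - f v) / h - (f (v + k) - f v) / k.
  have GP v : cdiff G v ((cderiv f (v + h) - cderiv f v) / h - (cderiv f (v + k) - cderiv f v) / k).
    by apply: cdiffB; apply: cdiff_quot; exact: holoP.
  rewrite -(deriv_unique (GP z)).
  have -> : e = 2 * (e / 2) / 1 by field.
  apply: cauchy_estimate => // [v|v vz]; first by eexists; exact: GP.
  have vr : cdisc z 1 v by rewrite /cdisc/= vz.
  rewrite (_ : G v = ((f (v + h) - f v) / h - cderiv f v) - ((f (v + k) - f v) / k - cderiv f v)); last by rewrite /G; ring.
  apply: (le_trans (cmodB _ _)).
  by have := hd h h0 hh v vr; have := hd k k0 hk v vr; lra.
pose h n : Cplx R := mkc n.+1%:R^-1 0.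
have ch n : cmod (h n) = n.+1%:R^-1 by rewrite cmod_real gtr0_norm.
have h0 n : h n != 0 by rewrite -cmod_gt0 ch.
have hlt (d : R) : 0 < d -> exists N, forall n, (N <= n)%N -> cmod (h n) < d.
  move=> d0; exists (Num.bound d^-1) => n Nn; rewrite ch invf_plt ?posrE//.
  apply: lt_le_trans (archi_boundP _) _; first by rewrite invr_ge0 ltW.
  by rewrite ler_nat; exact: leqW.
have [|l hl] := @cplx_complete (fun n => (cderiv f (z + h n) - cderiv f z) / h n).
  move=> e /cau[d /hlt[N hN] hd]; exists N => n m /hN Nn /hN Nm; exact: hd.
exists l => e e0.
have e20 : 0 < e / 2 by rewrite divr_gt0.
have [d d0 hd] := cau _ e20; exists d => // k kd.
have [->|k0] := eqVneq k 0; first by rewrite addr0 subrr mulr0 subrr cmod0 mulr0.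
have [N1 hN1] := hlt d d0; have [N2 hN2] := hl _ e20.
have := hN2 _ (leq_maxr N1 N2); have := hN1 _ (leq_maxl N1 N2).
set n := maxn N1 N2 => hn1 hn2.
have := hd k (h n) k0 (h0 n) kd hn1.
have := cmod_tri ((cderiv f (z + k) - cderiv f z) / k) l ((cderiv f (z + h n) - cderiv f z) / h n).
move=> h1 h2; have {h1 h2 hn2} : cmod ((cderiv f (z + k) - cderiv f z) / k - l) <= e by lra.
rewrite -(@ler_pM2r _ (cmod k)) ?cmod_gt0// -cmodM mulrBl divfK//.
Qed.

End MaxModulus.
(** * Laplacians *)

Section Laplacian.
Context (R : realType).
Implicit Types (z w v : Cplx R) (u p q : Cplx R -> R) (G : Cplx R -> Cplx R).

Definition dot z w : R := re z * re w + im z * im w.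

(** Conformality of multiplication by [c]: for [c] a complex derivative, products of directional
    derivatives summed over the directions 1 and i collapse to one inner product. *)
Lemma dot_rot z w c :
  dot z (c * 1) * dot w (c * 1) + dot z (c * mkc 0 1) * dot w (c * mkc 0 1) =
  cmod c ^+ 2 * dot z w.
Proof. by rewrite cmod_sq /dot !reimE; ring. Qed.

(* (gx, gy) is the gradient and l the Laplacian of u at w. *)
Definition Lap u w (gx gy l : R) := exists cx cy : R,
  [/\ D2 (fun t => u (w + mkc t 0 * 1)) gx cx,
      D2 (fun t => u (w + mkc t 0 * mkc 0 1)) gy cy & cx + cy = l].

Lemma line0 w v : w + mkc 0 0 * v = w.
Proof. by rewrite [mkc 0 0](_ : _ = 0)// mul0r addr0. Qed.

Lemma LapD p q w a b c a' b' c' : Lap p w a b c -> Lap q w a' b' c' ->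
  Lap (fun z => p z + q z) w (a + a') (b + b') (c + c').
Proof.
move=> [cx [cy [h1 h2 <-]]] [cx' [cy' [h1' h2' <-]]].
exists (cx + cx'), (cy + cy'); split; [exact: D2D | exact: D2D | ring].
Qed.

Lemma LapZ p w (k : R) a b c : Lap p w a b c ->
  Lap (fun z => k * p z) w (k * a) (k * b) (k * c).
Proof.
move=> [cx [cy [h1 h2 <-]]].
exists (k * cx), (k * cy); split; [exact: D2Z | exact: D2Z | ring].
Qed.

Lemma LapB p q w a b c a' b' c' : Lap p w a b c -> Lap q w a' b' c' ->
  Lap (fun z => p z - q z) w (a - a') (b - b') (c - c').
Proof.
move=> [cx [cy [h1 h2 <-]]] [cx' [cy' [h1' h2' <-]]].
exists (cx - cx'), (cy - cy'); split; [exact: D2B | exact: D2B | ring].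
Qed.

Lemma Lap_cst (k : R) w : Lap (fun=> k) w 0 0 0.
Proof. by exists 0, 0; split; [exact: D2_cst | exact: D2_cst | rewrite addr0]. Qed.

Lemma Lap_ln p w a b c : 0 < p w -> Lap p w a b c ->
  Lap (fun z => ln (p z)) w (a / p w) (b / p w)
    (c / p w - (a ^+ 2 + b ^+ 2) / p w ^+ 2).
Proof.
move=> pw [cx [cy [h1 h2 <-]]].
have k1 := D2_ln _ h1; have k2 := D2_ln _ h2.
rewrite /= !line0 in k1 k2.
exists (cx / p w - (a / p w) ^+ 2), (cy / p w - (b / p w) ^+ 2).
split; [exact: k1 | exact: k2 | field]; rewrite gt_eqF//.
Qed.

Lemma Lap_max p w a b c (r : R) : Lap p w a b c -> 0 < r ->
  (forall z, disc w r z -> p z <= p w) -> c <= 0.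
Proof.
move=> [cx [cy [h1 h2 <-]]] r0 hmax.
have H v : cmod v = 1 -> exists2 t0 : R, 0 < t0 & forall t : R, `|t| < t0 ->
    p (w + mkc t 0 * v) <= p (w + mkc 0 0 * v).
  move=> v1; exists r => // t tr; rewrite line0; apply: hmax.
  by rewrite /disc/= (addrC w) addrK cmodM cmod_real v1 mulr1.
have := D2_max h1 (H 1 (cmod1 R)); have := D2_max h2 (H (mkc 0 1) _).
by rewrite cmod_imag normr1 => /(_ erefl); lra.
Qed.

Lemma D2_eq (phi : R -> R) (a b a' b' : R) : D2 phi a b -> a = a' -> b = b' -> D2 phi a' b'.
Proof. by move=> h <- <-. Qed.

Lemma dotE z : dot z z = cmod z ^+ 2.
Proof. by rewrite cmod_sq /dot. Qed.

Lemma mul_ii z : z * mkc 0 1 * mkc 0 1 = - z.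
Proof. by apply: cplx_eq; rewrite !reimE; ring. Qed.

Lemma dotNr z w : dot z (- w) = - dot z w.
Proof. by rewrite /dot !reimE; ring. Qed.

Lemma rot_sum (a b c : Cplx R) :
  2 * cmod (a * 1) ^+ 2 + 2 * dot c (b * 1 * 1) +
  (2 * cmod (a * mkc 0 1) ^+ 2 + 2 * dot c (b * mkc 0 1 * mkc 0 1)) =
  4 * cmod a ^+ 2.
Proof. by rewrite mul_ii dotNr !mulr1 cmodM cmod_imag normr1 mulr1; ring. Qed.

(** The terms with the second derivative of [G] cancel, since 1 and i have opposite squares. *)
Lemma Lap_sq G w : holo G -> Lap (fun z => cmod (G z) ^+ 2) w
  (2 * dot (G w) (cderiv G w * 1)) (2 * dot (G w) (cderiv G w * mkc 0 1))
  (4 * cmod (cderiv G w) ^+ 2).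
Proof.
move=> hG.
have key v : D2 (fun t => cmod (G (w + mkc t 0 * v)) ^+ 2)
   (2 * dot (G w) (cderiv G w * v))
   (2 * cmod (cderiv G w * v) ^+ 2 + 2 * dot (G w) (cderiv (cderiv G) w * v * v)).
  have [h1 h2] := @D2_holo R G (cderiv G) w v _ 1 ltr01 (fun z _ => holoP z hG)
     (holoP w (holo_deriv hG)).
  have h3 := D2D (D2M h1 h1) (D2M h2 h2); rewrite !line0 in h3.
  apply: (@D2_ext _ (fun t => re (G (w + mkc t 0 * v)) * re (G (w + mkc t 0 * v)) +
     im (G (w + mkc t 0 * v)) * im (G (w + mkc t 0 * v)))).
    by move=> t; rewrite cmod_sq.
  by apply: D2_eq h3 _ _; rewrite ?cmod_sq /dot; ring.
exists (2 * cmod (cderiv G w * 1) ^+ 2 + 2 * dot (G w) (cderiv (cderiv G) w * 1 * 1)).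
exists (2 * cmod (cderiv G w * mkc 0 1) ^+ 2 + 2 * dot (G w) (cderiv (cderiv G) w * mkc 0 1 * mkc 0 1)).
split; [exact: key | exact: key | exact: rot_sum].
Qed.

(** By [dot_rot] the two terms of the Laplacian in [Lap_ln] are equal, so the logarithm is
    harmonic. *)
Lemma Lap_ln_sq G w : holo G -> G w != 0 ->
  Lap (fun z => ln (cmod (G z) ^+ 2)) w
   (2 * dot (G w) (cderiv G w * 1) / cmod (G w) ^+ 2)
   (2 * dot (G w) (cderiv G w * mkc 0 1) / cmod (G w) ^+ 2) 0.
Proof.
move=> hG G0; have c0 : 0 < cmod (G w) by rewrite cmod_gt0.
have := Lap_ln _ (Lap_sq w hG); rewrite exprn_gt0// => /(_ isT).
rewrite (_ : 4 * _ / _ - _ = 0)//.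
have := dot_rot (G w) (G w) (cderiv G w).
rewrite dotE; set x := dot _ (_ * 1); set y := dot _ (_ * mkc 0 1) => e.
have -> : (2 * x) ^+ 2 + (2 * y) ^+ 2 = 4 * (cmod (cderiv G w) ^+ 2 * cmod (G w) ^+ 2).
  by rewrite -e; ring.
by field; rewrite gt_eqF.
Qed.

End Laplacian.

(** * Schottky's theorem *)

Section Schottky.
Context (R : realType).
Implicit Types (z w v : Cplx R) (g : Cplx R -> Cplx R).

Lemma deriv_subc g (c : Cplx R) z : holo g -> cderiv (fun w => g w - c) z = cderiv g z.
Proof.
move=> hg; apply: deriv_unique.
by have := cdiffB (holoP z hg) (cdiff_cst c z); rewrite subr0.
Qed.

Lemma holo_subc g (c : Cplx R) : holo g -> holo (fun w => g w - c).
Proof. by move=> hg z; eexists; apply: cdiffB (holoP z hg) (cdiff_cst c z). Qed.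

(** The algebra behind negative curvature, with [s = |w|^2] and [m = |w - 1|^2] for [w = x + i y],
    and [li], [l0], [l1] the squares of the logarithmic factors. Near infinity, 0 or 1 the gradient
    term of that puncture dominates the density; elsewhere the density is bounded and the term 1
    suffices. *)
Lemma three_point_bound : exists2 C : R, 1 <= C & forall x y li l0 l1 s m : R,
  s = x ^+ 2 + y ^+ 2 -> m = s - 2 * x + 1 ->
  0 < s -> 0 < m -> 1 <= li -> 1 <= l0 -> 1 <= l1 ->
  (1 + s) ^+ 3 / (s * m * (li * l0 * l1)) <=
    C * (1 + 4 * (s / li + (s * l0)^-1 + (s + 2 * x + 1) / (m * l1))).
Proof.
(* Away from the punctures [s < 16], [s > 1 / 4] and [m > 1 / 4]: the numerator is below [17 ^+ 3]
   and the denominator above 1/16. The regions near the punctures need at most 80. *)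
pose C : R := 17 ^+ 3 * 16.
have C80 : 80 <= C.
  have : (17 : R) <= 17 ^+ 3 by rewrite -[leLHS]expr1 ler_weXn2l//; lra.
  rewrite /C; lra.
have CE : C * (1 / 4 * (1 / 4)) = 17 ^+ 3 by rewrite /C; field.
clearbody C; exists C; first by lra.
move=> x y li l0 l1 s m sE mE s0 m0 li1 l01 l11.
have li0 : 0 < li by lra.
have l00 : 0 < l0 by lra.
have l10 : 0 < l1 by lra.
have xs : x ^+ 2 <= s by rewrite sE lerDl sqr_ge0.
have p0 : 0 <= s + 2 * x + 1.
  by have := sqr_ge0 (x + 1); have := sqr_ge0 y; rewrite sE; lra.
have q1 : 0 <= s / li by rewrite divr_ge0// ltW.
have q2 : 0 <= (s * l0)^-1 by rewrite invr_ge0 mulr_ge0// ltW.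
have q3 : 0 <= (s + 2 * x + 1) / (m * l1) by rewrite divr_ge0// ltW// mulr_gt0.
(* The logarithmic factors are at least 1; only that of the nearby puncture is kept. *)
have drop (k a b c : R) : 0 < k -> 1 <= a -> 1 <= b -> 0 < c ->
    k / (s * m * c * (a * b)) <= k / (s * m * c).
  move=> k0 a1 b1 c0.
  have ab1 : 1 <= a * b by rewrite -[leLHS]mulr1; apply: ler_pM.
  have X0 : 0 < s * m * c by rewrite !mulr_gt0.
  have X1 : s * m * c <= s * m * c * (a * b) by rewrite -[leLHS]mulr1 ler_pM2l.
  rewrite ler_pM2l// lef_pV2 ?posrE//; exact: lt_le_trans X1.
have N0 : 0 < (1 + s) ^+ 3 by rewrite exprn_gt0//; lra.
have Cq (k q : R) : 0 <= k -> k <= 80 -> 0 <= q -> k * q <= C * q.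
  by move=> k0 k80 q0; rewrite ler_wpM2r//; lra.
have [s16|s16] := leP 16 s.
  have m9 : 9 / 16 * s <= m by have := sqr_ge0 (x / 2 - 2); rewrite mE; lra.
  apply: (@le_trans _ _ ((1 + s) ^+ 3 / (s * m * li))).
    by rewrite (_ : li * l0 * l1 = li * (l0 * l1)) ?[s * m * _]mulrA ?drop//; ring.
  apply: (@le_trans _ _ (3 * (s / li))); last first.
    apply: (@le_trans _ _ (C * (s / li))); first by apply: Cq; lra.
    by rewrite ler_wpM2l//; lra.
  rewrite ler_pdivrMr ?mulr_gt0//.
  rewrite (_ : 3 * (s / li) * (s * m * li) = 3 * s ^+ 2 * m); last by field; rewrite gt_eqF.
  apply: (@le_trans _ _ (3 * s ^+ 2 * (9 / 16 * s))); last first.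
    by rewrite ler_wpM2l// mulr_ge0// sqr_ge0.
  have h : (1 + s) ^+ 3 <= (17 / 16 * s) ^+ 3 by apply: lerXn2r; rewrite ?nnegrE; lra.
  apply: (le_trans h).
  have := exprn_gt0 3 s0; rewrite exprMn (_ : 3 * s ^+ 2 * (9 / 16 * s) = 27 / 16 * s ^+ 3); last by ring.
  rewrite (_ : (17 / 16) ^+ 3 = 4913 / 4096 :> R); [lra | by field].
have [s4|s4] := leP s (1 / 4).
  have m4 : 1 / 4 <= m by have := sqr_ge0 (x - 1 / 2); rewrite mE; lra.
  apply: (@le_trans _ _ ((1 + s) ^+ 3 / (s * m * l0))).
    by rewrite (_ : li * l0 * l1 = l0 * (li * l1)) ?[s * m * _]mulrA ?drop//; ring.
  apply: (@le_trans _ _ (8 * (s * l0)^-1)); last first.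
    apply: (@le_trans _ _ (C * (s * l0)^-1)); first by apply: Cq; lra.
    by rewrite ler_wpM2l//; lra.
  rewrite ler_pdivrMr ?mulr_gt0//.
  rewrite (_ : 8 * (s * l0)^-1 * (s * m * l0) = 8 * m); last by field; rewrite !gt_eqF.
  have h : (1 + s) ^+ 3 <= 2 ^+ 3 by apply: lerXn2r; rewrite ?nnegrE; lra.
  have h2 : (1 + s) ^+ 3 <= (5 / 4) ^+ 3 by apply: lerXn2r; rewrite ?nnegrE; lra.
  apply: (le_trans h2); rewrite (_ : (5 / 4) ^+ 3 = 125 / 64 :> R); [lra | by field].
have [m4|m4] := leP m (1 / 4).
  have xx : (x - 1) ^+ 2 <= 1 / 4 by have := sqr_ge0 y; move: m4; rewrite mE sE; lra.
  have x12 : 1 / 2 <= x <= 3 / 2 by apply/andP; split; nra.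
  apply: (@le_trans _ _ ((1 + s) ^+ 3 / (s * m * l1))).
    by rewrite (_ : li * l0 * l1 = l1 * (li * l0)) ?[s * m * _]mulrA ?drop//; ring.
  apply: (@le_trans _ _ (80 * ((s + 2 * x + 1) / (m * l1)))); last first.
    apply: (@le_trans _ _ (C * ((s + 2 * x + 1) / (m * l1)))); first by apply: Cq; lra.
    by rewrite ler_wpM2l//; lra.
  rewrite ler_pdivrMr ?mulr_gt0//.
  rewrite (_ : 80 * ((s + 2 * x + 1) / (m * l1)) * (s * m * l1) = 80 * (s + 2 * x + 1) * s); last by field; rewrite !gt_eqF.
  have h2 : (1 + s) ^+ 3 <= (13 / 4) ^+ 3 by apply: lerXn2r; rewrite ?nnegrE; lra.
  apply: (le_trans h2); rewrite (_ : (13 / 4) ^+ 3 = 2197 / 64 :> R); last by field.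
  case/andP: x12 => x1 x2.
  have h : (2 : R) * (1 / 4) <= (s + 2 * x + 1) * s by apply: ler_pM; lra.
  by rewrite -mulrA; lra.
apply: (@le_trans _ _ C); last by rewrite ler_peMr//; lra.
have P1 : 1 <= li * l0 * l1.
  rewrite -[leLHS]mulr1; apply: ler_pM => //.
  by rewrite -[leLHS]mulr1; apply: ler_pM.
rewrite ler_pdivrMr ?mulr_gt0//.
apply: (@le_trans _ _ (17 ^+ 3)); first by apply: lerXn2r; rewrite ?nnegrE; lra.
rewrite -CE -[leLHS]mulr1 -mulrA ler_pM2l; last by lra.
have h1 : (1 / 4 : R) * (1 / 4) <= s * m by apply: ler_pM; lra.
rewrite mulr1; apply: (le_trans h1).
by rewrite ler_peMr// ltW// mulr_gt0.
Qed.

(* 12 - ln s, where s <= 1 is the normalized squared chordal distance from g z to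
   the puncture infinity, 0 or 1. The offset 12 makes
   1 - 2 (1/Linfty + 1/Lzero + 1/Lone) at least 1/2 in the curvature estimate. *)
Definition Linfty g z : R := 12 + ln (1 + cmod (g z) ^+ 2).
Definition Lzero g z : R := 12 + ln (1 + cmod (g z) ^+ 2) - ln (cmod (g z) ^+ 2).
Definition Lone g z : R :=
  12 + ln 2 + ln (1 + cmod (g z) ^+ 2) - ln (cmod (g z - 1) ^+ 2).

Lemma sq1_gt0 z : 0 < 1 + cmod z ^+ 2.
Proof. by have := sqr_ge0 (cmod z); lra. Qed.

Lemma cmodB1 z : cmod (z - 1) ^+ 2 = cmod z ^+ 2 - 2 * re z + 1.
Proof. by rewrite !cmod_sq !reimE; ring. Qed.

Lemma Linfty_ge g z : 12 <= Linfty g z.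
Proof. by rewrite /Linfty lerDl ln_ge0// lerDl sqr_ge0. Qed.

Lemma Lzero_ge g z : g z != 0 -> 12 <= Lzero g z.
Proof.
move=> g0; have c0 : 0 < cmod (g z) ^+ 2 by rewrite exprn_gt0// cmod_gt0.
rewrite /Lzero -addrA lerDl subr_ge0 ler_ln ?posrE ?sq1_gt0//; lra.
Qed.

(** [|w + 1|^2 >= 0] rearranges to [|w - 1|^2 <= 2 (1 + |w|^2)]; this accounts for the [ln 2] in
    [Lone]. *)
Lemma Lone_ge g z : g z != 1 -> 12 <= Lone g z.
Proof.
move=> g0; have c1 : 0 < cmod (g z - 1) by rewrite cmod_gt0 subr_eq0.
have c0 : 0 < cmod (g z - 1) ^+ 2 by rewrite exprn_gt0.
rewrite -subr_ge0 /Lone.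
rewrite (_ : _ - 12 = ln 2 + ln (1 + cmod (g z) ^+ 2) - ln (cmod (g z - 1) ^+ 2)); last by ring.
rewrite subr_ge0 -lnM ?posrE ?sq1_gt0// ler_ln ?posrE ?mulr_gt0 ?sq1_gt0//.
rewrite cmodB1 cmod_sq; have := sqr_ge0 (re (g z) + 1); have := sqr_ge0 (im (g z)); lra.
Qed.

End Schottky.

(** * The Ahlfors-Schwarz comparison with the hyperbolic disc *)

Section AhlforsBound.
Context (R : realType).
Implicit Types (z w v : Cplx R) (g : Cplx R -> Cplx R).

Definition disc_weight z0 (r : R) z : R := r ^+ 2 - cmod (z - z0) ^+ 2.

(* Square of the ratio, at z, of the pull-back by g of the complete metric
   |dw| / (prod_j s_j^(1/2) L_j (1 + |w|^2)) on the plane minus 0 and 1, where s_j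
   are squared chordal distances to the punctures, and the hyperbolic metric of
   the disc (up to a constant). *)
Definition metric_ratio g z0 (r : R) z : R :=
  disc_weight z0 r z ^+ 2 * cmod (cderiv g z) ^+ 2 * (1 + cmod (g z) ^+ 2) /
  (cmod (g z) ^+ 2 * cmod (g z - 1) ^+ 2 * (Linfty g z ^+ 2 * Lzero g z ^+ 2 * Lone g z ^+ 2)).

(** The Laplacian rules act on this sum term by term. The quotient is kept beside it because it
    stays meaningful at zeros of the derivative, where the logarithm does not. *)
Definition log_metric_ratio g z0 (r : R) z : R :=
  2 * ln (disc_weight z0 r z) + ln (cmod (cderiv g z) ^+ 2) + ln (1 + cmod (g z) ^+ 2)
  - ln (cmod (g z) ^+ 2) - ln (cmod (g z - 1) ^+ 2)
  - 2 * (ln (Linfty g z) + ln (Lzero g z) + ln (Lone g z)).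

Lemma cmod_near_neq0 z w : cmod (z - w) < cmod w -> z != 0.
Proof. by move=> h; apply: contraTneq h => ->; rewrite sub0r cmodN ltxx. Qed.

Section Ahlfors.
Context (g : Cplx R -> Cplx R) (z0 : Cplx R) (r : R).
Hypothesis hg : holo g.
Hypothesis r0 : 0 < r.
Hypothesis omit : forall z, cdisc z0 r z -> g z != 0 /\ g z != 1.

Variable C0 : R.
Hypothesis C01 : 1 <= C0.
Hypothesis C0P : forall x y li l0 l1 s m : R,
  s = x ^+ 2 + y ^+ 2 -> m = s - 2 * x + 1 ->
  0 < s -> 0 < m -> 1 <= li -> 1 <= l0 -> 1 <= l1 ->
  (1 + s) ^+ 3 / (s * m * (li * l0 * l1)) <=
    C0 * (1 + 4 * (s / li + (s * l0)^-1 + (s + 2 * x + 1) / (m * l1))).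

Local Notation rho := (disc_weight z0 r).
Local Notation E := (metric_ratio g z0 r).
Local Notation Psi := (log_metric_ratio g z0 r).

Lemma Lap_rho w : Lap rho w (- 2 * dot (w - z0) 1) (- 2 * dot (w - z0) (mkc 0 1)) (- 4).
Proof.
have h : holo (fun z => z - z0).
  move=> z; exists 1.
  by have := cdiffB (cdiff_id z) (cdiff_cst z0 z); rewrite subr0.
have d1 : cderiv (fun z => z - z0) w = 1.
  apply: deriv_unique.
  by have := cdiffB (cdiff_id w) (cdiff_cst z0 w); rewrite subr0.
have := LapB (Lap_cst (r ^+ 2) w) (Lap_sq w h).
by rewrite d1 cmod1 !mul1r expr1n mulr1 !sub0r !mulNr.
Qed.

Lemma E_continuous z : cdisc z0 r z -> {for z, continuous E}.
Proof.
move=> /omit[g0 g1].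
have cg : {for z, continuous g} by exact: holo_continuous.
have cg1 : {for z, continuous (fun w => g w - 1)} by exact: (holo_continuous (holo_subc 1 hg)).
have cd : {for z, continuous (cderiv g)} by exact: (holo_continuous (holo_deriv hg)).
have csq (p : Cplx R -> R) : {for z, continuous p} -> {for z, continuous (fun w => p w ^+ 2)}.
  by move=> hp; exact: (continuous_mul (p := p) (q := p)).
have cln (p : Cplx R -> R) : 0 < p z -> {for z, continuous p} -> {for z, continuous (fun w => ln (p w))}.
  move=> p0 hp; apply: (@continuous_comp _ _ _ p (@ln R)) => //.
  exact: continuous_ln.
have cB (p q : Cplx R -> R) : {for z, continuous p} -> {for z, continuous q} -> {for z, continuous (fun w => p w - q w)}.
  by move=> hp hq; exact: cvgB hp hq.
have cV (p : Cplx R -> R) : p z != 0 -> {for z, continuous p} -> {for z, continuous (fun w => (p w)^-1)}.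
  by move=> p0 hp; exact: cvgV p0 hp.
have s0 : 0 < cmod (g z) ^+ 2 by rewrite exprn_gt0// cmod_gt0.
have m0 : 0 < cmod (g z - 1) ^+ 2 by rewrite exprn_gt0// cmod_gt0 subr_eq0.
have cs : {for z, continuous (fun w => cmod (g w) ^+ 2)}.
  by apply: (csq (fun w => cmod (g w))); exact: (@continuous_cmod_comp R _ g z cg).
have cm : {for z, continuous (fun w => cmod (g w - 1) ^+ 2)}.
  by apply: (csq (fun w => cmod (g w - 1))); exact: (@continuous_cmod_comp R _ _ z cg1).
have c1s : {for z, continuous (fun w => 1 + cmod (g w) ^+ 2)}.
  by apply: (continuous_add (p := fun=> 1)) cs; exact: continuous_cst.
have cL : {for z, continuous (Linfty g)}.
  apply: (continuous_add (p := fun=> 12)); first exact: continuous_cst.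
  by apply: (cln (fun w => 1 + cmod (g w) ^+ 2)) => //; exact: sq1_gt0.
have cL0 : {for z, continuous (Lzero g)}.
  apply: (cB (Linfty g)) => //.
  exact: (cln (fun w => cmod (g w) ^+ 2)).
have cL1 : {for z, continuous (Lone g)}.
  apply: (cB (fun w => 12 + ln 2 + ln (1 + cmod (g w) ^+ 2))); last first.
    exact: (cln (fun w => cmod (g w - 1) ^+ 2)).
  apply: (continuous_add (p := fun=> 12 + ln 2)); first exact: continuous_cst.
  by apply: (cln (fun w => 1 + cmod (g w) ^+ 2)) => //; exact: sq1_gt0.
have Li0 := Linfty_ge g z; have L00 := Lzero_ge g0; have L10 := Lone_ge g1.
rewrite /metric_ratio; apply: (continuous_mul (p := fun w => rho w ^+ 2 * cmod (cderiv g w) ^+ 2 * (1 + cmod (g w) ^+ 2))).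
  apply: (continuous_mul (p := fun w => rho w ^+ 2 * cmod (cderiv g w) ^+ 2)) => //.
  apply: (continuous_mul (p := fun w => rho w ^+ 2)).
    apply: (csq rho); apply: (cB (fun=> r ^+ 2)); first exact: continuous_cst.
    by apply: (csq (fun w => cmod (w - z0))); exact: continuous_cmodB.
  by apply: (csq (fun w => cmod (cderiv g w))); exact: (@continuous_cmod_comp R _ _ z cd).
apply: (cV (fun w => cmod (g w) ^+ 2 * cmod (g w - 1) ^+ 2 * (Linfty g w ^+ 2 * Lzero g w ^+ 2 * Lone g w ^+ 2))).
  have cg00 : 0 < cmod (g z) by rewrite cmod_gt0.
  have cg10 : 0 < cmod (g z - 1) by rewrite cmod_gt0 subr_eq0.
  have Li1 : 0 < Linfty g z by apply: lt_le_trans Li0.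
  have L01 : 0 < Lzero g z by apply: lt_le_trans L00.
  have L11 : 0 < Lone g z by apply: lt_le_trans L10.
  by rewrite gt_eqF// !mulr_gt0.
apply: (continuous_mul (p := fun w => cmod (g w) ^+ 2 * cmod (g w - 1) ^+ 2)).
  exact: (continuous_mul cs cm).
apply: (continuous_mul (p := fun w => Linfty g w ^+ 2 * Lzero g w ^+ 2)); last exact: (csq (Lone g)).
by apply: (continuous_mul (p := fun w => Linfty g w ^+ 2)); [exact: (csq (Linfty g)) | exact: (csq (Lzero g))].
Qed.

Lemma PsiE z : g z != 0 -> g z != 1 -> 0 < rho z -> cderiv g z != 0 ->
  0 < E z /\ ln (E z) = Psi z.
Proof.
move=> g0 g1 p0 d0.
have s0 : 0 < cmod (g z) ^+ 2 by rewrite exprn_gt0// cmod_gt0.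
have m0 : 0 < cmod (g z - 1) ^+ 2 by rewrite exprn_gt0// cmod_gt0 subr_eq0.
have D0 : 0 < cmod (cderiv g z) ^+ 2 by rewrite exprn_gt0// cmod_gt0.
have cg0 : 0 < cmod (g z) by rewrite cmod_gt0.
have cg1 : 0 < cmod (g z - 1) by rewrite cmod_gt0 subr_eq0.
have cd0 : 0 < cmod (cderiv g z) by rewrite cmod_gt0.
have N0 := sq1_gt0 (g z).
have Li0 : 0 < Linfty g z by apply: lt_le_trans (Linfty_ge g z).
have L00 : 0 < Lzero g z by apply: lt_le_trans (Lzero_ge g0).
have L10 : 0 < Lone g z by apply: lt_le_trans (Lone_ge g1).
have r2 := exprn_gt0 2 p0.
have Li2 := exprn_gt0 2 Li0; have L02 := exprn_gt0 2 L00; have L12 := exprn_gt0 2 L10.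
split; first by rewrite /metric_ratio divr_gt0// !mulr_gt0.
rewrite /metric_ratio ln_div ?posrE ?mulr_gt0// 2?lnM ?posrE ?mulr_gt0//.
rewrite lnM ?posrE ?mulr_gt0// lnM ?posrE ?mulr_gt0// lnM ?posrE ?mulr_gt0//.
rewrite lnM ?posrE ?mulr_gt0//.
rewrite (lnXn 2 p0) (lnXn 2 Li0) (lnXn 2 L00) (lnXn 2 L10) /log_metric_ratio; ring.
Qed.

(** At a maximum the Laplacian of [Psi] is at most 0. The disc contributes
    [- 8 * r ^+ 2 / rho ^+ 2], so the curvature terms of the pulled-back metric are at most the
    opposite of this ([key]), and [C0P] bounds its density by those terms. *)
Lemma ahlfors_max w (t : R) : cmod (w - z0) < r -> 0 < t -> 0 < E w ->
  (forall z, disc w t z -> E z <= E w) -> E w <= 4 * C0 * r ^+ 2.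
Proof.
move=> wr t0 Ew hmax.
have [g0 g1] := omit (ltW wr).
have d0 : cderiv g w != 0.
  by apply/negP => /eqP d0; move: Ew; rewrite /metric_ratio d0 cmod0 expr0n/= !(mulr0, mul0r) ltxx.
have rho_pos z : cmod (z - z0) < r -> 0 < rho z.
  by move=> zr; rewrite subr_gt0 ltr_pXn2r ?nnegrE ?cmod_ge0// ltW.
have p0 := rho_pos w wr.
have D0 : 0 < cmod (cderiv g w) by rewrite cmod_gt0.
have cd : {for w, continuous (cderiv g)} by exact: (holo_continuous (holo_deriv hg)).
(* Near [w] the derivative stays nonzero, so [Psi] is the logarithm of [E] there and has its maximum
   at [w] as well. *)
have /cplx_continuousP/(_ _ D0)[t1 t10 ht1] := cd.
pose T := Num.min t (Num.min t1 (r - cmod (w - z0))).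
have T0 : 0 < T by rewrite !lt_min t0 t10 subr_gt0.
have Pmax z : disc w T z -> Psi z <= Psi w.
  rewrite /disc/= !lt_min => /and3P[zt zt1 zr].
  have zr' : cmod (z - z0) < r.
    by apply: le_lt_trans (cmod_tri z z0 w) _; lra.
  have [gz0 gz1] := omit (ltW zr').
  have dz : cderiv g z != 0.
    exact: cmod_near_neq0 (ht1 z zt1).
  have [Ez <-] := PsiE gz0 gz1 (rho_pos z zr') dz.
  have [_ <-] := PsiE g0 g1 p0 d0.
  by rewrite ler_ln ?posrE// hmax.
have s0 : 0 < cmod (g w) ^+ 2 by rewrite exprn_gt0// cmod_gt0.
have m0 : 0 < cmod (g w - 1) ^+ 2 by rewrite exprn_gt0// cmod_gt0 subr_eq0.
have N0 := sq1_gt0 (g w).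
have Li12 := Linfty_ge g w; have L012 := Lzero_ge g0; have L112 := Lone_ge g1.
have Li0 : 0 < Linfty g w by lra.
have L00 : 0 < Lzero g w by lra.
have L10 : 0 < Lone g w by lra.
have A1 := LapD (Lap_cst 1 w) (Lap_sq w hg).
have A2 := Lap_ln N0 A1.
have A3 := Lap_ln_sq hg g0.
have g10 : g w - 1 != 0 by rewrite subr_eq0.
have A4 := Lap_ln_sq (holo_subc 1 hg) g10.
rewrite deriv_subc// in A4.
have A5 := Lap_ln_sq (holo_deriv hg) d0.
have B1 := Lap_ln Li0 (LapD (Lap_cst 12 w) A2).
have B2 := Lap_ln L00 (LapB (LapD (Lap_cst 12 w) A2) A3).
have B3 := Lap_ln L10 (LapB (LapD (Lap_cst (12 + ln 2) w) A2) A4).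
have B4 := Lap_ln p0 (Lap_rho w).
have H := LapB (LapB (LapB (LapD (LapD (LapZ 2 B4) A5) A2) A3) A4)
   (LapZ 2 (LapD (LapD B1 B2) B3)).
have := Lap_max H T0 Pmax; clear H B1 B2 B3 B4 A1 A2 A3 A4 A5 Pmax hmax.
have i00 := dot_rot (g w) (g w) (cderiv g w).
have i01 := dot_rot (g w) (g w - 1) (cderiv g w).
have i11 := dot_rot (g w - 1) (g w - 1) (cderiv g w).
have iz := dot_rot (w - z0) (w - z0) 1; rewrite !mul1r cmod1 expr1n mul1r in iz.
rewrite !dotE in i00 i11 iz.
move: i00 i01 i11 iz.
set a0 := dot (g w) (cderiv g w * 1); set b0 := dot (g w) (cderiv g w * mkc 0 1).
set a1 := dot (g w - 1) (cderiv g w * 1); set b1 := dot (g w - 1) (cderiv g w * mkc 0 1).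
set az := dot (w - z0) 1; set bz := dot (w - z0) (mkc 0 1).
set c := dot (g w) (g w - 1); set D := cmod (cderiv g w) ^+ 2.
have cE : c = cmod (g w) ^+ 2 - re (g w) by rewrite /c cmod_sq /dot !reimE; ring.
have mE := cmodB1 (g w).
have sE := cmod_sq (g w).
have sq12 (l : R) : 12 <= l -> 1 <= l ^+ 2.
  by move=> l12; rewrite -[leLHS](expr1n _ 2); apply: lerXn2r; rewrite ?nnegrE; lra.
have := C0P sE mE s0 m0 (sq12 _ Li12) (sq12 _ L012) (sq12 _ L112).
rewrite /metric_ratio -/D.
have {}D0 : 0 < D by rewrite exprn_gt0.
have rz : cmod (w - z0) ^+ 2 = r ^+ 2 - rho w by rewrite /disc_weight; ring.
rewrite rz.
move: (cmod (g w) ^+ 2) (cmod (g w - 1) ^+ 2) (Linfty g w) (Lzero g w) (Lone g w) (re (g w)) (rho w)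
  s0 m0 Li0 L00 L10 Li12 L012 L112 p0 N0 cE mE {rz sE Ew}.
move=> s m li l0 l1 x rh s0 m0 Li0 L00 L10 Li12 L012 L112 p0 N0 cE mE TP i00 i01 i11 iz LAP.
have sn : s != 0 by rewrite gt_eqF.
have mn : m != 0 by rewrite gt_eqF.
have Nn : 1 + s != 0 by rewrite gt_eqF.
have lin : li != 0 by rewrite gt_eqF.
have l0n : l0 != 0 by rewrite gt_eqF.
have l1n : l1 != 0 by rewrite gt_eqF.
have rhn : rh != 0 by rewrite gt_eqF.
(* Times [4 * D / (1 + s) ^+ 2], the terms of [Q] are the squared gradients of [Linfty], [Lzero],
   [Lone] divided by their squares. The same factor is the Laplacian of each of the three,
   logarithms of [|g|^2] and [|g - 1|^2] being harmonic. *)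
pose Q := s / li ^+ 2 + (s * l0 ^+ 2)^-1 + (s + 2 * x + 1) / (m * l1 ^+ 2).
have key : 4 * D / (1 + s) ^+ 2 * (1 - 2 * (li^-1 + l0^-1 + l1^-1)) + 8 * D / (1 + s) ^+ 2 * Q
     <= 8 * r ^+ 2 / rh ^+ 2.
  rewrite -subr_le0; apply: le_trans LAP; rewrite le_eqVlt; apply/orP; left; apply/eqP.
  have e00 : a0 ^+ 2 + b0 ^+ 2 = D * s by rewrite -i00; ring.
  have e01 : a0 * a1 + b0 * b1 = D * c by rewrite -i01; ring.
  have e11 : a1 ^+ 2 + b1 ^+ 2 = D * m by rewrite -i11; ring.
  have ez : az ^+ 2 + bz ^+ 2 = r ^+ 2 - rh by rewrite -iz; ring.
  have G0 : (2 * a0) ^+ 2 + (2 * b0) ^+ 2 = 4 * (D * s) by rewrite -e00; ring.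
  have Gz : (- 2 * az) ^+ 2 + (- 2 * bz) ^+ 2 = 4 * (r ^+ 2 - rh) by rewrite -ez; ring.
  rewrite !add0r Gz G0.
  set lapP := 4 * D / (1 + s) - 4 * (D * s) / (1 + s) ^+ 2.
  have lapPE : lapP = 4 * D / (1 + s) ^+ 2 by rewrite /lapP; field.
  have Gi : (2 * a0 / (1 + s)) ^+ 2 + (2 * b0 / (1 + s)) ^+ 2 = 4 * (D * s) / (1 + s) ^+ 2.
    by rewrite -e00; field.
  have Gze : (2 * a0 / (1 + s) - 2 * a0 / s) ^+ 2 + (2 * b0 / (1 + s) - 2 * b0 / s) ^+ 2 =
      4 * D / ((1 + s) ^+ 2 * s).
    rewrite (_ : _ + _ = 4 * (a0 ^+ 2 + b0 ^+ 2) * ((1 + s)^-1 - s^-1) ^+ 2); last by ring.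
    by rewrite e00; field; rewrite sn.
  have Gon : (2 * a0 / (1 + s) - 2 * a1 / m) ^+ 2 + (2 * b0 / (1 + s) - 2 * b1 / m) ^+ 2 =
      4 * D * (s + 2 * x + 1) / ((1 + s) ^+ 2 * m).
    rewrite (_ : _ + _ = 4 * ((a0 ^+ 2 + b0 ^+ 2) / (1 + s) ^+ 2 - 2 * (a0 * a1 + b0 * b1) / ((1 + s) * m) + (a1 ^+ 2 + b1 ^+ 2) / m ^+ 2)); last first.
      by field; rewrite mn.
    rewrite e00 e01 e11 cE.
    rewrite (_ : s + 2 * x + 1 = s * m - 2 * (1 + s) * (s - x) + (1 + s) ^+ 2); last by rewrite mE; ring.
    by field; rewrite mn.
  rewrite Gi Gze Gon !subr0 lapPE /Q.
  by field; rewrite ?rhn ?sn ?mn ?lin ?l0n ?l1n ?Nn.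
have inv12 (l : R) : 12 <= l -> l^-1 <= 12^-1.
  by move=> l12; rewrite lef_pV2// posrE; lra.
have k1 := inv12 _ Li12; have k2 := inv12 _ L012; have k3 := inv12 _ L112.
have W0 : 0 < D / (1 + s) ^+ 2 by rewrite divr_gt0// exprn_gt0.
have key2 : D / (1 + s) ^+ 2 * (1 + 4 * Q) <= 4 * r ^+ 2 / rh ^+ 2.
  have : D / (1 + s) ^+ 2 * (1 / 2) <= D / (1 + s) ^+ 2 * (1 - 2 * (li^-1 + l0^-1 + l1^-1)).
    by rewrite ler_pM2l//; lra.
  lra.
have := key2; rewrite ler_pdivlMr ?exprn_gt0// => key3.
rewrite -[leLHS](_ : D / (1 + s) ^+ 2 * rh ^+ 2 *
   ((1 + s) ^+ 3 / (s * m * (li ^+ 2 * l0 ^+ 2 * l1 ^+ 2))) = _); last first.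
  by field; rewrite sn mn lin l0n l1n.
apply: (@le_trans _ _ (D / (1 + s) ^+ 2 * rh ^+ 2 * (C0 * (1 + 4 * Q)))).
  by rewrite ler_pM2l// mulr_gt0// exprn_gt0.
rewrite [leLHS](_ : _ = C0 * (D / (1 + s) ^+ 2 * (1 + 4 * Q) * rh ^+ 2)); last by ring.
rewrite [leRHS](_ : _ = C0 * (4 * r ^+ 2)); last by ring.
by rewrite ler_pM2l// (lt_le_trans ltr01 C01).
Qed.

(** The weight vanishes on the circle, so a positive maximum over the closed disc is interior. *)
Lemma ahlfors z : cdisc z0 r z -> E z <= 4 * C0 * r ^+ 2.
Proof.
move=> zr.
have [||w wr hmax] := @disc_max R E z0 r.
- exact: ltW.
- by move=> v; rewrite inE; exact: E_continuous.
apply: (le_trans (hmax z zr)).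
have C00 : 0 <= 4 * C0 * r ^+ 2.
  by rewrite mulr_ge0 ?sqr_ge0// mulr_ge0// (le_trans ler01 C01).
have [Ew|Ew] := leP (E w) 0; first exact: le_trans Ew C00.
have wlt : cmod (w - z0) < r.
  rewrite lt_neqAle; apply/andP; split; last exact: wr.
  apply/negP => /eqP wr'; move: Ew.
  by rewrite /metric_ratio /disc_weight wr' subrr expr0n/= !mul0r ltxx.
apply: (@ahlfors_max w (r - cmod (w - z0))) => //; first by rewrite subr_gt0.
move=> v; rewrite /disc/= => vw; apply: hmax; rewrite /cdisc/=.
by apply: le_trans (cmod_tri v z0 w) _; lra.
Qed.

End Ahlfors.

End AhlforsBound.

(** * From the metric comparison to Schottky's theorem *)

Section SchottkyTheorem.
Context (R : realType).
Implicit Types (z w v : Cplx R) (g : Cplx R -> Cplx R).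

Lemma dot_le z w : `|dot z w| <= cmod z * cmod w.
Proof.
rewrite -(@ler_pXn2r _ 2) ?nnegrE ?mulr_ge0 ?cmod_ge0//.
rewrite real_normK ?num_real// exprMn !cmod_sq /dot.
have := sqr_ge0 (re z * im w - im z * re w).
lra.
Qed.

(** For the roots [a], [b] of [s], [N], the inequality [ln (b / a) <= b / a - 1] gives
    [a (12 + 2 ln (b / a)) <= 14 b]. Near the punctures 0 and 1 this bounds the metric from
    below. *)
Lemma sq_log_bound (s N : R) : 0 < s -> s <= N ->
  s * (12 + ln N - ln s) ^+ 2 <= 14 ^+ 2 * N.
Proof.
move=> s0 sN; have N0 : 0 < N by exact: lt_le_trans sN.
set a := Num.sqrt s; set b := Num.sqrt N.
have a0 : 0 < a by rewrite sqrtr_gt0.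
have b0 : 0 < b by rewrite sqrtr_gt0.
have ab : a <= b by rewrite ler_wsqrtr.
have sE : s = a ^+ 2 by rewrite sqr_sqrtr// ltW.
have NE : N = b ^+ 2 by rewrite sqr_sqrtr// ltW.
have l0 : ln a <= ln b by rewrite ler_ln ?posrE.
have l1 : ln b - ln a <= b / a - 1.
  rewrite -ln_div ?posrE//.
  have := @le_ln1Dx R (b / a - 1); rewrite (addrC 1) subrK; apply.
  by have := divr_gt0 b0 a0; lra.
rewrite sE NE (lnXn 2 a0) (lnXn 2 b0) -exprMn -exprMn.
have l2 : a * (ln b - ln a) <= b - a.
  have e : a * (b / a - 1) = b - a by field; rewrite gt_eqF.
  by rewrite -e ler_pM2l.
have l3 : 0 <= a * (ln b - ln a) by rewrite mulr_ge0 ?subr_ge0// ltW.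
apply: lerXn2r; rewrite ?nnegrE.
- by rewrite (_ : a * _ = 12 * a + 2 * (a * (ln b - ln a))); [lra | ring].
- by lra.
- by rewrite (_ : a * _ = 12 * a + 2 * (a * (ln b - ln a))); [lra | ring].
Qed.

Lemma ln_Linfty_derive g z v (t : R) : holo g ->
  is_derive t 1 (fun s : R => ln (Linfty g (z + mkc s 0 * v)))
    (2 * dot (g (z + mkc t 0 * v)) (cderiv g (z + mkc t 0 * v) * v) /
     ((1 + cmod (g (z + mkc t 0 * v)) ^+ 2) * Linfty g (z + mkc t 0 * v))).
Proof.
move=> hg.
have [h1 h2] := rderiv_cdiff (holoP (z + mkc t 0 * v) hg).
have L0 := lt_le_trans (_ : 0 < 12) (Linfty_ge g (z + mkc t 0 * v)).
have h3 := is_deriveD (is_derive_cst (1 : R) t 1) (is_deriveD (is_deriveM h1 h1) (is_deriveM h2 h2)).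
have N0 := sq1_gt0 (g (z + mkc t 0 * v)).
have NE s : 1 + (re (g (z + mkc s 0 * v)) * re (g (z + mkc s 0 * v)) + im (g (z + mkc s 0 * v)) * im (g (z + mkc s 0 * v))) = 1 + cmod (g (z + mkc s 0 * v)) ^+ 2.
  by rewrite cmod_sq.
have h4 : is_derive t 1 (fun s : R => 1 + cmod (g (z + mkc s 0 * v)) ^+ 2)
    (2 * dot (g (z + mkc t 0 * v)) (cderiv g (z + mkc t 0 * v) * v)).
  rewrite (_ : (fun s : R => _) = cst 1 + ((fun s => re (g (z + mkc s 0 * v))) * (fun s => re (g (z + mkc s 0 * v))) +
    (fun s => im (g (z + mkc s 0 * v))) * (fun s => im (g (z + mkc s 0 * v))))).
    by apply: is_derive_eq h3 _; rewrite /GRing.scale/= /dot; ring.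
  by apply/funext => s; rewrite -NE.
have h5 : is_derive t 1 (fun s : R => Linfty g (z + mkc s 0 * v))
    ((1 + cmod (g (z + mkc t 0 * v)) ^+ 2)^-1 * (2 * dot (g (z + mkc t 0 * v)) (cderiv g (z + mkc t 0 * v) * v))).
  have h6 : is_derive t 1 (fun s : R => ln (1 + cmod (g (z + mkc s 0 * v)) ^+ 2))
     ((1 + cmod (g (z + mkc t 0 * v)) ^+ 2)^-1 * (2 * dot (g (z + mkc t 0 * v)) (cderiv g (z + mkc t 0 * v) * v))).
    by apply: is_derive1_comp h4; exact: is_derive1_ln.
  by apply: is_derive_eq (is_deriveD (is_derive_cst (12 : R) t 1) h6) _; rewrite add0r.
have h7 : is_derive t 1 (fun s : R => ln (Linfty g (z + mkc s 0 * v)))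
    ((Linfty g (z + mkc t 0 * v))^-1 * ((1 + cmod (g (z + mkc t 0 * v)) ^+ 2)^-1 * (2 * dot (g (z + mkc t 0 * v)) (cderiv g (z + mkc t 0 * v) * v)))).
  by apply: is_derive1_comp h5; apply: is_derive1_ln; exact: L0.
by apply: is_derive_eq h7 _; rewrite invfM; ring.
Qed.

(** [ahlfors] bounds the derivative of [g]; [sq_log_bound] removes the factors of the punctures 0
    and 1 and leaves a constant times [(1 + |g|^2)^(1/2) Linfty g / r]. So [ln (Linfty g)], which
    measures the distance to infinity in the metric, has slope of order [1 / r]. *)
Lemma Linfty_growth : exists2 K : R, 0 <= K & forall g z0 r, holo g -> 0 < r ->
  (forall z, disc z0 r z -> g z != 0 /\ g z != 1) ->
  forall z, cdisc z0 (r / 2) z -> Linfty g z <= expR K * Linfty g z0.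
Proof.
have [C0 C01 C0P] := three_point_bound R.
(* [4 * C0] comes from [ahlfors], the factors [14 ^+ 2] and [14 ^+ 2 * 2] from [sq_log_bound] at 0
   and at 1. *)
pose C1 := 4 * C0 * (14 ^+ 2 * (14 ^+ 2 * 2)).
have C11 : 1 <= C1.
  have h : (1 : R) <= 14 ^+ 2 by rewrite -[leLHS](expr1n _ 2); apply: lerXn2r; rewrite ?nnegrE; lra.
  rewrite /C1 -[leLHS]mulr1; apply: ler_pM => //; first by lra.
  rewrite -[leLHS]mulr1; apply: ler_pM => //; lra.
exists (8 * C1); first by lra.
move=> g z0 r hg r0 omit z zr.
(* [ahlfors] needs the omission on a closed disc; with this radius, points within
   [r / 2 = 2 / 3 * r1] of the centre have weight at least [5 / 9 * r1 ^+ 2]. *)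
pose r1 := 3 / 4 * r.
have r10 : 0 < r1 by rewrite /r1; lra.
have omit1 w : cdisc z0 r1 w -> g w != 0 /\ g w != 1.
  by move=> wr; apply: omit; apply: le_lt_trans wr _; rewrite /r1; lra.
pose v := z - z0.
have vr : cmod v <= 2 / 3 * r1 by apply: le_trans zr _; rewrite /r1; lra.
have bound t : 0 <= t <= 1 ->
    `|2 * dot (g (z0 + mkc t 0 * v)) (cderiv g (z0 + mkc t 0 * v) * v) /
     ((1 + cmod (g (z0 + mkc t 0 * v)) ^+ 2) * Linfty g (z0 + mkc t 0 * v))| <= 8 * C1.
  move=> /andP[t0 t1]; set w := z0 + mkc t 0 * v.
  have wv : cmod (w - z0) <= 2 / 3 * r1.
    rewrite /w (addrC z0) addrK cmodM cmod_real ger0_norm//.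
    by apply: le_trans vr; rewrite ler_piMl ?cmod_ge0.
  have wr : cdisc z0 r1 w by apply: (le_trans wv); lra.
  have [g0 g1] := omit1 w wr.
  have HE := ahlfors hg r10 omit1 C01 C0P wr.
  have s0 : 0 < cmod (g w) by rewrite cmod_gt0.
  have m0 : 0 < cmod (g w - 1) by rewrite cmod_gt0 subr_eq0.
  have N0 := sq1_gt0 (g w).
  have Li12 := Linfty_ge g w; have L012 := Lzero_ge g0; have L112 := Lone_ge g1.
  have Li0 : 0 < Linfty g w by apply: lt_le_trans Li12.
  have L00 : 0 < Lzero g w by apply: lt_le_trans L012.
  have L10 : 0 < Lone g w by apply: lt_le_trans L112.
  have B0 : cmod (g w) ^+ 2 * Lzero g w ^+ 2 <= 14 ^+ 2 * (1 + cmod (g w) ^+ 2).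
    by apply: sq_log_bound; rewrite ?exprn_gt0// lerDr.
  have B1 : cmod (g w - 1) ^+ 2 * Lone g w ^+ 2 <= 14 ^+ 2 * (2 * (1 + cmod (g w) ^+ 2)).
    rewrite /Lone -(addrA 12) -lnM ?posrE//; apply: sq_log_bound; first by rewrite exprn_gt0.
    rewrite cmodB1 cmod_sq; have := sqr_ge0 (re (g w) + 1); have := sqr_ge0 (im (g w)); lra.
  have rho0 : 5 / 9 * r1 ^+ 2 <= disc_weight z0 r1 w.
    have : cmod (w - z0) ^+ 2 <= (2 / 3 * r1) ^+ 2.
      by apply: lerXn2r; rewrite ?nnegrE ?cmod_ge0//; lra.
    rewrite /disc_weight exprMn (_ : (2 / 3) ^+ 2 = 4 / 9 :> R); [lra | by field].
  have r12 : 0 < r1 ^+ 2 by rewrite exprn_gt0.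
  have rhop : 0 < disc_weight z0 r1 w by lra.
  have dv := dot_le (g w) (cderiv g w * v); rewrite cmodM in dv.
  move: HE dv; rewrite /metric_ratio.
  set D := cmod (cderiv g w); set s := cmod (g w) in B0 B1 s0 N0 *.
  have D0 : 0 <= D by exact: cmod_ge0.
  move: rhop rho0 B0 B1 Li0 L00 L10 m0.
  set rh := disc_weight _ _ _; set li := Linfty g w; set l0 := Lzero g w; set l1 := Lone g w.
  set m := cmod (g w - 1); set q := dot _ _; set cv := cmod v in vr *.
  have cv0 : 0 <= cv by exact: cmod_ge0.
  clearbody rh li l0 l1 m q cv D s; clear - C01 C11 r10 vr cv0 D0 s0 N0 r12.
  move=> rhop rho0 B0 B1 Li0 L00 L10 m0 HE dv.
  have NL : 0 < (1 + s ^+ 2) * li by rewrite mulr_gt0.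
  rewrite normrM normfV normrM ger0_norm// (gtr0_norm NL) ler_pdivrMr//.
  apply: (@le_trans _ _ (2 * (s * (D * cv)))); first by rewrite ler_pM2l.
  have C10 : 0 < C1 by lra.
  rewrite -(@ler_pXn2r _ 2) ?nnegrE//; last 2 first.
    by rewrite !mulr_ge0// ltW.
    by rewrite mulr_ge0// ltW// mulr_gt0.
  have HE2 : rh ^+ 2 * D ^+ 2 * (1 + s ^+ 2) <= C1 * r1 ^+ 2 * (1 + s ^+ 2) ^+ 2 * li ^+ 2.
    move: HE; rewrite ler_pdivrMr; last by rewrite !mulr_gt0.
    move=> HE; apply: (le_trans HE).
    rewrite (_ : s ^+ 2 * m ^+ 2 * _ = (s ^+ 2 * l0 ^+ 2) * (m ^+ 2 * l1 ^+ 2) * li ^+ 2); last by ring.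
    rewrite (_ : C1 * _ * _ * _ = 4 * C0 * r1 ^+ 2 * ((14 ^+ 2 * (1 + s ^+ 2)) * (14 ^+ 2 * (2 * (1 + s ^+ 2))) * li ^+ 2)); last by rewrite /C1; ring.
    rewrite ler_wpM2l//.
      by rewrite mulr_ge0 ?(ltW r12)// mulr_ge0// (le_trans ler01 C01).
    rewrite ler_wpM2r ?sqr_ge0//.
    by apply: ler_pM => //; rewrite mulr_ge0// sqr_ge0.
  have HE3 : rh ^+ 2 * D ^+ 2 <= C1 * r1 ^+ 2 * (1 + s ^+ 2) * li ^+ 2.
    rewrite -(@ler_pM2r _ (1 + s ^+ 2))//; apply: (le_trans HE2).
    by rewrite le_eqVlt; apply/orP; left; apply/eqP; ring.
  have rh2 : 25 / 81 * (r1 ^+ 2 * r1 ^+ 2) <= rh ^+ 2.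
    have : (5 / 9 * r1 ^+ 2) ^+ 2 <= rh ^+ 2 by apply: lerXn2r; rewrite ?nnegrE//; lra.
    by rewrite (_ : (5 / 9 * r1 ^+ 2) ^+ 2 = 25 / 81 * (r1 ^+ 2 * r1 ^+ 2)); [|field].
  have cv2 : cv ^+ 2 <= 4 / 9 * r1 ^+ 2.
    have : cv ^+ 2 <= (2 / 3 * r1) ^+ 2 by apply: lerXn2r; rewrite ?nnegrE//; lra.
    by rewrite (_ : (2 / 3 * r1) ^+ 2 = 4 / 9 * r1 ^+ 2); [|field].
  have r14 : 0 < r1 ^+ 2 * r1 ^+ 2 by rewrite mulr_gt0.
  have D2b : 25 / 81 * r1 ^+ 2 * D ^+ 2 <= C1 * (1 + s ^+ 2) * li ^+ 2.
    rewrite -(@ler_pM2r _ (r1 ^+ 2))//.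
    rewrite (_ : 25 / 81 * r1 ^+ 2 * D ^+ 2 * r1 ^+ 2 = 25 / 81 * (r1 ^+ 2 * r1 ^+ 2) * D ^+ 2); last by ring.
    apply: (@le_trans _ _ (rh ^+ 2 * D ^+ 2)); first by rewrite ler_wpM2r ?sqr_ge0.
    by apply: (le_trans HE3); rewrite le_eqVlt; apply/orP; left; apply/eqP; ring.
  have D2c : cv ^+ 2 * D ^+ 2 <= 36 / 25 * (C1 * (1 + s ^+ 2) * li ^+ 2).
    apply: (@le_trans _ _ (4 / 9 * r1 ^+ 2 * D ^+ 2)); first by rewrite ler_wpM2r ?sqr_ge0.
    lra.
  have s2N : s ^+ 2 <= 1 + s ^+ 2 by rewrite lerDr.
  rewrite (_ : (2 * _) ^+ 2 = 4 * s ^+ 2 * (cv ^+ 2 * D ^+ 2)); last by ring.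
  apply: (@le_trans _ _ (4 * (1 + s ^+ 2) * (36 / 25 * (C1 * (1 + s ^+ 2) * li ^+ 2)))).
    apply: ler_pM => //; rewrite ?mulr_ge0 ?sqr_ge0//; lra.
  rewrite (_ : 4 * _ * _ = 144 / 25 * C1 * ((1 + s ^+ 2) * li) ^+ 2); last by ring.
  rewrite [leRHS]exprMn ler_wpM2r ?sqr_ge0//.
  have : C1 <= C1 ^+ 2 by rewrite ler_eXnr//; lra.
  by rewrite (_ : (8 * C1) ^+ 2 = 64 * C1 ^+ 2); [lra | ring].
have := @mvt_le R _ _ 0 1 (8 * C1) ler01 (fun t _ => @ln_Linfty_derive g z0 v t hg) bound.
rewrite line0 [mkc 1 0](_ : _ = 1)// mul1r (_ : z0 + v = z); last by rewrite /v; ring.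
rewrite subr0 mulr1 => /(le_trans (ler_norm _)).
have Lz : 0 < Linfty g z by apply: lt_le_trans (Linfty_ge g z).
have Lz0 : 0 < Linfty g z0 by apply: lt_le_trans (Linfty_ge g z0).
have X0 : 0 < expR (8 * C1) * Linfty g z0 by rewrite mulr_gt0 ?expR_gt0.
by rewrite lerBlDr -{1}[8 * C1]expRK -lnM ?posrE ?expR_gt0// ler_ln ?posrE.
Qed.

(** An affine map [G] of [g] omits 0 and 1. [C] is chosen before the function, the disc and the
    pair, so that in [blow_up] one iterate serves every admissible pair. *)
Theorem schottky (A d M : R) : 0 < d -> exists C : R, forall g z0 r (a b : Cplx R),
  holo g -> 0 < r -> cmod a <= A -> cmod b <= A -> d <= cmod (a - b) ->
  (forall z, disc z0 r z -> g z != a /\ g z != b) -> cmod (g z0) <= M ->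
  forall z, cdisc z0 (r / 2) z -> cmod (g z) <= C.
Proof.
move=> d0; have [K K0 KP] := Linfty_growth.
pose B := expR K * (12 + ln (1 + ((M + A) / d) ^+ 2)).
exists (A + 2 * A * expR B) => g z0 r a b hg r0 aA bA dab omit gM z zr.
have ab0 : b - a != 0 by rewrite -cmod_gt0 cmodBC; exact: lt_le_trans dab.
have A0 : 0 <= A by exact: le_trans (cmod_ge0 a) aA.
pose G w := (b - a)^-1 * (g w - a).
have hG : holo G.
  by move=> w; eexists; apply: cdiffZ; apply: cdiffB (holoP w hg) (cdiff_cst a w).
have Gomit w : disc z0 r w -> G w != 0 /\ G w != 1.
  move=> /omit[ga gb]; split.
    by rewrite mulf_neq0 ?invr_eq0// subr_eq0.
  apply: contra gb => /eqP e; apply/eqP.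
  have : g w - a = b - a by rewrite -[LHS](mulVKf ab0) -/(G w) e mulr1.
  by move/(congr1 (fun x => x + a)); rewrite !subrK.
have := KP G z0 r hG r0 Gomit z zr => H.
have cab : cmod (b - a) <= 2 * A by apply: (le_trans (cmodB _ _)); lra.
have cab0 : 0 < cmod (b - a) by rewrite cmod_gt0.
have G0 : cmod (G z0) <= (M + A) / d.
  rewrite /G cmodM cmodV mulrC; apply: ler_pM; rewrite ?cmod_ge0 ?invr_ge0 ?cmod_ge0//.
    by apply: (le_trans (cmodB _ _)); exact: lerD.
  by rewrite lef_pV2 ?posrE// cmodBC.
have LB : Linfty G z <= B.
  apply: (le_trans H); rewrite /B ler_pM2l ?expR_gt0// /Linfty lerD2l.
  rewrite ler_ln ?posrE ?sq1_gt0//; last by have := sqr_ge0 ((M + A) / d); lra.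
  rewrite lerD2l; apply: lerXn2r; rewrite ?nnegrE ?cmod_ge0//.
  exact: le_trans (cmod_ge0 _) G0.
have Gz : cmod (G z) <= expR B.
  have h1 : 1 + cmod (G z) ^+ 2 <= expR B.
    rewrite -[leLHS]lnK ?posrE ?sq1_gt0// ler_expR.
    by apply: le_trans LB; rewrite /Linfty lerDr.
  by have := sqr_ge0 (cmod (G z) - 1); have := cmod_ge0 (G z); lra.
have -> : g z = (b - a) * G z + a by rewrite /G mulrA mulfV// mul1r subrK.
apply: (le_trans (cmodD _ _)); rewrite addrC lerD// cmodM.
by apply: ler_pM; rewrite ?cmod_ge0.
Qed.

End SchottkyTheorem.
(** * Picard's theorem for finitely many preimages *)

Section Liouville.
Context (R : realType).
Implicit Types (z w : Cplx R) (f g : Cplx R -> Cplx R).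

Lemma cdiff_horner (p : {poly Cplx R}) z : cdiff (fun w => p.[w]) z (p^`()).[z].
Proof.
elim/poly_ind: p => [|p c ih].
  rewrite derivC horner0; apply: cdiff_ext (cdiff_cst 0 z) => w.
  by rewrite horner0.
rewrite derivMXaddC hornerD hornerMX.
have := cdiffD (cdiffM ih (cdiff_id z)) (cdiff_cst c z).
rewrite (_ : _ + 0 = p.[z] + (p^`()).[z] * z); last by ring.
by apply: cdiff_ext => w; rewrite hornerMXaddC.
Qed.

Lemma poly_antiderivative (p : {poly Cplx R}) : exists P : {poly Cplx R}, P^`() = p.
Proof.
exists (\poly_(i < (size p).+1) (p`_i.-1 / i%:R)); apply/polyP => i.
rewrite coef_deriv coef_poly ltnS; case: ltnP => [ip|pi] /=.
  by rewrite -[LHS]mulr_natr divfK// pnatr_eq0.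
by rewrite mul0rn nth_default.
Qed.

Lemma deriv0_cst f : holo f -> (forall z, cderiv f z = 0) -> forall z, f z = f 0.
Proof.
move=> hf f0 z; apply: (@deriv0_cst_disc R f (cmod z + 1)); last by lra.
by move=> w _; rewrite -(f0 w); exact: holoP.
Qed.

(** The Cauchy estimate on the circle of radius [1 + |z|] about [z] lowers the growth exponent of
    the derivative by one; by induction the derivative is a polynomial. *)
Theorem liouville_poly f (k : nat) (C : R) : holo f ->
  (forall z, cmod (f z) <= C * (1 + cmod z) ^+ k) ->
  exists p : {poly Cplx R}, forall z, f z = p.[z].
Proof.
elim: k f C => [|k ih] f C hf hC.
  exists (f 0)%:P => z; rewrite hornerC; apply: deriv0_cst => // w.
  apply/eqP; rewrite -cmod_eq0 eq_le cmod_ge0 andbT.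
  apply/ler_addgt0Pr => e e0; rewrite add0r.
  have C0 : 0 <= C by have := hC 0; rewrite expr0 mulr1; exact: le_trans (cmod_ge0 _).
  have r0 : 0 < (2 * C + 1) / e by rewrite divr_gt0//; lra.
  apply: (le_trans (@cauchy_estimate R f w ((2 * C + 1) / e) C hf r0 _)).
    by move=> z' _; have := hC z'; rewrite expr0 mulr1.
  rewrite ler_pdivrMr// mulrCA divff ?mulr1; last by rewrite gt_eqF.
  lra.
have [|p hp] := ih (cderiv f) (2 * C * 2 ^+ k.+1) (holo_deriv hf).
  move=> z; have z1 : 0 < 1 + cmod z by have := cmod_ge0 z; lra.
  have C0 : 0 <= C.
    by have := le_trans (cmod_ge0 _) (hC z); rewrite pmulr_lge0// exprn_gt0.
  apply: (le_trans (@cauchy_estimate R f z (1 + cmod z) (C * (2 * (1 + cmod z)) ^+ k.+1) hf z1 _)).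
    move=> w wz; apply: (le_trans (hC w)); rewrite ler_wpM2l//; apply: lerXn2r; rewrite ?nnegrE.
    - by have := cmod_ge0 w; lra.
    - by lra.
    - by have := cmodD (w - z) z; rewrite subrK wz; lra.
  rewrite le_eqVlt; apply/orP; left; apply/eqP.
  by rewrite exprMn (exprS (1 + cmod z)); field; rewrite gt_eqF.
have [P hP] := poly_antiderivative p.
pose g z := f z - P.[z].
have hg z : cdiff g z 0.
  by rewrite -(subrr p.[z]) -{1}hp -hP; apply: cdiffB; [exact: holoP | exact: cdiff_horner].
exists (P + (g 0)%:P) => z; rewrite hornerD hornerC.
have -> : g 0 = g z.
  by apply/esym/deriv0_cst => [w|w]; [exists 0 | exact: deriv_unique].
by rewrite /g addrC subrK.
Qed.

End Liouville.

(** * Moving along a circle by small rotations *)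

Section CircleChain.
Context (R : realType).
Implicit Types (z w d u : Cplx R).

(** The principal root has nonnegative real part, so [|d + 1|^2 >= 2], while
    [u - 1 = (d - 1) (d + 1)]. *)
Lemma unit_sqrt u : cmod u = 1 ->
  exists d, [/\ cmod d = 1, d ^+ 2 = u & 2 * cmod (d - 1) ^+ 2 <= cmod (u - 1) ^+ 2].
Proof.
move=> u1; pose d : Cplx R := complex.sqrtc u.
have d2 : d ^+ 2 = u by exact: sqr_sqrtc.
have rd : 0 <= re d by rewrite /d; case: (u) => a b; rewrite /re/= sqrtr_ge0.
have d1 : cmod d = 1.
  apply/eqP; rewrite -(@eqrXn2 _ 2)// ?cmod_ge0//.
  by rewrite expr1n -cmodX d2 u1.
exists d; split => //.
have -> : u - 1 = (d - 1) * (d + 1) by rewrite -d2; ring.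
rewrite cmodM exprMn mulrC ler_wpM2l ?sqr_ge0//.
have : cmod d ^+ 2 = 1 by rewrite d1 expr1n.
by rewrite !cmod_sq !reimE; lra.
Qed.

Lemma unit_root n u : cmod u = 1 ->
  exists d, [/\ cmod d = 1, d ^+ (2 ^ n) = u &
    2 ^+ n * cmod (d - 1) ^+ 2 <= cmod (u - 1) ^+ 2].
Proof.
elim: n u => [|n ih] u u1; first by exists u; rewrite expn0 expr1 expr0 mul1r.
have [e [e1 eu hu]] := ih u u1.
have [d [d1 de hd]] := unit_sqrt e1.
exists d; split => //; first by rewrite expnS exprM de.
apply: le_trans hu; rewrite exprSr -mulrA ler_wpM2l// exprn_ge0//.
Qed.

(* Repeated square roots write w / z as the 64th power of a unit within 1/4 of 1. *)
Lemma circle_chain (T : Cplx R -> R) (c rho : R) : 0 < rho -> 0 <= c ->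
  (forall z w, cmod z = rho -> cmod w = rho -> cmod (w - z) <= rho / 4 ->
     T w <= c * T z) ->
  forall z w, cmod z = rho -> cmod w = rho -> T w <= c ^+ (2 ^ 6) * T z.
Proof.
move=> rho0 c0 H z w zr wr.
have z0 : z != 0 by rewrite -cmod_gt0 zr.
have [|d [d1 dw hd]] := @unit_root 6 (w / z).
  by rewrite cmodM cmodV zr wr divff// gt_eqF.
have d4 : cmod (d - 1) <= 1 / 4.
  have h : cmod (w / z - 1) <= 2.
    apply: (le_trans (cmodB _ _)).
    by rewrite cmodM cmodV zr wr divff ?gt_eqF// cmod1.
  have h2 : cmod (w / z - 1) ^+ 2 <= 2 ^+ 2 by apply: lerXn2r; rewrite ?nnegrE ?cmod_ge0.
  rewrite -(@ler_pXn2r _ 2) ?nnegrE ?cmod_ge0//.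
  rewrite (_ : (1 / 4) ^+ 2 = 1 / 16 :> R); last by field.
  move: hd; rewrite (_ : 2 ^+ 6 = 64 :> R); last by ring.
  move: h2; rewrite (_ : 2 ^+ 2 = 4 :> R); last by ring.
  lra.
have step k : T (z * d ^+ k) <= c ^+ k * T z.
  elim: k => [|k ih]; first by rewrite !expr0 mulr1 mul1r.
  apply: (@le_trans _ _ (c * T (z * d ^+ k))); last first.
    by rewrite exprS -mulrA ler_wpM2l.
  apply: H; rewrite ?cmodM ?cmodX ?d1 ?expr1n ?mulr1//.
  rewrite exprS (_ : _ - _ = z * d ^+ k * (d - 1)); last by ring.
  by rewrite !cmodM cmodX d1 expr1n mulr1 zr; have := ler_wpM2l (ltW rho0) d4; lra.
have := step (2 ^ 6)%N; rewrite dw mulrC divfK//.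
Qed.

End CircleChain.

(** * Entire functions omitting two values near infinity *)

Section GreatPicard.
Context (R : realType).
Implicit Types (z w : Cplx R) (f g : Cplx R -> Cplx R).

Lemma holo_id : holo (fun z : Cplx R => z).
Proof. by move=> z; exists 1; exact: cdiff_id. Qed.

Lemma continuous_ln_sq g z : holo g -> g z != 0 ->
  {for z, continuous (fun w => ln (cmod (g w) ^+ 2))}.
Proof.
move=> hg g0.
have c0 : 0 < cmod (g z) ^+ 2 by rewrite exprn_gt0// cmod_gt0.
have cg := @continuous_cmod_comp R _ g z (@holo_continuous R g hg z).
apply: (@continuous_comp _ _ _ (fun w => cmod (g w) ^+ 2) (@ln R)).
  exact: (continuous_mul cg cg).
exact: continuous_ln.
Qed.

(** Both sides are harmonic and are compared on the two circles. Adding [ep * |w|^2] to their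
    difference makes its Laplacian positive, which excludes an interior maximum. *)
Lemma annulus_min g (r rho k : R) : holo g -> 0 < r -> r < rho ->
  (forall z, r <= cmod z <= rho -> g z != 0) ->
  (forall z, cmod z = r -> 0 <= ln (cmod (g z) ^+ 2)) ->
  (forall z, cmod z = rho -> k * (ln (rho ^+ 2) - ln (r ^+ 2)) <= ln (cmod (g z) ^+ 2)) ->
  forall z, r <= cmod z <= rho ->
    k * (ln (cmod z ^+ 2) - ln (r ^+ 2)) <= ln (cmod (g z) ^+ 2).
Proof.
move=> hg r0 rrho g0 hin hout z zA.
have rho0 : 0 < rho by exact: lt_trans rrho.
rewrite -subr_le0; apply/ler_addgt0Pr => e e0; rewrite add0r.
pose ep := e / rho ^+ 2.
have ep0 : 0 < ep by rewrite divr_gt0// exprn_gt0.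
have epr : ep * rho ^+ 2 = e by rewrite /ep divfK// expf_neq0// gt_eqF.
pose u w := k * (ln (cmod w ^+ 2) - ln (r ^+ 2)) - ln (cmod (g w) ^+ 2) + ep * cmod w ^+ 2.
pose A := [set w : Cplx R | r <= cmod w <= rho].
have An0 w : A w -> w != 0 by move=> /andP[rw _]; rewrite -cmod_gt0; exact: lt_le_trans rw.
have cA : compact A.
  apply: (subclosed_compact _ (@compact_cdisc R 0 rho)); last first.
    by move=> w /andP[_]; rewrite /cdisc/= subr0.
  rewrite (_ : A = (@cmod R) @^-1` `[r, rho]%classic); last first.
    by apply/seteqP; split => w /=; rewrite in_itv.
  by move: (@cmod_continuous R) => /continuous_closedP; apply; exact: itv_closed.
have cu w : A w -> {for w, continuous u}.
  move=> wA.
  have c1 : {for w, continuous (fun w => ln (cmod w ^+ 2))} by exact: (continuous_ln_sq holo_id (An0 w wA)).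
  have c2 := continuous_ln_sq hg (g0 w wA).
  have c3 : {for w, continuous (fun w => cmod w ^+ 2)} by apply: continuous_mul; exact: cmod_continuous.
  apply: (continuous_add (p := fun w => k * (ln (cmod w ^+ 2) - ln (r ^+ 2)) - ln (cmod (g w) ^+ 2))).
    apply: (continuous_sub (p := fun w => k * (ln (cmod w ^+ 2) - ln (r ^+ 2))) _ c2).
    apply: (continuous_mul (p := fun=> k)); first exact: continuous_cst.
    by apply: (continuous_sub c1); exact: continuous_cst.
  by apply: (continuous_mul (p := fun=> ep)); first exact: continuous_cst.
have [||w wA hmax] := @compact_EVT_max _ _ u A _ cA.
- by exists z.
- by apply: continuous_in_subspaceT => w; rewrite inE; exact: cu.
have {}wA : A w by exact/set_mem.
have {}hmax v : A v -> u v <= u w by move=> vA; apply: hmax; exact/mem_set.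
have uz : k * (ln (cmod z ^+ 2) - ln (r ^+ 2)) - ln (cmod (g z) ^+ 2) <= u z.
  by rewrite /u lerDl mulr_ge0 ?sqr_ge0// ltW.
apply: (le_trans uz); apply: (le_trans (hmax z zA)).
have wr2 : ep * cmod w ^+ 2 <= e.
  rewrite -epr ler_pM2l//; apply: lerXn2r; rewrite ?nnegrE ?cmod_ge0 ?(ltW rho0)//.
  by case/andP: wA.
case/andP: (wA); rewrite le_eqVlt => /orP[/eqP rw _|rw].
  have := hin w (esym rw).
  by rewrite /u -rw subrr mulr0 sub0r; rewrite -rw in wr2; lra.
rewrite le_eqVlt => /orP[/eqP wrho|wrho].
  by have := hout w wrho; rewrite /u wrho; rewrite wrho in wr2; lra.
exfalso.
have L1 := LapZ k (LapB (Lap_ln_sq holo_id (An0 w wA)) (Lap_cst (ln (r ^+ 2)) w)).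
have L2 := Lap_ln_sq hg (g0 w wA).
have L3 := LapZ ep (Lap_sq w holo_id).
have := LapD (LapB L1 L2) L3.
have d1 : cderiv (fun z : Cplx R => z) w = 1 by apply: deriv_unique; exact: cdiff_id.
rewrite d1 cmod1 => L.
pose t := Num.min (cmod w - r) (rho - cmod w).
have t0 : 0 < t by rewrite lt_min !subr_gt0 rw.
have := Lap_max L t0; rewrite -/u => H.
have : k * (0 - 0) - 0 + ep * (4 * 1 ^+ 2) <= 0.
  apply: H => v; rewrite /disc/= lt_min => /andP[v1 v2]; apply: hmax; apply/andP; split.
    by have := cmod_sub w v; rewrite cmodBC; lra.
  by have := cmodD (v - w) w; rewrite subrK; lra.
by rewrite expr1n; lra.
Qed.

Lemma finite_cmod_bounded (A : set (Cplx R)) : finite_set A ->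
  exists2 M : R, 0 < M & forall z, A z -> cmod z <= M.
Proof.
move=> /finite_seqP[s ->]; elim: s => [|x s [M M0 ih]].
  by exists 1 => // z; rewrite /= in_nil.
exists (M + cmod x); first by rewrite ltr_pwDl// cmod_ge0.
move=> z /=; rewrite inE => /orP[/eqP ->|/ih zM]; first by rewrite lerDr ltW.
by apply: (le_trans zM); rewrite lerDl cmod_ge0.
Qed.

(** On large circles the values of [Linfty g] are comparable. If [|g| <= 2] at arbitrarily large
    points, [g] is thus bounded on arbitrarily large circles. Otherwise [|g| > 2] near infinity, and
    a large value at [z] makes [ln |g|^2] large on the whole circle through [z]; [annulus_min]
    carries this in to the fixed point [z2], which limits [ln |g z|^2] to order [ln |z|]. *)
Lemma picard01 g (R0 : R) : holo g -> 0 < R0 ->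
  (forall z, R0 < cmod z -> g z != 0 /\ g z != 1) ->
  exists p : {poly Cplx R}, forall z, g z = p.[z].
Proof.
move=> hg R00 omit.
have [K K0 KP] := Linfty_growth R.
(* On discs of radius [|z| / 2] about points of a circle outside [2 * R0], 0 and 1 are omitted; half
   of that radius is the step [rho / 4] of [circle_chain], which takes [2 ^ 6] steps. *)
pose H := expR K ^+ (2 ^ 6).
have H1 : 1 <= H by apply: exprn_ege1; rewrite -expR0 ler_expR.
have chain z w : 2 * R0 <= cmod z -> cmod w = cmod z -> Linfty g w <= H * Linfty g z.
  move=> zR wz.
  have z0 : 0 < cmod z by lra.
  apply: (@circle_chain R (Linfty g) (expR K) (cmod z)) => //.
  move=> u v uz vz uv; apply: (KP g u (cmod z / 2)) => //; first by rewrite divr_gt0.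
    move=> x; rewrite /disc/= => xu; apply: omit.
    by have := cmod_sub u x; rewrite cmodBC uz; lra.
  by rewrite /cdisc/=; lra.
clearbody H.
have [[R1 R1P]|small] := pselect (exists R1 : R, forall z, R1 < cmod z -> 2 < cmod (g z)); last first.
  pose B := expR (H * (12 + ln 5)).
  apply: (@liouville_poly R g 0 B) => // z; rewrite expr0 mulr1.
  have [w wz gw] : exists2 w, Num.max (cmod z) (2 * R0) < cmod w & cmod (g w) <= 2.
    apply: contrapT => h; apply: small; exists (Num.max (cmod z) (2 * R0)) => w wz.
    by rewrite ltNge; apply/negP => gw; apply: h; exists w.
  move: wz; rewrite gt_max => /andP[zw Rw].
  have w0 : 0 < cmod w by lra.
  apply: (@max_modulus R g 0 (cmod w) B hg w0); last by rewrite /cdisc/= subr0 ltW.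
  move=> v; rewrite subr0 => vw.
  have := chain w v (ltW Rw) vw => h.
  have h2 : Linfty g w <= 12 + ln 5.
    rewrite /Linfty lerD2l ler_ln ?posrE ?sq1_gt0//.
    have : cmod (g w) ^+ 2 <= 2 ^+ 2 by apply: lerXn2r; rewrite ?nnegrE ?cmod_ge0.
    by rewrite (_ : 2 ^+ 2 = 4 :> R); [lra | ring].
  have h3 : ln (1 + cmod (g v) ^+ 2) <= H * (12 + ln 5).
    have : H * Linfty g w <= H * (12 + ln 5) by rewrite ler_wpM2l//; lra.
    by move: h; rewrite {1}/Linfty; lra.
  have : 1 + cmod (g v) ^+ 2 <= B by rewrite -[leLHS]lnK ?posrE ?sq1_gt0// ler_expR.
  by have := sqr_ge0 (cmod (g v) - 1); have := cmod_ge0 (g v); lra.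
pose r := Num.max R1 (2 * R0) + 1.
have rR1 : R1 < r by apply: (@le_lt_trans _ _ (Num.max R1 (2 * R0))); [rewrite le_max lexx | rewrite /r; lra].
have rR0 : 2 * R0 < r by apply: (@le_lt_trans _ _ (Num.max R1 (2 * R0))); [rewrite le_max lexx orbT | rewrite /r; lra].
have r0 : 0 < r by lra.
clearbody r.
have g2 z : r <= cmod z -> 2 < cmod (g z) by move=> rz; apply: R1P; exact: lt_le_trans rz.
have gn0 z : r <= cmod z -> g z != 0 by move=> /g2 h; rewrite -cmod_gt0; lra.
have lng z : r <= cmod z -> 0 <= ln (cmod (g z) ^+ 2).
  move=> /g2 h; apply: ln_ge0; rewrite -[leLHS](expr1n _ 2).
  by apply: lerXn2r; rewrite ?nnegrE; lra.
pose z2 : Cplx R := mkc (2 * r) 0.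
have cz2 : cmod z2 = 2 * r by rewrite cmod_real ger0_norm//; lra.
pose c2 := ln (cmod (g z2) ^+ 2).
have c20 : 0 <= c2 by apply: lng; rewrite cz2; lra.
have ln4 : 0 < ln 4 :> R by apply: ln_gt0; lra.
have growth z : 2 * r < cmod z -> ln (cmod (g z) ^+ 2) <= H * 13 + H * c2 / ln 4 * (ln (cmod z ^+ 2) - ln (r ^+ 2)).
  move=> rz.
  pose rho := cmod z.
  pose Lam := ln (rho ^+ 2) - ln (r ^+ 2).
  have rho0 : 0 < rho by rewrite /rho; lra.
  have Lam0 : 0 < Lam.
    rewrite subr_gt0 ltr_ln ?posrE ?exprn_gt0// ltr_pXn2r ?nnegrE ?ltW//; rewrite /rho; lra.
  (* 13 is 12 + 1, since [ln (1 + t) <= 1 + ln t] for [t >= 1]. *)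
  pose mu := Linfty g z / H - 13.
  have muP w : cmod w = rho -> mu <= ln (cmod (g w) ^+ 2).
    move=> wr.
    have h : Linfty g z / H <= Linfty g w.
      rewrite ler_pdivrMr; last by lra.
      by rewrite mulrC; apply: chain; rewrite ?wr /rho//; lra.
    have gw := g2 w; rewrite wr in gw; have {}gw := gw (_ : r <= rho).
    have {}gw : 2 < cmod (g w) by apply: gw; rewrite /rho; lra.
    have gw2 : 1 <= cmod (g w) ^+ 2.
      by rewrite -[leLHS](expr1n _ 2); apply: lerXn2r; rewrite ?nnegrE; lra.
    have : Linfty g w <= 13 + ln (cmod (g w) ^+ 2).
      have e1 : ln (expR 1 * cmod (g w) ^+ 2) = 1 + ln (cmod (g w) ^+ 2).
        by rewrite lnM ?posrE ?expR_gt0 ?expRK//; lra.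
      rewrite /Linfty; have : ln (1 + cmod (g w) ^+ 2) <= 1 + ln (cmod (g w) ^+ 2).
        rewrite -e1 ler_ln ?posrE ?sq1_gt0//; last by rewrite mulr_gt0 ?expR_gt0//; lra.
        apply: (@le_trans _ _ (2 * cmod (g w) ^+ 2)); first by lra.
        by rewrite ler_wpM2r ?sqr_ge0//; have := expR_ge1Dx (1 : R); lra.
      by lra.
    by rewrite /mu; lra.
  have rrho : r < rho by rewrite /rho; lra.
  have h := @annulus_min g r rho (mu / Lam) hg r0 rrho.
  have {h} : mu / Lam * (ln (cmod z2 ^+ 2) - ln (r ^+ 2)) <= ln (cmod (g z2) ^+ 2).
    apply: h.
    - by move=> w /andP[rw _]; exact: gn0.
    - by move=> w wr; apply: lng; rewrite wr.
    - by move=> w wr; rewrite divfK ?gt_eqF//; exact: muP.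
    - by rewrite cz2 /rho; lra.
  have -> : ln (cmod z2 ^+ 2) - ln (r ^+ 2) = ln 4.
    rewrite cz2 exprMn lnM ?posrE ?exprn_gt0// addrK.
    by congr ln; ring.
  rewrite -/c2 mulrAC -ler_pdivlMr ?invr_gt0// invrK -ler_pdivlMr// => h.
  have : H * mu <= H * (c2 * Lam / ln 4) by rewrite ler_pM2l//; lra.
  have -> : H * mu = Linfty g z - H * 13.
    by rewrite /mu mulrBr mulrCA divff ?mulr1// gt_eqF//; lra.
  have -> : H * (c2 * Lam / ln 4) = H * c2 / ln 4 * Lam by ring.
  have : ln (cmod (g z) ^+ 2) <= Linfty g z.
    apply: (@le_trans _ _ (ln (1 + cmod (g z) ^+ 2))); last by rewrite /Linfty lerDr.
    rewrite ler_ln ?posrE ?sq1_gt0 ?lerDr//.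
    by rewrite exprn_gt0//; have := g2 z; rewrite -/rho; lra.
  by rewrite /Lam /rho; lra.
pose a := H * c2 / ln 4.
have a0 : 0 <= a by rewrite /a divr_ge0 ?mulr_ge0 ?(ltW ln4)//; lra.
pose k := Num.bound a.
have ak : a <= k%:R by apply/ltW; apply: le_lt_trans (archi_boundP a0).
pose B := expR (H * 13).
have gb z : 2 * r < cmod z -> cmod (g z) <= B * (cmod z / r) ^+ k.
  move=> rz; have z0 : 0 < cmod z by lra.
  have gz0 : 0 < cmod (g z) by have := g2 z; lra.
  have := growth z rz; rewrite -/a (lnXn 2 gz0) (lnXn 2 z0) (lnXn 2 r0) => h.
  have X0 : 0 <= ln (cmod z) - ln r by rewrite subr_ge0 ler_ln ?posrE//; lra.
  have h1 := ler_wpM2r X0 ak.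
  have h2 : ln (cmod (g z)) <= H * 13 + k%:R * (ln (cmod z) - ln r).
    have : a * (ln (cmod z) *+ 2 - ln r *+ 2) = 2 * (a * (ln (cmod z) - ln r)) by ring.
    by move: h => /[swap] ->; rewrite -mulr_natl; lra.
  rewrite -[leLHS]lnK ?posrE//; apply: (@le_trans _ _ (expR (H * 13 + k%:R * (ln (cmod z) - ln r)))).
    by rewrite ler_expR.
  by rewrite expRD expRM_natl -ln_div ?posrE// lnK// posrE divr_gt0.
have B0 : 0 < B by exact: expR_gt0.
clear growth lng gn0 g2 chain; clearbody B; clearbody k; clear a a0 ak c20; clearbody c2; clear c2.
apply: (@liouville_poly R g k (B * r^-1 ^+ k * (2 * r + 1) ^+ k)) => // z.
have c0 := cmod_ge0 z.
have z1 : 1 <= (1 + cmod z) ^+ k by apply: exprn_ege1; lra.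
have r21 : 1 <= 2 * r + 1 by lra.
have r1 : 1 <= (2 * r + 1) ^+ k by exact: exprn_ege1.
have Br : 0 < B * r^-1 ^+ k by rewrite mulr_gt0// exprn_gt0// invr_gt0.
have [zs|zl] := leP (cmod z) (2 * r + 1).
  apply: (@le_trans _ _ (B * r^-1 ^+ k * (2 * r + 1) ^+ k)); last first.
    by rewrite ler_peMr// ltW// mulr_gt0//; lra.
  have r22 : 0 < 2 * r + 1 by lra.
  apply: (@max_modulus R g 0 (2 * r + 1) _ hg r22); last by rewrite /cdisc/= subr0.
  move=> w; rewrite subr0 => wr; apply: (le_trans (gb w _)); first by rewrite wr; lra.
  by rewrite wr exprMn -mulrA (mulrC (r^-1 ^+ k)).
apply: (le_trans (gb z _)); first by lra.
apply: (@le_trans _ _ (B * r^-1 ^+ k * (1 + cmod z) ^+ k)).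
  rewrite exprMn (mulrA B) mulrAC ler_pM2l//.
  by apply: lerXn2r; rewrite ?nnegrE; lra.
rewrite ler_wpM2r//; first by rewrite (le_trans ler01).
by rewrite ler_peMr// ltW.
Qed.

Theorem finite_preimages_poly f (a b : Cplx R) : holo f -> a != b ->
  finite_set [set z | f z = a] -> finite_set [set z | f z = b] ->
  exists p : {poly Cplx R}, forall z, f z = p.[z].
Proof.
move=> hf ab /finite_cmod_bounded[M1 M10 h1] /finite_cmod_bounded[M2 M20 h2].
have ba0 : b - a != 0 by rewrite subr_eq0 eq_sym.
pose g w := (b - a)^-1 * (f w - a).
have hg : holo g.
  by move=> w; eexists; apply: cdiffZ; apply: cdiffB (holoP w hf) (cdiff_cst a w).
have fg z : f z = (b - a) * g z + a by rewrite /g mulrA mulfV// mul1r subrK.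
have [||p hp] := @picard01 g (M1 + M2) hg.
- exact: addr_gt0.
- move=> z zM; split; apply/negP => /eqP gz.
    have /h1 : f z = a by rewrite fg gz mulr0 add0r.
    lra.
  have /h2 : f z = b by rewrite fg gz mulr1 subrK.
  lra.
exists ((b - a)%:P * p + a%:P) => z.
by rewrite hornerD hornerM !hornerC -hp -fg.
Qed.

End GreatPicard.
(** * Topology of the plane *)

Section Topology.
Context (R : realType).
Implicit Types (z w a b : Cplx R) (K S : set (Cplx R)).

Lemma closure_cmod K z : closure K z <->
  forall e : R, 0 < e -> exists2 w, K w & cmod (w - z) < e.
Proof.
split=> [cz e e0|h B /nbhs_cmod[e e0 eB]].
  by have [w [Kw wz]] := cz _ (nbhs_disc z e0); exists w.
by have [w Kw wz] := h e e0; exists w; split => //; exact: eB.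
Qed.

Definition cseg a b : set (Cplx R) :=
  (fun t : R => a + mkc t 0 * (b - a)) @` `[0, 1]%classic.

Lemma cseg_connected a b : connected (cseg a b).
Proof.
apply: connected_continuous_connected; first exact: segment_connected.
apply: continuous_subspaceT => t; apply/continuous_cmodP => e e0.
have c0 : 0 < cmod (b - a) + 1 by rewrite ltr_wpDl ?cmod_ge0.
apply/nbhs_ballP; exists (e / (cmod (b - a) + 1)) => /=; first by rewrite divr_gt0.
move=> s; rewrite /ball/= ltr_pdivlMr// distrC => st.
rewrite (_ : _ - _ = mkc (s - t) 0 * (b - a)); last first.
  by apply: cplx_eq; rewrite !reimE; ring.
by rewrite cmodM cmod_real; apply: le_lt_trans st; rewrite ler_wpM2l// lerDl.
Qed.

Lemma cseg_l a b : cseg a b a.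
Proof. by exists 0; [rewrite /= in_itv/= lexx ler01 | rewrite line0]. Qed.

Lemma cseg_r a b : cseg a b b.
Proof.
exists 1; first by rewrite /= in_itv/= ler01 lexx.
by rewrite [mkc 1 0](_ : _ = 1)// mul1r addrC subrK.
Qed.

(** Otherwise the trace of [K] on the connected [S] would be relatively closed as well as open. *)
Lemma boundary_crossing K S : open K -> connected S ->
  S `&` K !=set0 -> ~ (S `<=` K) -> exists x, [/\ S x, closure K x & ~ K x].
Proof.
move=> oK cS SK0 SK; apply: contrapT => h; apply: SK.
have e : S `&` K = S.
  apply: cS => //; first by exists K.
  exists (closure K); first exact: closed_closure.
  apply/seteqP; split => x [Sx Kx]; split => //; first exact: subset_closure.
  by apply: contrapT => nKx; apply: h; exists x.
by rewrite -e => x [].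
Qed.

(** Two routes from [p] to [q] that meet only at their ends: each must leave [K], or else [p] and
    [q] would share a component, and each yields its own boundary point. *)
Lemma two_boundary_points K p q : open K -> K p -> K q ->
  ~ connected_component K p q ->
  exists x1 x2, [/\ x1 != x2, closure K x1 /\ ~ K x1 & closure K x2 /\ ~ K x2].
Proof.
move=> oK Kp Kq pq.
have npq : q - p != 0.
  by rewrite subr_eq0; apply: contra_notN pq => /eqP ->; exact: connected_component_refl.
have nsub S : connected S -> S p -> S q -> ~ (S `<=` K).
  by move=> cS Sp Sq SK; apply: pq; exact: (connected_component_max Sp SK cS).
have [|x1 [[t _ x1E] cx1 nx1]] := boundary_crossing oK (@cseg_connected p q) _ (nsub _ (@cseg_connected p q) (cseg_l p q) (cseg_r p q)).
  by exists p; split => //; exact: cseg_l.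
(* In the coordinate taking [p] to 0 and [q] to 1, the detour passes through 1/2 + i and is real
   only at its two ends, which lie in [K]. *)
pose k : Cplx R := mkc 2^-1 1.
pose c := p + k * (q - p).
pose S := cseg p c `|` cseg c q.
have cS : connected S.
  apply: connectedU; [|exact: cseg_connected|exact: cseg_connected].
  by exists c; split; [exact: cseg_r | exact: cseg_l].
have Sp : S p by left; exact: cseg_l.
have Sq : S q by right; exact: cseg_r.
have [|x2 [Sx2 cx2 nx2]] := boundary_crossing oK cS _ (nsub _ cS Sp Sq).
  by exists p.
exists x1, x2; split => //; apply/eqP => x12; apply: nx2.
have lin (u : Cplx R) : p + mkc t 0 * (q - p) = p + u * (q - p) -> im u = 0.
  move=> /addrI /(mulIf npq) <-; exact: im_mkc.
case: Sx2 => -[s _ x2E]; move: x1E; rewrite x12 -x2E.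
- rewrite (_ : p + mkc s 0 * (c - p) = p + (mkc s 0 * k) * (q - p)); last first.
    by rewrite /c; ring.
  move=> /lin; rewrite !reimE mulr1 mul0r addr0 => s0.
  by rewrite -[mkc s 0]/(mkc s 0) s0 [mkc 0 0](_ : _ = 0)// !mul0r addr0.
- rewrite (_ : c + mkc s 0 * (q - c) = p + (k + mkc s 0 * (1 - k)) * (q - p)); last first.
    by rewrite /c; ring.
  move=> /lin; rewrite !reimE => s1.
  have {s1} s1 : s = 1 by lra.
  rewrite s1 [mkc 1 0](_ : _ = 1)// mul1r (_ : k + (1 - k) = 1); last by ring.
  by rewrite mul1r addrC subrK.
Qed.

Lemma connected_add_limit (T : topologicalType) (A : set T) x :
  connected A -> closure A x -> connected (A `|` [set x]).
Proof.
move=> cA clx; apply/connectedP => E [E0 AE sE].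
have sub : A `<=` E false `|` E true by rewrite -AE; left.
have [s0 s1] := sE.
have [AF|AT] := connected_subset sE sub cA.
- have [y Ey] := E0 true.
  have : (A `|` [set x]) y by rewrite AE; right.
  have ncl : ~ closure (E false) y.
    by move=> cy; have : (closure (E false) `&` E true) y by []; rewrite s0.
  case=> [/AF Fy|yx]; first by apply: ncl; exact: subset_closure.
  by apply: ncl; rewrite yx; exact: closureS AF _ clx.
- have [y Ey] := E0 false.
  have : (A `|` [set x]) y by rewrite AE; left.
  have ncl : ~ closure (E true) y.
    by move=> cy; have : (E false `&` closure (E true)) y by []; rewrite s1.
  case=> [/AT Fy|yx]; first by apply: ncl; exact: subset_closure.
  by apply: ncl; rewrite yx; exact: closureS AT _ clx.
Qed.

(** A point of [K] in the closure of a component belongs to it, by [connected_add_limit]. So [z]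
    avoids the closures of the other components, and a finite union of these is closed. *)
Lemma component_nbhs K z : finite_set (components K) -> K z ->
  exists2 rho : R, 0 < rho & forall w, disc z rho w -> K w ->
    connected_component K z w.
Proof.
move=> finK Kz.
pose P := components K `\ connected_component K z.
have finP : finite_set P by exact: finite_setD.
have cU : closed (\bigcup_(C in P) closure C).
  by apply: closed_bigcup => // C _; exact: closed_closure.
have nz : ~ (\bigcup_(C in P) closure C) z.
  move=> [C [[w Kw Cw] Cz] zC]; apply: Cz.
  rewrite -Cw; apply/esym/same_connected_component/connected_component_sym.
  exists (C `|` [set z]); last by right.
  rewrite -Cw; split; first by left; exact: connected_component_refl.
    by move=> v [/connected_component_sub//|->].
  apply: connected_add_limit; first exact: component_connected.
  by rewrite Cw.
have /nbhs_cmod[rho rho0 hrho] : nbhs z (~` \bigcup_(C in P) closure C).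
  by apply: open_nbhs_nbhs; split => //; exact: closed_openC.
exists rho => // w wz Kw; apply: contrapT => nzw.
apply: (hrho w wz); exists (connected_component K w).
  split; first by exists w.
  move=> /= e; apply: nzw; rewrite -e; exact: connected_component_refl.
by apply: subset_closure; exact: connected_component_refl.
Qed.

End Topology.

(** * Bounded orbits *)

Section BoundedOrbits.
Context (R : realType) (f : Cplx R -> Cplx R).
Hypothesis hf : holo f.
Implicit Types (z w x y a b : Cplx R).

Local Notation K := (bounded_orbit_set f).

(** In the order of [Cplx R] an upper bound of a modulus is itself real. *)
Lemma bounded_orbitP z :
  K z <-> exists M : R, forall n, cmod (iter n f z) <= M.
Proof.
split=> [[M hM]|[M hM]].
  exists (re M) => n; have := hM n; rewrite normCE.
  by case: M {hM} => a b; rewrite lecE => /andP[].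
by exists (mkc M 0) => n; rewrite normCE leCE.
Qed.

Lemma holo_iter n : holo (iter n f).
Proof.
elim: n => [|n ih]; first exact: holo_id.
by move=> z; eexists; apply: (cdiff_comp (holoP z ih) (holoP (iter n f z) hf)).
Qed.

Lemma bounded_orbit_iter m z : K (iter m f z) <-> K z.
Proof.
elim: m => [//|m ih]; rewrite -ih iterS; move: (iter m f z) => {ih}w.
split=> /bounded_orbitP[M hM]; apply/bounded_orbitP.
- exists (Num.max M (cmod w)) => -[|n]; first by rewrite /= le_max lexx orbT.
  by rewrite iterSr le_max hM.
- by exists M => n; rewrite -iterSr.
Qed.

Lemma orbit_unbounded x (B : R) : ~ K x -> exists2 m, (0 < m)%N & B < cmod (iter m f x).
Proof.
move=> nK; apply: contrapT => h; apply: nK; apply/bounded_orbitP.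
(* Covering iterate 0 by [cmod x] gives a positive index, as [no_expanding_disc] requires. *)
exists (Num.max B (cmod x)) => -[|n]; first by rewrite le_max lexx orbT.
rewrite le_max; apply/orP; left; rewrite leNgt; apply/negP => lt.
by apply: h; exists n.+1.
Qed.

(** All iterates are bounded at [y] by one constant, so an iterate omitting such a pair is bounded
    at [x] by a [C] independent of iterate and pair; [m] is taken with [f^m(x)] beyond [C]. *)
Lemma blow_up y x (r A d : R) : K y -> ~ K x -> 0 < r -> 0 < d ->
  cdisc y (r / 2) x -> exists2 m, (0 < m)%N & forall a b,
    cmod a <= A -> cmod b <= A -> d <= cmod (a - b) ->
    exists2 z, disc y r z & iter m f z = a \/ iter m f z = b.
Proof.
move=> /bounded_orbitP[M hM] nKx r0 d0 xy.
have [C hC] := schottky A M d0.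
have [m m0 mC] := orbit_unbounded C nKx; exists m => // a b aA bA dab.
apply: contrapT => h.
have omit z : disc y r z -> iter m f z != a /\ iter m f z != b.
  by move=> zy; split; apply/eqP => e; apply: h; exists z => //; [left|right].
have := hC (iter m f) y r a b (holo_iter m) r0 aA bA dab omit (hM m) x xy.
by rewrite leNgt mC.
Qed.

Lemma iter_compact_bounded z (r : R) (p : nat) : 0 <= r ->
  exists M : R, forall s, (s < p)%N -> forall w, cdisc z r w -> cmod (iter s f w) <= M.
Proof.
move=> r0; elim: p => [|p [M hM]]; first by exists 0.
have [|w _ hw] := @disc_max R (fun v => cmod (iter p f v)) z r r0.
  move=> v _; apply: continuous_cmod_comp; exact: (@holo_continuous R _ (holo_iter p) v).
exists (Num.max M (cmod (iter p f w))) => s; rewrite ltnS leq_eqVlt => /orP[/eqP ->|sp] v vz.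
  by rewrite le_max hw// orbT.
by rewrite le_max (hM s sp).
Qed.

(* A point of the closed set C \ K whose orbit under f^p never leaves the disc:
   it exists by compactness, since every finite stretch can be pulled back. *)
Lemma no_expanding_disc x (r : R) p : open K -> ~ K x -> 0 <= r -> (0 < p)%N ->
  ~ (forall w, cdisc x r w -> exists2 z, cdisc x r z & iter p f z = w).
Proof.
move=> oK nKx r0 p0 cov.
have back k : exists z, ~ K z /\ forall j, (j <= k)%N -> cdisc x r (iter (p * j) f z).
  elim: k => [|k [z [nKz hz]]].
    exists x; split => // j; rewrite leqn0 => /eqP ->.
    by rewrite muln0 /cdisc/= subrr cmod0.
  have zx : cdisc x r z by have := hz 0%N isT; rewrite muln0.
  have [w wx wz] := cov z zx.
  exists w; split; first by move=> /(bounded_orbit_iter p); rewrite wz.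
  move=> [|j] jk; first by rewrite muln0.
  by rewrite mulnS addnC iterD wz; exact: hz.
have [u hu] := choice back.
have [|z [zx cz]] := @compact_cdisc R x r (u @ \oo).
  by exists 0%N => // n _ /=; have [_ /(_ 0%N isT)] := hu n; rewrite muln0.
(* Closed conditions that hold eventually along [u] pass to the cluster point [z]. *)
have inall (B : set (Cplx R)) : closed B -> (exists N, forall n, (N <= n)%N -> B (u n)) -> B z.
  move=> cB [N hN]; apply: cB; move: cz; rewrite clusterE; apply.
  by exists N => // n Nn; exact: hN.
have nKz : ~ K z.
  apply: (inall (~` K)); first exact: open_closedC.
  by exists 0%N => n _; have [] := hu n.
apply: nKz; apply/bounded_orbitP.
have stay j : cdisc x r (iter (p * j) f z).
  apply: (inall [set w | cdisc x r (iter (p * j) f w)]).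
    have := @holo_continuous R _ (holo_iter (p * j)) => /continuous_closedP; apply.
    exact: closed_cdisc.
  by exists j => n jn; have [_] := hu n; apply.
(* Between multiples of [p] the orbit is controlled by the first [p] iterates on the disc. *)
have [M hM] := iter_compact_bounded x p r0.
exists M => n; rewrite (divn_eq n p) addnC mulnC iterD.
by apply: hM; [rewrite ltn_mod | exact: stay].
Qed.

(* If K were open, take discs D1, D2 about two boundary points: by blow-up some
   iterate of each covers D1 or D2, so one of them is covered by its own image. *)
Lemma bounded_orbit_not_open p q : K p -> K q ->
  ~ connected_component K p q -> ~ open K.
Proof.
move=> Kp Kq pq oK.
have [x1 [x2 [x12 [c1 n1] [c2 n2]]]] := two_boundary_points oK Kp Kq pq.
pose r := cmod (x1 - x2) / 4.
have c12 : 0 < cmod (x1 - x2) by rewrite cmod_gt0 subr_eq0.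
have r0 : 0 < r by rewrite divr_gt0.
pose A := cmod x1 + cmod x2 + r.
have sep a b : cdisc x1 r a -> cdisc x2 r b -> [/\ cmod a <= A, cmod b <= A & r <= cmod (a - b)].
  rewrite /cdisc/= => a1 b2; split.
  - by have := cmodD (a - x1) x1; rewrite subrK /A; have := cmod_ge0 x2; lra.
  - by have := cmodD (b - x2) x2; rewrite subrK /A; have := cmod_ge0 x1; lra.
  - have := cmod_tri x1 x2 a; have := cmod_tri a x2 b; rewrite (cmodBC x1 a).
    by rewrite /r in a1 b2 *; lra.
pose cov (x w : Cplx R) m := forall v, cdisc w r v -> exists2 z, cdisc x r z & iter m f z = v.
have step x : closure K x -> ~ K x -> exists2 m, (0 < m)%N & cov x x1 m \/ cov x x2 m.
  move=> cx nx.
  have [|y Ky yx] := (closure_cmod K x).1 cx (r / 4); first by rewrite divr_gt0.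
  have [|||m m0 hm] := @blow_up y x (r / 2) A r Ky nx.
  - by rewrite divr_gt0.
  - exact: r0.
  - by rewrite /cdisc/= cmodBC; lra.
  (* If neither disc were covered, a missed point of each would form a pair contradicting
     [blow_up]. *)
  exists m => //; apply: contrapT => /not_orP[h1 h2].
  move: h1 => /existsNP[a /not_implyP[a1 na]].
  move: h2 => /existsNP[b /not_implyP[b2 nb]].
  have [aA bA ab] := sep a b a1 b2.
  have [z zy] := hm a b aA bA ab.
  have zx : cdisc x r z.
    rewrite /cdisc/=; apply: (le_trans (cmod_tri z x y)).
    by move: zy; rewrite /disc/=; lra.
  by move=> [e|e]; [apply: na | apply: nb]; exists z.
have nexp x m : ~ K x -> (0 < m)%N -> ~ cov x x m.
  by move=> nx m0; exact: (no_expanding_disc oK nx (ltW r0) m0).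
have [m1 m10 [h11|h12]] := step x1 c1 n1; first exact: (nexp x1 m1 n1 m10).
have [m2 m20 [h21|h22]] := step x2 c2 n2; last exact: (nexp x2 m2 n2 m20).
apply: (nexp x1 (m2 + m1)%N n1); first by rewrite addn_gt0 m20.
move=> v /h21[w /h12[z zx <-] <-]; exists z => //.
by rewrite iterD.
Qed.

Lemma component_iter m z w : connected_component K z w ->
  connected_component K (iter m f z) (iter m f w).
Proof.
move=> [C [Cz CK cC] Cw]; exists (iter m f @` C); last by exists w.
split; first by exists z.
  by move=> _ [v Cv <-]; apply/bounded_orbit_iter; exact: CK.
apply: connected_continuous_connected => //.
by apply: continuous_subspaceT; exact: holo_continuous (holo_iter m).
Qed.

(** By backward invariance the fibres over [p] and [q] lie in [K], so finiteness of [K] would bring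
    in [finite_preimages_poly]. *)
Lemma bounded_orbit_infinite p q : ~ (exists P : {poly Cplx R}, forall z, f z = P.[z]) ->
  K p -> K q -> p != q -> infinite_set K.
Proof.
move=> npoly Kp Kq pq finK; apply: npoly.
have fib a : K a -> finite_set [set z | f z = a].
  move=> Ka; apply: sub_finite_set finK => z /= za.
  by apply/(bounded_orbit_iter 1); rewrite /= za.
exact: (finite_preimages_poly hf pq (fib p Kp) (fib q Kq)).
Qed.

(* An isolated point al of K would have a neighbourhood on which f^m meets K in
   the single point f^m(al), hence omits two of any three points of K. *)
Lemma no_singleton_component al : infinite_set K ->
  finite_set (components K) -> K al ->
  exists2 w, connected_component K al w & w != al.
Proof.
move=> infK finC Kal; apply: contrapT => h.
have single w : connected_component K al w -> w = al.
  by move=> Cw; apply: contrapT => wal; apply: h; exists w => //; apply/eqP.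
have [rho rho0 hrho] := component_nbhs finC Kal.
have iso z : disc al rho z -> K z -> z = al by move=> zr Kz; apply: single; exact: hrho.
have next (s : seq (Cplx R)) : exists2 a, K a & a \notin s.
  apply: contrapT => hs; apply: infK.
  apply: (@sub_finite_set _ _ [set` s]); last exact: finite_seq.
  by move=> a Ka; apply: contrapT => /negP nas; apply: hs; exists a.
have [p1 K1 _] := next [::].
have [p2 K2] := next [:: p1]; rewrite inE => p21.
have [p3 K3] := next [:: p1; p2]; rewrite !inE negb_or => /andP[p31 p32].
pose A := cmod p1 + cmod p2 + cmod p3.
pose d := Num.min (cmod (p1 - p2)) (Num.min (cmod (p1 - p3)) (cmod (p2 - p3))).
have d0 : 0 < d.
  rewrite !lt_min !cmod_gt0 !subr_eq0 (eq_sym p1) p21.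
  by rewrite (eq_sym p1) p31 (eq_sym p2) p32.
pose x := al + mkc (rho / 4) 0.
have cx : cmod (x - al) = rho / 4.
  by rewrite /x (addrC al) addrK cmod_real ger0_norm//; lra.
have nKx : ~ K x.
  move=> Kx; have : x = al by apply: iso => //; rewrite /disc/= cx; lra.
  by move=> xal; move: cx; rewrite xal subrr cmod0; lra.
have [|m _ hm] := @blow_up al x rho A d Kal nKx rho0 d0.
  by rewrite /cdisc/= cx; lra.
have hit a b : K a -> K b -> cmod a <= A -> cmod b <= A -> d <= cmod (a - b) ->
    iter m f al = a \/ iter m f al = b.
  move=> Ka Kb aA bA dab; have [z zr e] := hm a b aA bA dab.
  have Kz : K z by apply/(bounded_orbit_iter m); case: e => ->.
  by rewrite -(iso z zr Kz).
have g1 := cmod_ge0 p1; have g2 := cmod_ge0 p2; have g3 := cmod_ge0 p3.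
have a1 : cmod p1 <= A by rewrite /A; lra.
have a2 : cmod p2 <= A by rewrite /A; lra.
have a3 : cmod p3 <= A by rewrite /A; lra.
have d12 : d <= cmod (p1 - p2) by rewrite ge_min lexx.
have d13 : d <= cmod (p1 - p3) by rewrite !ge_min lexx orbT.
have d23 : d <= cmod (p2 - p3) by rewrite !ge_min lexx !orbT.
have h12 := hit p1 p2 K1 K2 a1 a2 d12.
have h13 := hit p1 p3 K1 K3 a1 a3 d13.
have h23 := hit p2 p3 K2 K3 a2 a3 d23.
move/eqP in p21; move/eqP in p31; move/eqP in p32.
(* Each of the three points is absent from one of the three pairs, so one value cannot lie in all of
   them. *)
by case: h12 => e1; [case: h23 => e2 | case: h13 => e2];
   rewrite e1 in e2; congruence.
Qed.

End BoundedOrbits.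

Theorem theorem1p1 (R : realType) (f : Cplx R -> Cplx R) :
  transcendental_entire f ->
  connected (bounded_orbit_set f) \/ infinite_set (components (bounded_orbit_set f)).
Proof.
move=> [/entire_holo hf npoly].
apply: contrapT => /not_orP[nconn /contrapT finC].
set K := bounded_orbit_set f in nconn finC *.
have [p [q [Kp Kq pq]]] : exists p q, [/\ K p, K q & ~ connected_component K p q].
  apply: contrapT => h; apply: nconn.
  have [[p Kp]|K0] := pselect (K !=set0); last first.
    by rewrite (_ : K = set0); [exact: connected0 | exact/nonemptyPn].
  suff -> : K = connected_component K p by exact: component_connected.
  apply/seteqP; split; last exact: connected_component_sub.
  by move=> q Kq; apply: contrapT => pq; apply: h; exists p, q.
have npq : p != q.
  by apply: contra_notN pq => /eqP ->; exact: connected_component_refl.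
have infK : infinite_set K by exact: (bounded_orbit_infinite hf npoly Kp Kq npq).
(* A second point in each component: [blow_up] promises only one of two values, and either must
   identify the component. *)
have [p' pp' p'p] := no_singleton_component hf infK finC Kp.
have [q' qq' q'q] := no_singleton_component hf infK finC Kq.
have [z0 Kz0 z0P] : exists2 z0, K z0 & forall e : R, 0 < e -> exists2 x, ~ K x & cmod (x - z0) < e.
  apply: contrapT => h; apply: (bounded_orbit_not_open hf Kp Kq pq).
  rewrite openE => z Kz; apply/nbhs_cmod; apply: contrapT => hz; apply: h.
  exists z => // e e0; apply: contrapT => he; apply: hz; exists e => // w wz.
  by apply: contrapT => nKw; apply: he; exists w.
have [rho rho0 hrho] := component_nbhs finC Kz0.
have [|x nKx xz0] := z0P (rho / 2); first by rewrite divr_gt0.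
pose A := cmod p + cmod p' + cmod q + cmod q'.
pose d := Num.min (cmod (p - p')) (cmod (q - q')).
have d0 : 0 < d by rewrite lt_min !cmod_gt0 !subr_eq0 eq_sym p'p eq_sym q'q.
have [m _ hm] := @blow_up R f hf z0 x rho A d Kz0 nKx rho0 d0 (ltW xz0).
have g1 := cmod_ge0 p; have g2 := cmod_ge0 p'; have g3 := cmod_ge0 q; have g4 := cmod_ge0 q'.
(* The value taken lies in [K], hence so does its preimage [z], which shares the component of [z0]
   by the choice of [rho]; the iterate preserves this. *)
have hit a a' : K a -> connected_component K a a' -> cmod a <= A -> cmod a' <= A ->
    d <= cmod (a - a') -> connected_component K a (iter m f z0).
  move=> Ka aa' aA a'A daa'.
  have [z zr e] := hm a a' aA a'A daa'.
  have az : connected_component K a (iter m f z).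
    by case: e => -> //; exact: connected_component_refl.
  have Kz : K z by apply/(bounded_orbit_iter f m); exact: connected_component_sub az.
  apply: connected_component_trans az _.
  by apply: component_iter => //; apply: connected_component_sym; exact: hrho.
apply: pq; apply: (@connected_component_trans _ K (iter m f z0)).
  by apply: (hit p p') => //; rewrite /A ?ge_min ?lexx//; lra.
apply: connected_component_sym.
by apply: (hit q q') => //; rewrite /A ?ge_min ?lexx ?orbT//; lra.
Qed.
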